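(* Let $\mu$ be the Lebesgue measure on $\mathbb{R}$, $H=L_2(\mathbb{R},\mu)$ over $\mathbb{C}$, and $A=-i\frac{d}{dx}$ with $\mathrm{dom}(A)=C_c^\infty(\mathbb{R})$. Let $(S_n)_n$ be the $A$-sampling-scale sequence for this operator described in the context. Let $\varphi:\mathbb{R}\to\mathbb{R}_{>0}$, $\varphi(\omega)=\left(\frac{\pi}{2}\right)^{1/2}e^{-\frac{\pi^2\omega^2}{2}}$, let $\mu'$ be the probability measure on $\mathrm{Borel}(\mathbb{R})$ with $d\mu'=\varphi\,d\mu$, and let $X:\mathbb{R}\to Q$ be $X(\omega)=\left(\frac{1}{\sqrt{2^j}}e^{-\pi i q_j\omega}\right)_{j\in\mathbb{N}}$. Then $(S_n)_n$ is convergent, and the resulting measure $\hat\mu$ is the pushforward $\hat\mu=X_{\#}(\mu')$. Furthermore, if $U:H\to L_2(\mathbb{R},\mu')$ is given by $U(g)=\hat U(g)\circ X$, then $U$ is a unitary map and for any $\psi\in L_2(\mathbb{R},\mu)\cap L_1(\mathbb{R},\mu)$, $$(U(\psi))(\omega)=\frac{1}{\sqrt{2\varphi(\omega)}}\int_{\mathbb{R}}e^{-\pi i\omega t}\psi(t)\,d\mu(t)$$ for almost all $\omega\in\mathbb{R}$. Finally, if $m:\mathbb{R}\to\mathbb{R}$ is given by $m=\hat m\circ X$, then $m(\omega)=\pi\omega$ almost everywhere in $\mathbb{R}$, and for any $z\in\mathrm{dom}(A)=C_c^\infty(\mathbb{R})$, $U(Az)=m\cdot U(z)$.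
   Context: $\mathbb{N}=\{1,2,\dots\}$; inner products are linear in the first argument. $(q_j)_{j\in\mathbb{N}}$ is a fixed enumeration of $\mathbb{Q}$ with $q_1=0$. Sequences $(S_n)$ below are indexed by integers $n\ge2$. Sampling: $s_l^{(n)}=[\frac{l}{n!},\frac{l+1}{n!})$ for integers $-n!^2\le l<n!^2$ (where $n!^2=(n!)^2$); $H_n=\mathrm{span}(\{\mathbf 1_{s_l^{(n)}}\}_{l=-n!^2}^{n!^2-1})\subset H$; $RS_n$ is the linear map on $H_n$ with $RS_n\mathbf 1_{s_l^{(n)}}=\mathbf 1_{s_{l+1}^{(n)}}$ for $l<n!^2-1$ and $RS_n\mathbf 1_{s_{n!^2-1}^{(n)}}=\mathbf 1_{s_{-n!^2}^{(n)}}$, and $LS_n=RS_n^{-1}$; $A_n=-i\frac{LS_n-RS_n}{2/n!}$; $\Omega_n=\{f_k^{(n)}\}_{k=-n!^2}^{n!^2-1}$ with $f_k^{(n)}=\frac{1}{\sqrt{2n!}}\sum_{l=-n!^2}^{n!^2-1}e^{2\pi i l\frac{k}{2n!^2}}\mathbf 1_{s_l^{(n)}}$ (an orthonormal eigenbasis of $A_n$). Scale: $E(t)=\left(\frac2\pi\right)^{1/4}e^{-t^2}$; $(L_n)$ is a fixed integer sequence with $0<L_n<n!^2-1$ and $\lim_n\frac{n!^{3/2}}{L_n}=\lim_n\frac{L_n}{n!^2}=0$; $E^{(n)}=\sum_{l=-L_n}^{L_n}E\left(\frac{l}{n!}\right)\mathbf 1_{s_l^{(n)}}+\frac{i}{n!}\mathbf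 1_{s_0^{(n)}}\in H_n$; $N_n=n!$, and for $j\le N_n$, $e_j^{(n)}=RS_n^{\lfloor n!q_j\rfloor}E^{(n)}$ and $c_j^{(n)}=\frac{1}{2^j(1-2^{-N_n})\|E^{(n)}\|^2}$. $S_n=(H_n,A_n,\Omega_n,(e_j^{(n)},c_j^{(n)})_{j=1}^{N_n})$. One has $e_j:=\lim_ne_j^{(n)}=E(\cdot-q_j)$ and $c_j:=\lim_nc_j^{(n)}=2^{-j}$. Associated objects: $\mu_n$ is the probability measure on $\Omega_n$ with $\mu_n(\{f\})=\sum_{j=1}^{N_n}c_j^{(n)}|\langle e_j^{(n)},f\rangle|^2$ (which is $>0$); $U_n:H_n\to L_2(\Omega_n,\mu_n)$ is $(U_n(x))(f)=\langle x,f\rangle/\sqrt{\mu_n(\{f\})}$. $Q=\overline{\mathbb{D}}^{\mathbb{N}}$ with the product topology, where $\overline{\mathbb{D}}=\{z\in\mathbb{C}:|z|\le1\}$, with coordinate projections $\pi_j$. $X_n:\Omega_n\to Q$ is given by $\pi_j\circ X_n=\sqrt{c_j^{(n)}}\,U_n(e_j^{(n)})$ if $j\le N_n$ and $\pi_j\circ X_n=0$ otherwise. $(S_n)_n$ is convergent if $\left(\int_{\Omega_n}h\circ X_n\,d\mu_n\right)_n$ converges for every continuous $h:Q\to\mathbb{C}$. In that case: $\hat\mu$ is the unique probability measure on $\mathrm{Borel}(Q)$ with $\int_Qh\,d\hat\mu=\lim_n\int_{\Omega_n}(h\circ X_n)\,d\mu_n$ for all continuous $h$; $\hat U:H\to L_2(Q,\hat\mu)$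 is the unique linear isometry with $\hat U(e_j)=\frac{1}{\sqrt{c_j}}\pi_j$ for all $j$; and $\hat m$ is the unique real-valued element of $L_2(Q,\hat\mu)$ with $\hat U(Ax)=\hat m\cdot\hat U(x)$ for all $x\in\mathrm{dom}(A)$ (existence and uniqueness of $\hat\mu,\hat U,\hat m$ hold for every convergent $A$-sampling-scale sequence). *)

(* Defs.v *)
From HB Require Import structures.
From mathcomp Require Import all_boot all_order all_algebra.
From mathcomp Require Import complex.
From mathcomp Require Import all_classical all_reals all_analysis.
From mathcomp Require Import ring zify.

Set Implicit Arguments.
Unset Strict Implicit.
Unset Printing Implicit Defensive.

Import Order.TTheory GRing.Theory Num.Theory.
Import numFieldTopology.Exports numFieldNormedType.Exports.

Local Open Scope classical_set_scope.
Local Open Scope ring_scope.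

(* The library puts the norm topology on the alias R[i]^o only. *)
HB.instance Definition _ (R : realType) := PseudoPointedMetric.copy R[i] R[i]^o.
HB.instance Definition _ (R : realType) := NormedModule.copy R[i] R[i]^o.

Notation cnorm := Normc.normc.

Lemma normC_cnorm (R : realType) (z : R[i]) : `|z| = (cnorm z)%:C%C.
Proof. by []. Qed.

Lemma cnorm_real (R : realType) (x : R) : cnorm x%:C%C = `|x|.
Proof. by rewrite /= expr0n addr0 sqrtr_sqr. Qed.

Lemma cnorm_ge0 (R : realType) (z : R[i]) : 0 <= cnorm z.
Proof. by case: z => a b; exact: sqrtr_ge0. Qed.

Definition expi {R : realType} (t : R) : R[i] := (cos t +i* sin t)%C.

Lemma cnorm_expi (R : realType) (t : R) : cnorm (expi t) = 1.
Proof. by rewrite /= cos2Dsin2 sqrtr1. Qed.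

(* Elements of L_1 and L_2 are represented by measurable functions; equality of
   elements is equality almost everywhere. *)

Section complex_L2.
Context d (T : measurableType d) (R : realType).
Variable mu : {measure set T -> \bar R}.
Implicit Types f g : T -> R[i].

Definition cmeasurable f :=
  measurable_fun [set: T] (fun x => complex.Re (f x)) /\
  measurable_fun [set: T] (fun x => complex.Im (f x)).

Definition Cintegral f : R[i] :=
  ((\int[mu]_x complex.Re (f x)) +i* (\int[mu]_x complex.Im (f x)))%C.

Definition in_L1 f :=
  cmeasurable f /\ (\int[mu]_x (cnorm (f x))%:E < +oo)%E.

Definition in_L2 f :=
  cmeasurable f /\ (\int[mu]_x (cnorm (f x) ^+ 2)%:E < +oo)%E.

Definition aeeq f g := {ae mu, forall x, f x = g x}.

Definition L2inner f g : R[i] := Cintegral (fun x => f x * (g x)^*%C).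

Definition L2norm f : R := Num.sqrt (\int[mu]_x (cnorm (f x) ^+ 2)).

End complex_L2.

Section L2_maps.
Context d1 (T1 : measurableType d1) d2 (T2 : measurableType d2) (R : realType).
Variables (mu : {measure set T1 -> \bar R}) (nu : {measure set T2 -> \bar R}).
Implicit Type V : (T1 -> R[i]) -> (T2 -> R[i]).

(* The second clause says that V is well defined on classes. *)
Definition L2linear V :=
  [/\ forall f, in_L2 mu f -> in_L2 nu (V f),
      forall f g, in_L2 mu f -> in_L2 mu g ->
        aeeq mu f g -> aeeq nu (V f) (V g)
    & forall (a : R[i]) f g, in_L2 mu f -> in_L2 mu g ->
        aeeq nu (V (fun x => a * f x + g x)) (fun y => a * V f y + V g y)].

Definition L2isometry V :=
  L2linear V /\ forall f, in_L2 mu f -> L2norm nu (V f) = L2norm mu f.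

Definition L2unitary V :=
  [/\ L2linear V,
      forall f g, in_L2 mu f -> in_L2 mu g ->
        L2inner nu (V f) (V g) = L2inner mu f g
    & forall h, in_L2 nu h -> exists2 f, in_L2 mu f & aeeq nu (V f) h].

End L2_maps.

(* Indices in {1, 2, ...} are shifted by one throughout: [j : nat] stands for
   the index j + 1. *)

Definition disc (R : realType) : set R[i] := [set z | `|z| <= 1].
Arguments disc : clear implicits.

Lemma disc0 (R : realType) : (0 : R[i]) \in disc R.
Proof. by rewrite inE /disc /= normr0. Qed.

HB.instance Definition _ (R : realType) :=
  isPointed.Build (set_type (disc R)) (exist _ 0 (disc0 R)).

Definition Q (R : realType) := prod_topology (fun _ : nat => set_type (disc R)).

HB.instance Definition _ (R : realType) := Topological.on (Q R).
HB.instance Definition _ (R : realType) :=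
  isPointed.Build (Q R) (fun _ => point).

Definition BorelQ (R : realType) := g_sigma_algebraType (@open (Q R)).

(* Junk value 0 outside the disc; see [projX] and [projXn]. *)
Definition to_disc (R : realType) (z : R[i]) : set_type (disc R) :=
  insubd (point : set_type (disc R)) z.

Definition proj_Q (R : realType) (j : nat) (x : Q R) : R[i] := \val (x j).

Lemma to_discK (R : realType) (z : R[i]) : `|z| <= 1 -> \val (to_disc z) = z.
Proof.
by move=> z1; rewrite /to_disc insubdK //; exact: mem_set.
Qed.

Section sampling_scale.
Variable R : realType.

Notation leb := (@lebesgue_measure R).

(* The tuple (H_n, A_n, Omega_n, (e_j, c_j)_(j <= N_n)); only the values
   [sample_e j] and [sample_c j] with [j < sample_N] are meaningful. *)
Record sample := Sample {
  sample_H : set (R -> R[i]);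
  sample_A : (R -> R[i]) -> (R -> R[i]);
  sample_Omega : set (R -> R[i]);
  sample_N : nat;
  sample_e : nat -> (R -> R[i]);
  sample_c : nat -> R }.

(* mu_n({f}) *)
Definition mass (S : sample) (f : R -> R[i]) : R :=
  \sum_(j < sample_N S)
    sample_c S j * cnorm (L2inner leb (sample_e S j) f) ^+ 2.

Definition Un (S : sample) (x f : R -> R[i]) : R[i] :=
  L2inner leb x f / (Num.sqrt (mass S f))%:C%C.

Definition Xn (S : sample) (f : R -> R[i]) : Q R := fun j =>
  to_disc (if (j < sample_N S)%N
           then (Num.sqrt (sample_c S j))%:C%C * Un S (sample_e S j) f
           else 0).

Lemma projXn (S : sample) (f : R -> R[i]) (j : nat) :
    (forall i, 0 <= sample_c S i) ->
  proj_Q j (Xn S f) =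
    if (j < sample_N S)%N
    then (Num.sqrt (sample_c S j))%:C%C * Un S (sample_e S j) f else 0.
Proof.
move=> c_ge0; apply: to_discK; case: ifPn => [jN|_]; last by rewrite normr0.
rewrite normC_cnorm lecR /Un !Normc.normcM Normc.normcV !cnorm_real.
rewrite !ger0_norm ?sqrtr_ge0 //; set w := cnorm _.
have w0 : 0 <= w by exact: cnorm_ge0.
have [->|m0] := eqVneq (Num.sqrt (mass S f)) 0.
  by rewrite invr0 mulr0 mulr0.
have mgt0 : 0 < Num.sqrt (mass S f) by rewrite lt_neqAle eq_sym m0 sqrtr_ge0.
rewrite mulrA ler_pdivrMr // mul1r -(ger0_norm w0) -sqrtr_sqr -sqrtrM //.
apply: ler_wsqrtr; rewrite /mass (bigD1 (Ordinal jN)) //= -/w lerDl.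
by apply: sumr_ge0 => i _; rewrite mulr_ge0 // sqr_ge0.
Qed.

(* The integral of h o X_n over the finite probability space (Omega_n, mu_n). *)
Definition integral_n (S : sample) (h : Q R -> R[i]) : R[i] :=
  \sum_(f \in sample_Omega S) (mass S f)%:C%C * h (Xn S f).

Definition convergent (S : nat -> sample) :=
  forall h : Q R -> R[i], continuous h ->
    cvg (integral_n (S n) h @[n --> \oo]).

Definition is_hat_mu (S : nat -> sample) (nu : probability (BorelQ R) R) :=
  forall h : Q R -> R[i], continuous h ->
    integral_n (S n) h @[n --> \oo] --> Cintegral nu h.

(* [e] and [c] are the limits e_j and c_j of the sequence. *)
Definition lim_e (S : nat -> sample) (j : nat) (e : R -> R[i]) :=
  in_L2 leb e /\
  L2norm leb (fun t => sample_e (S n) j t - e t) @[n --> \oo] --> (0 : R).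

Definition lim_c (S : nat -> sample) (j : nat) (c : R) :=
  sample_c (S n) j @[n --> \oo] --> c.

Definition is_hat_U (S : nat -> sample) (nu : probability (BorelQ R) R)
    (U : (R -> R[i]) -> (Q R -> R[i])) :=
  L2isometry leb nu U /\
  forall (j : nat) (e : R -> R[i]) (c : R), lim_e S j e -> lim_c S j c ->
    aeeq nu (U e) (fun x => (Num.sqrt c)^-1%:C%C * proj_Q j x).

Definition is_hat_m (dom : set (R -> R[i])) (A : (R -> R[i]) -> (R -> R[i]))
    (nu : probability (BorelQ R) R) (U : (R -> R[i]) -> (Q R -> R[i]))
    (m : Q R -> R) :=
  in_L2 nu (fun x => (m x)%:C%C) /\
  forall x, dom x -> aeeq nu (U (A x)) (fun y => (m y)%:C%C * U x y).

End sampling_scale.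

Section momentum.
Variable R : realType.

Definition smooth (f : R -> R) := forall n x, derivable (derive1n n f) x 1.

Definition Cc_infty : set (R -> R[i]) :=
  [set f | [/\ smooth (fun x => complex.Re (f x)),
               smooth (fun x => complex.Im (f x))
             & compact (closure [set x | f x != 0])]].

Definition momentum (f : R -> R[i]) : R -> R[i] := fun x =>
  - 'i%C * (derive1 (fun y => complex.Re (f y)) x +i*
            derive1 (fun y => complex.Im (f y)) x)%C.

End momentum.

Section example.
Variable R : realType.

Notation leb := (@lebesgue_measure R).

(* Half the number of cells. *)
Definition half (n : nat) : nat := (n`! ^ 2)%N.

Definition cell (n : nat) (l : int) : set R :=
  `[l%:~R / n`!%:R, (l + 1)%:~R / n`!%:R[.

Definition one_cell (n : nat) (l : int) : R -> R[i] :=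
  fun t => (\1_(cell n l) t)%:C%C.

Definition cell_sum (n : nat) (a : int -> R[i]) (sigma : int -> int) :
    R -> R[i] :=
  fun t => \sum_(k < (half n).*2)
    a (k%:Z - (half n)%:Z) * one_cell n (sigma (k%:Z - (half n)%:Z)) t.

Definition Hn (n : nat) : set (R -> R[i]) :=
  [set f | exists a : int -> R[i], f = cell_sum n a id].

Definition next_cell (n : nat) (l : int) : int :=
  if l < (half n)%:Z - 1 then l + 1 else - (half n)%:Z.

Definition prev_cell (n : nat) (l : int) : int :=
  if - (half n)%:Z < l then l - 1 else (half n)%:Z - 1.

(* The coordinate of f in H_n at cell l is its value at the left end l / n!. *)
Definition coord_cell (n : nat) (f : R -> R[i]) (l : int) : R[i] :=
  f (l%:~R / n`!%:R).

Definition RS (n : nat) (f : R -> R[i]) : R -> R[i] :=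
  cell_sum n (coord_cell n f) (next_cell n).

Definition LS (n : nat) (f : R -> R[i]) : R -> R[i] :=
  cell_sum n (coord_cell n f) (prev_cell n).

(* RS and LS are the linear maps on H_n determined by their values on the
   indicators of the cells, and they are inverse to each other. *)
Definition in_range (n : nat) (l : int) : bool :=
  - (half n)%:Z <= l < (half n)%:Z.

Lemma next_range n l : in_range n l -> in_range n (next_cell n l).
Proof. by rewrite /in_range /next_cell; case: ifP; lia. Qed.

Lemma prev_range n l : in_range n l -> in_range n (prev_cell n l).
Proof. by rewrite /in_range /prev_cell; case: ifP; lia. Qed.

Lemma next_cellK n l : in_range n l -> prev_cell n (next_cell n l) = l.
Proof. by rewrite /in_range /prev_cell /next_cell; do 2 case: ifP; lia. Qed.

Lemma prev_cellK n l : in_range n l -> next_cell n (prev_cell n l) = l.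
Proof. by rewrite /in_range /prev_cell /next_cell; do 2 case: ifP; lia. Qed.

Lemma index_range n (k : 'I_(half n).*2) :
  in_range n (k%:Z - (half n)%:Z).
Proof. by case: k => k /= kn; rewrite /in_range; lia. Qed.

Lemma coord_one_cell n l l' : coord_cell n (one_cell n l) l' = (l == l')%:R.
Proof.
have n0 : (0 : R) < (n`!%:R)^-1 by rewrite invr_gt0 ltr0n fact_gt0.
rewrite /coord_cell /one_cell indicE /cell mem_setE in_itv /=.
rewrite ler_pM2r // ltr_pM2r // ler_int ltr_int.
rewrite (_ : _ && _ = (l == l')); last by lia.
by rewrite rmorph_nat.
Qed.

Lemma cell_sum_one n sigma l : in_range n l ->
  cell_sum n (coord_cell n (one_cell n l)) sigma = one_cell n (sigma l).
Proof.
move=> lr; apply/funext => t; rewrite /cell_sum.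
have kP : (`|(l + (half n)%:Z)%R|%N < (half n).*2)%N.
  by move: lr; rewrite /in_range; lia.
have kE : `|(l + (half n)%:Z)%R|%N%:Z - (half n)%:Z = l.
  by move: lr; rewrite /in_range; lia.
rewrite (bigD1 (Ordinal kP)) //= kE coord_one_cell eqxx mul1r big1 ?addr0 //.
move=> k kN; rewrite coord_one_cell; case: eqP; rewrite ?mul0r // => lk.
by move: kN; rewrite -val_eqE /= lk; case/eqP; lia.
Qed.

Lemma RS_one_cell n l : in_range n l ->
  RS n (one_cell n l) = one_cell n (next_cell n l).
Proof. exact: cell_sum_one. Qed.

Lemma LS_one_cell n l : in_range n l ->
  LS n (one_cell n l) = one_cell n (prev_cell n l).
Proof. exact: cell_sum_one. Qed.

Lemma shift_cell_sum n sigma tau a :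
    (forall l, in_range n l -> in_range n (tau l)) ->
  cell_sum n (coord_cell n (cell_sum n a tau)) sigma =
  cell_sum n a (sigma \o tau).
Proof.
move=> tr; apply/funext => t; rewrite {1 3}/cell_sum.
under eq_bigr do rewrite /coord_cell /cell_sum mulr_suml.
rewrite exchange_big /=; apply: eq_bigr => k _.
under eq_bigr do rewrite -mulrA.
rewrite -mulr_sumr; congr (_ * _).
by rewrite -(cell_sum_one sigma (tr _ (index_range k))).
Qed.

Lemma RS_linear n (a : R[i]) f g :
  RS n (fun t => a * f t + g t) = (fun t => a * RS n f t + RS n g t).
Proof.
apply/funext => t; rewrite /RS /cell_sum mulr_sumr -big_split /=.
by apply: eq_bigr => k _; rewrite /coord_cell mulrDl mulrA.
Qed.

Lemma LS_linear n (a : R[i]) f g :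
  LS n (fun t => a * f t + g t) = (fun t => a * LS n f t + LS n g t).
Proof.
apply/funext => t; rewrite /LS /cell_sum mulr_sumr -big_split /=.
by apply: eq_bigr => k _; rewrite /coord_cell mulrDl mulrA.
Qed.

Lemma eq_cell_sum n a sigma tau :
    (forall l, in_range n l -> sigma l = tau l) ->
  cell_sum n a sigma = cell_sum n a tau.
Proof.
move=> st; apply/funext => t; apply: eq_bigr => k _.
by rewrite st // index_range.
Qed.

Lemma RSK n f : Hn n f -> LS n (RS n f) = f.
Proof.
move=> [a ->]; rewrite /LS /RS (shift_cell_sum (next_cell n)) //.
rewrite shift_cell_sum; last by move=> l; exact: next_range.
by apply: eq_cell_sum => l lr; exact: next_cellK.
Qed.

Lemma LSK n f : Hn n f -> RS n (LS n f) = f.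
Proof.
move=> [a ->]; rewrite /LS /RS (shift_cell_sum (prev_cell n)) //.
rewrite shift_cell_sum; last by move=> l; exact: prev_range.
by apply: eq_cell_sum => l lr; exact: prev_cellK.
Qed.

Definition RS_pow (n : nat) (z : int) : (R -> R[i]) -> (R -> R[i]) :=
  match z with Posz k => iter k (RS n) | Negz k => iter k.+1 (LS n) end.

Definition An (n : nat) (f : R -> R[i]) : R -> R[i] :=
  fun t => - 'i%C * ((LS n f t - RS n f t) / (2 / n`!%:R)%:C%C).

Definition fk (n : nat) (k : int) : R -> R[i] := fun t =>
  (Num.sqrt (2 * n`!%:R))^-1%:C%C *
  cell_sum n
    (fun l => expi (2 * pi * l%:~R * (k%:~R / (2 * n`!%:R ^+ 2)))) id t.

Definition Omega (n : nat) : set (R -> R[i]) :=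
  [set f | exists2 k : int, - (half n)%:Z <= k < (half n)%:Z & f = fk n k].

Definition E (t : R) : R := (2 / pi) `^ 4^-1 * expR (- t ^+ 2).

Definition En (L : nat -> nat) (n : nat) : R -> R[i] := fun t =>
  \sum_(k < (L n).*2.+1)
    (E ((k%:Z - (L n)%:Z)%:~R / n`!%:R))%:C%C *
      one_cell n (k%:Z - (L n)%:Z) t
  + 'i%C / n`!%:R * one_cell n 0 t.

Definition Sn (q : nat -> rat) (L : nat -> nat) (n : nat) : sample R :=
  {| sample_H := Hn n;
     sample_A := An n;
     sample_Omega := Omega n;
     sample_N := n`!;
     sample_e := fun j => RS_pow n (Num.floor (n`!%:R * q j)) (En L n);
     sample_c := fun j =>
       (2 ^+ j.+1 * (1 - 2 ^- n`!) * L2norm leb (En L n) ^+ 2)^-1 |}.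

Definition phi (w : R) : R :=
  Num.sqrt (pi / 2) * expR (- (pi ^+ 2 * w ^+ 2 / 2)).

Definition mu' : set (measurableTypeR R) -> \bar R :=
  fun B => (\int[leb]_(w in B) (phi w)%:E)%E.

Lemma phiE : phi = normal_pdf 0 pi^-1.
Proof.
have pi0 : (pi : R) != 0 by rewrite gt_eqF // pi_gt0.
rewrite normal_pdfE ?invr_eq0 //; apply/funext => w.
rewrite /phi /normal_peak /normal_fun subr0; congr (_ * expR _); last first.
  by rewrite exprVn -(mulr_natr (_ ^-1)); move: (pi) pi0 => p p0; field.
rewrite -sqrtrV ?mulrn_wge0 ?mulr_ge0 ?invr_ge0 ?pi_ge0 //.
congr (Num.sqrt _).
by rewrite exprVn -mulr_natr; move: (pi) pi0 => p p0; field.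
Qed.

Lemma mu'E : mu' = normal_prob 0 pi^-1.
Proof. by rewrite /mu' phiE. Qed.

Let mu'0 : mu' set0 = 0%E.
Proof. by rewrite mu'E measure0. Qed.

Let mu'_ge0 A : (0 <= mu' A)%E.
Proof. by rewrite mu'E; exact: measure_ge0. Qed.

Let mu'_sigma_additive : semi_sigma_additive mu'.
Proof. by rewrite mu'E; exact: measure_semi_sigma_additive. Qed.

HB.instance Definition _ :=
  isMeasure.Build _ _ _ mu' mu'0 mu'_ge0 mu'_sigma_additive.

Let mu'_setT : mu' [set: _] = 1%E.
Proof. by rewrite mu'E probability_setT. Qed.

HB.instance Definition _ :=
  @Measure_isProbability.Build _ _ R mu' mu'_setT.

Definition X (q : nat -> rat) (w : R) : Q R := fun j =>
  to_disc ((Num.sqrt (2 ^+ j.+1))^-1%:C%C * expi (- pi * ratr (q j) * w)).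

Lemma projX (q : nat -> rat) (w : R) (j : nat) :
  proj_Q j (X q w) =
    (Num.sqrt (2 ^+ j.+1))^-1%:C%C * expi (- pi * ratr (q j) * w).
Proof.
apply: to_discK; rewrite normC_cnorm lecR Normc.normcM cnorm_expi mulr1.
rewrite cnorm_real ger0_norm ?invr_ge0 ?sqrtr_ge0 // invf_le1 ?sqrtr_gt0 //.
  by rewrite -[leLHS]sqrtr1 ler_wsqrtr // exprn_ege1 // ler1n.
Qed.

End example.

(* Main.v *)
(**
The shift [RS_n] acts on the eigenbasis [f_k] by phases, so [mu_n(f_k)] equals
[|<E^n, f_k>|^2 / ||E^n||^2] and the [j]-th coordinate of [X_n(f_k)] is, up to the
phase of [<E^n, f_k>], the number [sqrt (c_j) ||E^n|| e^(- pi i q_j k / n!)].  As a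
function of [w = k / n!], the amplitude [<E^n, f_k>] is, up to a factor
[(2 n!)^(-1/2)], a Riemann sum of the Fourier integral of the Gaussian [E], so the
step densities [n! mu_n] converge pointwise to [phi].  By Parseval's identity they
have mass one, hence they converge in [L_1] (Scheffe), and
[\int h o X_n d mu_n] tends to [\int h o X d mu'].  Since continuous functions
determine a probability on the compact cube [Q], [hat_mu] is the pushforward of
[mu'] by [X], and [X] has a measurable left inverse because the phases
[e^(- pi i w / k)] determine [w].

The map [V g (w) = (2 phi w)^(-1/2) \int e^(- pi i w t) g(t) dt], extended to
[L_2] by Plancherel's theorem, is unitary and sends [E(. - r)] to the character
[e^(- pi i r w)].  A function of [L_1] orthogonal to all characters with rational
frequency vanishes, so an isometry which agrees with [V] on the [E(. - r)] is [V]: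
thus [hat_U g o X = V g].  Integration by parts gives [V (A z) = pi w V z], and
smooth bumps of small width, whose transforms do not vanish near a given point,
force [hat_m o X = pi w].
*)

Require Import Defs.
From HB Require Import structures.
From mathcomp Require Import all_boot all_order all_algebra.
From mathcomp Require Import complex.
From mathcomp Require Import all_classical all_reals all_analysis.
From mathcomp Require Import measurable_realfun ring lra zify.
Import Order.TTheory GRing.Theory Num.Theory.
Import numFieldTopology.Exports numFieldNormedType.Exports.
Local Open Scope classical_set_scope.
Local Open Scope ring_scope.
Set Implicit Arguments.
Unset Strict Implicit.
Unset Printing Implicit Defensive.

(** * Real and complex integrals *)

(** The limit objects are compared on the line rather than on the cube: the left inverse of [X]
    makes functions on [Q] and on the line correspond up to null sets, and witnesses for [hat_U] and
    [hat_m] arise by composing with it.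

    Plancherel's theorem is reached in two stages. A Gaussian cutoff gives only an inequality of
    norms, which is enough to extend the transform to L_2. Equality follows from the inversion
    formula, tested against modulated Gaussians, whose transforms are explicit; uniqueness of the
    transform on L_1 turns these tests into an identity almost everywhere. Uniqueness itself is
    elementary: polynomials in sines of long period approximate indicators of rays, and Lebesgue
    differentiation concludes.

    The two conditions on [L] pull in opposite directions. A large [L n] relative to [n!] makes the
    sampling window exhaust the line; a small [L n] relative to [n! ^ 2] keeps a shift by a fixed
    rational from wrapping round the cycle of cells. Such shifts are eventually exact translations,
    because the denominator of [q j] divides [n!] for large [n]. *)

Lemma cvg_seq_unique (R : realType) (u : nat -> R) (a b : R) :
  u n @[n --> \oo] --> a -> u n @[n --> \oo] --> b -> a = b.
Proof.
by move=> ua ub; rewrite -(cvg_lim _ ua)// (cvg_lim _ ub)//; exact: norm_hausdorff.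
Qed.

Lemma cvg_seq_cst (R : realType) (u : nat -> R) (a b : R) :
  (forall n, u n = a) -> u n @[n --> \oo] --> b -> b = a.
Proof.
move=> ua ub; apply: (cvg_seq_unique ub).
by have -> : u = (fun=> a) by [apply/funext]; exact: cvg_cst.
Qed.

Lemma cvg_seq_comp (R : realType) (f : R -> R) (u : nat -> R) (a : R) :
  continuous f -> u n @[n --> \oo] --> a -> f (u n) @[n --> \oo] --> f a.
Proof. by move=> cf ua; exact: (cvg_comp u f ua (cf a)). Qed.

Lemma cvg_le0 (R : realType) (u v : nat -> R) (a : R) :
  u n @[n --> \oo] --> (0 : R) -> v n @[n --> \oo] --> (0 : R) ->
  (forall n, a <= u n + v n) -> a <= 0.
Proof.
move=> u0 v0 au; have c : u n + v n @[n --> \oo] --> (0 : R).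
  by rewrite -[X in _ --> X](addr0 (0 : R)); exact: cvgD.
rewrite -(cvg_lim (@norm_hausdorff _ R) c); apply: limr_ge; first by apply/cvg_ex; exists 0.
exact: nearW.
Qed.

Section real_integrals.
Context d (T : measurableType d) (R : realType).
Variable mu : {measure set T -> \bar R}.
Implicit Types f g : T -> R.

Notation intg f := (mu.-integrable [set: T] (EFin \o f)).

Lemma ae_imp (P S : T -> Prop) : {ae mu, forall x, P x} ->
  (forall x, P x -> S x) -> {ae mu, forall x, S x}.
Proof. by move=> p ps; apply: filterS p. Qed.

Lemma ae_imp2 (P P' S : T -> Prop) : {ae mu, forall x, P x} ->
  {ae mu, forall x, P' x} -> (forall x, P x -> P' x -> S x) -> {ae mu, forall x, S x}.
Proof. by move=> p p' ps; apply: filterS2 p p'. Qed.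

Lemma intg_measurable f : intg f -> measurable_fun [set: T] f.
Proof. by move=> /integrableP[/measurable_EFinP]. Qed.

Lemma intg_le f g : measurable_fun [set: T] f ->
  (forall x, `|f x| <= g x) -> intg g -> intg f.
Proof.
move=> mf fg; apply: le_integrable => //; first exact/measurable_EFinP.
by move=> x _ /=; rewrite lee_fin (le_trans (fg x))// ler_norm.
Qed.

Lemma intgD f g : intg f -> intg g -> intg (fun x => f x + g x).
Proof. by move=> ff gg; exact: (integrableD measurableT ff gg). Qed.

Lemma intgB f g : intg f -> intg g -> intg (fun x => f x - g x).
Proof. by move=> ff gg; exact: (integrableB measurableT ff gg). Qed.

Lemma intgN f : intg f -> intg (fun x => - f x).
Proof. by move=> ff; exact: (integrableN ff). Qed.

Lemma intgZ (a : R) f : intg f -> intg (fun x => a * f x).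
Proof. by move=> ff; exact: (integrableZl measurableT a ff). Qed.

Lemma intg0 : intg (fun=> 0).
Proof. exact: integrable0. Qed.

Lemma EFin_Rintegral f : intg f -> (\int[mu]_x f x)%:E = (\int[mu]_x (f x)%:E)%E.
Proof. by move=> ff; rewrite /Rintegral fineK //; exact: integrable_fin_num. Qed.

Lemma ge0_intgP f : measurable_fun [set: T] f -> (forall x, 0 <= f x) ->
  intg f <-> (\int[mu]_x (f x)%:E < +oo)%E.
Proof.
move=> mf f0; split=> [/integrableP[_]|foo].
  by under eq_integral do rewrite /= ger0_norm//.
apply/integrableP; split; first exact/measurable_EFinP.
by under eq_integral do rewrite /= ger0_norm//.
Qed.

Lemma Rintegral_dct (f_ : nat -> T -> R) f g :
  (forall n, measurable_fun [set: T] (f_ n)) -> measurable_fun [set: T] f ->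
  {ae mu, forall x, f_ n x @[n --> \oo] --> f x} ->
  intg g -> (forall n x, `|f_ n x| <= g x) ->
  intg f /\ \int[mu]_x f_ n x @[n --> \oo] --> \int[mu]_x f x.
Proof.
move=> mf_ mf ff ig fg.
have [|||||If _ cf] := @dominated_convergence _ _ _ mu _ measurableT
  (fun n => EFin \o f_ n) (EFin \o f) (EFin \o g).
- by move=> n; exact/measurable_EFinP.
- exact/measurable_EFinP.
- by apply: filterS ff => x fx _; apply: cvg_EFin => //; exact: nearW.
- exact: ig.
- by apply: aeW => x n _; rewrite /= lee_fin.
split; first exact: If.
apply/fine_cvg; move: cf => /=.
by rewrite -EFin_Rintegral.
Qed.

Lemma Rintegral_eq0_ae f : intg f -> (forall x, 0 <= f x) ->
  \int[mu]_x f x = 0 -> {ae mu, forall x, f x = 0}.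
Proof.
move=> iff f0 If0.
have : (\int[mu]_x (`|(EFin \o f) x|) = 0)%E.
  under eq_integral do rewrite /= ger0_norm//.
  by rewrite -EFin_Rintegral// If0.
move/(ae_eq_integral_abs mu measurableT); case/integrableP : (iff) => mf _.
move=> /(_ mf); apply: filterS => x /= /(_ I).
by move=> [].
Qed.

Lemma eq_ae_Rintegral f g : measurable_fun [set: T] f ->
  measurable_fun [set: T] g -> {ae mu, forall x, f x = g x} ->
  \int[mu]_x f x = \int[mu]_x g x.
Proof.
move=> mf mg fg; congr fine; apply: ae_eq_integral => //; try exact/measurable_EFinP.
by apply: filterS fg => x /= -> .
Qed.

End real_integrals.

(** * Arithmetic and limits of complex numbers *)

Section complex_numbers.
Variable R : realType.
Implicit Types z w : R[i].

Lemma ReM z w : complex.Re (z * w) =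
  complex.Re z * complex.Re w - complex.Im z * complex.Im w.
Proof. by case: z => a b; case: w. Qed.

Lemma ImM z w : complex.Im (z * w) =
  complex.Re z * complex.Im w + complex.Im z * complex.Re w.
Proof. by case: z => a b; case: w. Qed.

Lemma ReD z w : complex.Re (z + w) = complex.Re z + complex.Re w.
Proof. by case: z => a b; case: w. Qed.

Lemma ImD z w : complex.Im (z + w) = complex.Im z + complex.Im w.
Proof. by case: z => a b; case: w. Qed.

Lemma ReN z : complex.Re (- z) = - complex.Re z.
Proof. by case: z. Qed.

Lemma ImN z : complex.Im (- z) = - complex.Im z.
Proof. by case: z. Qed.

Lemma ReJ z : complex.Re z^*%C = complex.Re z.
Proof. by case: z. Qed.

Lemma ImJ z : complex.Im z^*%C = - complex.Im z.
Proof. by case: z. Qed.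

Lemma ReR (x : R) : complex.Re x%:C%C = x. Proof. by []. Qed.

Lemma ImR (x : R) : complex.Im x%:C%C = 0. Proof. by []. Qed.

Lemma complexP z w : complex.Re z = complex.Re w ->
  complex.Im z = complex.Im w -> z = w.
Proof. by case: z => a b; case: w => c e /= -> ->. Qed.

Definition ReImE := (ReM, ImM, ReD, ImD, ReN, ImN, ReJ, ImJ, ReR, ImR).

Lemma sqr_cnorm z : cnorm z ^+ 2 = complex.Re z ^+ 2 + complex.Im z ^+ 2.
Proof. by case: z => a b /=; rewrite sqr_sqrtr ?addr_ge0 ?sqr_ge0. Qed.

Lemma cnormM z w : cnorm (z * w) = cnorm z * cnorm w.
Proof. exact: Normc.normcM. Qed.

Lemma cnormJ z : cnorm z^*%C = cnorm z.
Proof. by case: z => a b /=; rewrite sqrrN. Qed.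

Lemma cnorm0 : cnorm (0 : R[i]) = 0.
Proof. by rewrite cnorm_real normr0. Qed.

Lemma cnormN z : cnorm (- z) = cnorm z.
Proof. by case: z => a b /=; rewrite !sqrrN. Qed.

Lemma cnormD z w : cnorm (z + w) <= cnorm z + cnorm w.
Proof. by rewrite -lecR -normC_cnorm rmorphD /= -!normC_cnorm ler_normD. Qed.

Lemma normr_Re_le z : `|complex.Re z| <= cnorm z.
Proof. by case: z => a b /=; rewrite -sqrtr_sqr ler_wsqrtr// lerDl sqr_ge0. Qed.

Lemma normr_Im_le z : `|complex.Im z| <= cnorm z.
Proof. by case: z => a b /=; rewrite -sqrtr_sqr ler_wsqrtr// lerDr sqr_ge0. Qed.

Lemma cnorm_le z : cnorm z <= `|complex.Re z| + `|complex.Im z|.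
Proof.
rewrite -ler_sqr ?nnegrE ?addr_ge0 ?cnorm_ge0// sqr_cnorm.
rewrite sqrrD !real_normK ?num_real//; set a := complex.Re z; set b := complex.Im z.
have : 0 <= `|a| * `|b| by rewrite mulr_ge0.
by rewrite -mulr_natl; lra.
Qed.

Lemma mulcJ z : z * z^*%C = (cnorm z ^+ 2)%:C%C.
Proof. by apply: complexP; rewrite !ReImE ?sqr_cnorm; ring. Qed.

Lemma mulJ z w : (z * w)^*%C = z^*%C * w^*%C.
Proof. exact: rmorphM. Qed.

Lemma cnorm_eq0 z : cnorm z = 0 -> z = 0.
Proof. exact: Normc.eq0_normc. Qed.

Lemma expiD (s t : R) : expi (s + t) = expi s * expi t.
Proof.
apply: complexP; rewrite ?ReM ?ImM /=; first exact: cosD.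
by rewrite sinD addrC.
Qed.

Lemma expiN (t : R) : expi (- t) = (expi t)^*%C.
Proof. by rewrite /expi cosN sinN. Qed.

Lemma expi0 : expi (0 : R) = 1.
Proof. by rewrite /expi cos0 sin0. Qed.

Lemma cvg_complexP (I : Type) (F : set_system I) (u : I -> R[i]) (l : R[i]) :
  Filter F -> complex.Re (u n) @[n --> F] --> complex.Re l ->
  complex.Im (u n) @[n --> F] --> complex.Im l -> u n @[n --> F] --> l.
Proof.
move=> FF ru ju; apply/cvgrPdist_le => e e0.
(* The order of [R[i]] compares only numbers with equal imaginary parts, so a positive [e] is
   real. *)
have [r er] : exists r : R, e = r%:C%C.
  exists (complex.Re e); apply: complexP => //=.
  by move: e0; rewrite ltcE /= => /andP[/eqP].
rewrite {e}er in e0 *; have {}e0 : 0 < r by move: e0; rewrite ltcR.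
have r2 : 0 < r / 2 by rewrite divr_gt0.
near=> n; rewrite normC_cnorm lecR (le_trans (cnorm_le _))// !ReImE.
rewrite [leRHS](splitr r) lerD//; near: n.
  by move/cvgrPdist_le : ru; exact.
by move/cvgrPdist_le : ju; exact.
Unshelve. all: by end_near. Qed.

Lemma cvg_cnorm (I : Type) (F : set_system I) (u : I -> R[i]) (l : R[i]) :
  Filter F -> u n @[n --> F] --> l ->
  forall e : R, 0 < e -> \forall n \near F, cnorm (l - u n) <= e.
Proof.
move=> FF ul e e0; have e0' : 0 < e%:C%C :> R[i] by rewrite ltcR.
move/cvgrPdist_le : ul => /(_ _ e0'); apply: filterS => n.
by rewrite normC_cnorm lecR.
Qed.

Lemma cvg_Re (I : Type) (F : set_system I) (u : I -> R[i]) (l : R[i]) :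
  Filter F -> u n @[n --> F] --> l ->
  complex.Re (u n) @[n --> F] --> complex.Re l.
Proof.
move=> FF ul; apply/cvgrPdist_le => /= e e0; near=> n.
rewrite -ReN -ReD (le_trans (normr_Re_le _))//; near: n.
exact: (cvg_cnorm FF ul).
Unshelve. all: by end_near. Qed.

Lemma cvg_Im (I : Type) (F : set_system I) (u : I -> R[i]) (l : R[i]) :
  Filter F -> u n @[n --> F] --> l ->
  complex.Im (u n) @[n --> F] --> complex.Im l.
Proof.
move=> FF ul; apply/cvgrPdist_le => /= e e0; near=> n.
rewrite -ImN -ImD (le_trans (normr_Im_le _))//; near: n.
exact: (cvg_cnorm FF ul).
Unshelve. all: by end_near. Qed.

End complex_numbers.

(** * Complex integrals, L_1 and L_2 *)

Section complex_integrals.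
Context d (T : measurableType d) (R : realType).
Variable mu : {measure set T -> \bar R}.
Implicit Types f g : T -> R[i].

Notation intg f := (mu.-integrable [set: T] (EFin \o f)).

Lemma cmeasurableD f g : cmeasurable f -> cmeasurable g ->
  cmeasurable (fun x => f x + g x).
Proof.
move=> [rf jf] [rg jg]; split; under eq_fun do rewrite ?ReImE;
  exact: measurable_funD.
Qed.

Lemma cmeasurableN f : cmeasurable f -> cmeasurable (fun x => - f x).
Proof.
by move=> [rf jf]; split; under eq_fun do rewrite ?ReImE; exact: measurableT_comp.
Qed.

Lemma cmeasurableB f g : cmeasurable f -> cmeasurable g ->
  cmeasurable (fun x => f x - g x).
Proof. by move=> mf mg; apply: cmeasurableD => //; exact: cmeasurableN. Qed.

Lemma cmeasurableM f g : cmeasurable f -> cmeasurable g ->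
  cmeasurable (fun x => f x * g x).
Proof.
move=> [rf jf] [rg jg]; split; under eq_fun do rewrite ?ReImE.
  by apply: measurable_funB; exact: measurable_funM.
by apply: measurable_funD; exact: measurable_funM.
Qed.

Lemma cmeasurableJ f : cmeasurable f -> cmeasurable (fun x => (f x)^*%C).
Proof.
move=> [rf jf]; split.
  by under eq_fun do rewrite ReImE.
by under eq_fun do rewrite ReImE; exact: measurableT_comp.
Qed.

Lemma cmeasurable_cst (c : R[i]) : cmeasurable (fun _ : T => c).
Proof. by split; exact: measurable_cst. Qed.

Lemma cmeasurable_real (g : T -> R) : measurable_fun [set: T] g ->
  cmeasurable (fun x => (g x)%:C%C).
Proof. by move=> mg; split => //=; exact: measurable_cst. Qed.

Lemma measurable_sqr_cnorm f : cmeasurable f ->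
  measurable_fun [set: T] (fun x => cnorm (f x) ^+ 2).
Proof.
move=> [rf jf]; under eq_fun do rewrite sqr_cnorm.
by apply: measurable_funD; exact: measurable_funX.
Qed.

Lemma measurable_cnorm f : cmeasurable f ->
  measurable_fun [set: T] (fun x => cnorm (f x)).
Proof.
move=> mf; have -> : (fun x => cnorm (f x)) = (fun x => Num.sqrt (cnorm (f x) ^+ 2)).
  by apply/funext => x; rewrite sqrtr_sqr ger0_norm ?cnorm_ge0.
have ms : measurable_fun [set: R] (@Num.sqrt R).
  by apply: continuous_measurable_fun; exact: sqrt_continuous.
exact: (measurableT_comp ms (measurable_sqr_cnorm mf)).
Qed.

Lemma in_L1P f : in_L1 mu f <->
  intg (fun x => complex.Re (f x)) /\ intg (fun x => complex.Im (f x)).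
Proof.
split=> [[mf foo]|[rf jf]].
  have ic : intg (fun x => cnorm (f x)).
    apply/ge0_intgP => //; first exact: measurable_cnorm.
    by move=> x; exact: cnorm_ge0.
  case: (mf) => mr mj; split.
    by apply: (intg_le mr _ ic) => x; exact: normr_Re_le.
  by apply: (intg_le mj _ ic) => x; exact: normr_Im_le.
have mf : cmeasurable f by split; [exact: intg_measurable rf|exact: intg_measurable jf].
split => //; apply/ge0_intgP; first exact: measurable_cnorm.
  by move=> x; exact: cnorm_ge0.
apply: (@intg_le _ _ _ _ _ (fun x => `|complex.Re (f x)| + `|complex.Im (f x)|)).
- exact: measurable_cnorm.
- by move=> x; rewrite ger0_norm ?cnorm_ge0// cnorm_le.
- apply: (@intgD _ _ _ _ (fun x => `|complex.Re (f x)|) (fun x => `|complex.Im (f x)|));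
  exact: integrable_norm.
Qed.

Lemma in_L1_cnorm f : in_L1 mu f -> intg (fun x => cnorm (f x)).
Proof.
move=> [mf foo]; apply/ge0_intgP => //; first exact: measurable_cnorm.
by move=> x; exact: cnorm_ge0.
Qed.

Lemma in_L1_le f (g : T -> R) : cmeasurable f -> (forall x, cnorm (f x) <= g x) ->
  intg g -> in_L1 mu f.
Proof.
move=> [mr mj] fg ig; apply/in_L1P; split.
  by apply: (intg_le mr _ ig) => x; rewrite (le_trans (normr_Re_le _)).
by apply: (intg_le mj _ ig) => x; rewrite (le_trans (normr_Im_le _)).
Qed.

Lemma in_L1D f g : in_L1 mu f -> in_L1 mu g -> in_L1 mu (fun x => f x + g x).
Proof.
move=> /in_L1P[rf jf] /in_L1P[rg jg]; apply/in_L1P; split;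
  under eq_fun do rewrite ?ReImE; exact: intgD.
Qed.

Lemma in_L1Z (a : R[i]) f : in_L1 mu f -> in_L1 mu (fun x => a * f x).
Proof.
move=> /in_L1P[rf jf]; apply/in_L1P; split; under eq_fun do rewrite ?ReImE.
  by apply: intgB; exact: intgZ.
by apply: intgD; exact: intgZ.
Qed.

Lemma in_L1N f : in_L1 mu f -> in_L1 mu (fun x => - f x).
Proof.
by move=> /(in_L1Z (-1)); congr in_L1; apply/funext => x; rewrite mulN1r.
Qed.

Lemma in_L1B f g : in_L1 mu f -> in_L1 mu g -> in_L1 mu (fun x => f x - g x).
Proof. by move=> ff gg; apply: in_L1D => //; exact: in_L1N. Qed.

Lemma in_L1J f : in_L1 mu f -> in_L1 mu (fun x => (f x)^*%C).
Proof.
move=> /in_L1P[rf jf]; apply/in_L1P; split.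
  by under eq_fun do rewrite ReImE.
by under eq_fun do rewrite ReImE; exact: intgN.
Qed.

Lemma in_L1_bounded (M : R) f g : cmeasurable g -> (forall x, cnorm (g x) <= M) ->
  in_L1 mu f -> in_L1 mu (fun x => g x * f x).
Proof.
move=> mg gM If; apply: (@in_L1_le _ (fun x => M * cnorm (f x))).
- by apply: cmeasurableM => //; case: If.
- by move=> x; rewrite cnormM ler_wpM2r ?cnorm_ge0.
- by apply: intgZ; exact: in_L1_cnorm.
Qed.

Lemma CintegralD f g : in_L1 mu f -> in_L1 mu g ->
  Cintegral mu (fun x => f x + g x) = Cintegral mu f + Cintegral mu g.
Proof.
move=> /in_L1P[rf jf] /in_L1P[rg jg]; apply: complexP => /=;
  under eq_Rintegral do rewrite ?ReImE; exact: RintegralD.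
Qed.

Lemma CintegralZ (a : R[i]) f : in_L1 mu f ->
  Cintegral mu (fun x => a * f x) = a * Cintegral mu f.
Proof.
move=> /in_L1P[rf jf]; apply: complexP.
  rewrite ReM [LHS]/= [complex.Re (Cintegral _ _)]/= [complex.Im (Cintegral _ _)]/=.
  under eq_Rintegral do rewrite ReM.
  by rewrite RintegralB ?RintegralZl//; exact: intgZ.
rewrite ImM [LHS]/= [complex.Re (Cintegral _ _)]/= [complex.Im (Cintegral _ _)]/=.
under eq_Rintegral do rewrite ImM.
by rewrite RintegralD ?RintegralZl//; exact: intgZ.
Qed.

Lemma CintegralN f : in_L1 mu f ->
  Cintegral mu (fun x => - f x) = - Cintegral mu f.
Proof.
move=> If; rewrite -mulN1r -CintegralZ//; congr Cintegral.
by apply/funext => x; rewrite mulN1r.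
Qed.

Lemma CintegralB f g : in_L1 mu f -> in_L1 mu g ->
  Cintegral mu (fun x => f x - g x) = Cintegral mu f - Cintegral mu g.
Proof. by move=> ff gg; rewrite CintegralD ?CintegralN//; exact: in_L1N. Qed.

Lemma CintegralJ f : in_L1 mu f ->
  Cintegral mu (fun x => (f x)^*%C) = (Cintegral mu f)^*%C.
Proof.
move=> /in_L1P[rf jf]; apply: complexP => /=.
  by apply: eq_Rintegral => x _; rewrite ReImE.
under eq_Rintegral do rewrite ReImE -mulN1r.
by rewrite RintegralZl// mulN1r.
Qed.

Lemma Cintegral_real (g : T -> R) :
  Cintegral mu (fun x => (g x)%:C%C) = (\int[mu]_x g x)%:C%C.
Proof. by apply: complexP => //=; rewrite Rintegral_cst// mul0r. Qed.

Lemma eq_ae_Cintegral f g : cmeasurable f -> cmeasurable g -> aeeq mu f g ->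
  Cintegral mu f = Cintegral mu g.
Proof.
move=> [rf jf] [rg jg] fg; apply: complexP => /=; apply: eq_ae_Rintegral => //;
  by apply: filterS fg => x ->.
Qed.

(** Real and imaginary parts are bounded separately, which costs the factor 2 and is harmless in
    estimates of limits. *)
Lemma cnorm_Cintegral_le f : in_L1 mu f ->
  cnorm (Cintegral mu f) <= 2 * \int[mu]_x cnorm (f x).
Proof.
move=> If; apply: (le_trans (cnorm_le _)) => /=.
have ic := in_L1_cnorm If; case/in_L1P : If => rf jf.
rewrite mulr2n mulrDl mul1r; apply: lerD; apply: (le_trans (le_normr_Rintegral _ _)) => //;
  apply: le_Rintegral => //; try exact: integrable_norm.
  by move=> x _; exact: normr_Re_le.
by move=> x _; exact: normr_Im_le.
Qed.

Lemma Cintegral_dct (f_ : nat -> T -> R[i]) f (g : T -> R) :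
  (forall n, cmeasurable (f_ n)) -> cmeasurable f ->
  {ae mu, forall x, complex.Re (f_ n x) @[n --> \oo] --> complex.Re (f x)} ->
  {ae mu, forall x, complex.Im (f_ n x) @[n --> \oo] --> complex.Im (f x)} ->
  intg g -> (forall n x, cnorm (f_ n x) <= g x) ->
  in_L1 mu f /\ (complex.Re (Cintegral mu (f_ n)) @[n --> \oo] --> complex.Re (Cintegral mu f)
   /\ complex.Im (Cintegral mu (f_ n)) @[n --> \oo] --> complex.Im (Cintegral mu f)).
Proof.
move=> mf_ [rf jf] cr cj ig fg.
have [] := @Rintegral_dct _ _ _ mu (fun n x => complex.Re (f_ n x)) _ g _ rf cr ig.
- by move=> n; case: (mf_ n).
- by move=> n x; rewrite (le_trans (normr_Re_le _)).
move=> ir Ir; have [] := @Rintegral_dct _ _ _ mu (fun n x => complex.Im (f_ n x)) _ g _ jf cj ig.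
- by move=> n; case: (mf_ n).
- by move=> n x; rewrite (le_trans (normr_Im_le _)).
by move=> ij Ij; split => //; apply/in_L1P.
Qed.

Lemma in_L2P f : in_L2 mu f <-> cmeasurable f /\ intg (fun x => cnorm (f x) ^+ 2).
Proof.
split=> -[mf foo]; split=> //; apply/ge0_intgP => //.
- exact: measurable_sqr_cnorm.
- by move=> x; exact: sqr_ge0.
- exact: measurable_sqr_cnorm.
- by move=> x; exact: sqr_ge0.
Qed.

Lemma in_L2_le f (g : T -> R) : cmeasurable f -> (forall x, cnorm (f x) ^+ 2 <= g x) ->
  intg g -> in_L2 mu f.
Proof.
move=> mf fg ig; apply/in_L2P; split => //; apply: intg_le ig.
  exact: measurable_sqr_cnorm.
by move=> x; rewrite ger0_norm ?sqr_ge0.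
Qed.

Lemma sqr_cnormD_le (z w : R[i]) :
  cnorm (z + w) ^+ 2 <= 2 * cnorm z ^+ 2 + 2 * cnorm w ^+ 2.
Proof.
rewrite !sqr_cnorm !ReImE; case: z => a b; case: w => c e /=.
by have := sqr_ge0 (a - c); have := sqr_ge0 (b - e); lra.
Qed.

Lemma in_L2D f g : in_L2 mu f -> in_L2 mu g -> in_L2 mu (fun x => f x + g x).
Proof.
move=> /in_L2P[mf If] /in_L2P[mg Ig].
apply: (@in_L2_le _ (fun x => 2 * cnorm (f x) ^+ 2 + 2 * cnorm (g x) ^+ 2)).
- exact: cmeasurableD.
- by move=> x; exact: sqr_cnormD_le.
- by apply: intgD; exact: intgZ.
Qed.

Lemma in_L2Z (a : R[i]) f : in_L2 mu f -> in_L2 mu (fun x => a * f x).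
Proof.
move=> /in_L2P[mf If]; apply: (@in_L2_le _ (fun x => cnorm a ^+ 2 * cnorm (f x) ^+ 2)).
- by apply: cmeasurableM => //; exact: cmeasurable_cst.
- by move=> x; rewrite cnormM exprMn.
- exact: intgZ.
Qed.

Lemma in_L2N f : in_L2 mu f -> in_L2 mu (fun x => - f x).
Proof.
by move=> /(in_L2Z (-1)); congr in_L2; apply/funext => x; rewrite mulN1r.
Qed.

Lemma in_L2B f g : in_L2 mu f -> in_L2 mu g -> in_L2 mu (fun x => f x - g x).
Proof. by move=> ff gg; apply: in_L2D => //; exact: in_L2N. Qed.

Lemma in_L2J f : in_L2 mu f -> in_L2 mu (fun x => (f x)^*%C).
Proof.
move=> /in_L2P[mf If]; apply/in_L2P; split; first exact: cmeasurableJ.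
by under eq_fun do rewrite cnormJ.
Qed.

Lemma in_L2_L1M f g : in_L2 mu f -> in_L2 mu g -> in_L1 mu (fun x => f x * g x).
Proof.
move=> /in_L2P[mf If] /in_L2P[mg Ig].
apply: (@in_L1_le _ (fun x => cnorm (f x) ^+ 2 + cnorm (g x) ^+ 2)).
- exact: cmeasurableM.
- move=> x; rewrite cnormM; have := sqr_ge0 (cnorm (f x) - cnorm (g x)).
  have := mulr_ge0 (cnorm_ge0 (f x)) (cnorm_ge0 (g x)).
  by move: (cnorm (f x)) (cnorm (g x)) => a b; nra.
- exact: intgD.
Qed.

(** The square of [L2norm], which keeps square roots out of the estimates. *)
Definition sqnorm f := \int[mu]_x (cnorm (f x) ^+ 2).

Lemma sqnorm_ge0 f : 0 <= sqnorm f.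
Proof. by apply: Rintegral_ge0 => x _; exact: sqr_ge0. Qed.

Lemma sqr_L2norm f : L2norm mu f ^+ 2 = sqnorm f.
Proof. by rewrite sqr_sqrtr//; exact: sqnorm_ge0. Qed.

Lemma sqnorm_eq0 f : in_L2 mu f -> sqnorm f = 0 -> aeeq mu f (fun=> 0).
Proof.
move=> /in_L2P[mf If] /Rintegral_eq0_ae f0; apply: filterS (f0 If _) => x; last first.
  exact: sqr_ge0.
by move=> /eqP; rewrite sqrf_eq0 => /eqP/cnorm_eq0.
Qed.

Lemma sqnormD_le f g : in_L2 mu f -> in_L2 mu g ->
  sqnorm (fun x => f x + g x) <= 2 * sqnorm f + 2 * sqnorm g.
Proof.
move=> Lf Lg; have /in_L2P[_ Ifg] := in_L2D Lf Lg.
case/in_L2P : Lf => mf If; case/in_L2P : Lg => mg Ig.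
rewrite -!RintegralZl// -RintegralD//; try exact: intgZ.
apply: le_Rintegral => //; first by apply: intgD; exact: intgZ.
by move=> x _; exact: sqr_cnormD_le.
Qed.

Lemma sqnormZ (a : R[i]) f : in_L2 mu f ->
  sqnorm (fun x => a * f x) = cnorm a ^+ 2 * sqnorm f.
Proof.
move=> /in_L2P[mf If]; rewrite -RintegralZl//.
by apply: eq_Rintegral => x _; rewrite cnormM exprMn.
Qed.

Lemma sqnormN f : sqnorm (fun x => - f x) = sqnorm f.
Proof. by apply: eq_Rintegral => x _; rewrite cnormN. Qed.

Lemma sqnormB_le f g : in_L2 mu f -> in_L2 mu g ->
  sqnorm (fun x => f x - g x) <= 2 * sqnorm f + 2 * sqnorm g.
Proof. by move=> Lf Lg; rewrite -[sqnorm g]sqnormN sqnormD_le//; exact: in_L2N. Qed.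

Lemma eq_ae_sqnorm f g : cmeasurable f -> cmeasurable g -> aeeq mu f g ->
  sqnorm f = sqnorm g.
Proof.
move=> mf mg fg; apply: eq_ae_Rintegral; try exact: measurable_sqr_cnorm.
by apply: filterS fg => x ->.
Qed.

Lemma L2inner_sqnorm f : L2inner mu f f = (sqnorm f)%:C%C.
Proof.
by rewrite /L2inner -Cintegral_real; congr Cintegral; apply/funext => x; rewrite mulcJ.
Qed.

Lemma Re_L2inner f g : in_L2 mu f -> in_L2 mu g -> 2 * complex.Re (L2inner mu f g) =
  sqnorm (fun x => f x + g x) - sqnorm f - sqnorm g.
Proof.
move=> Lf Lg; have /in_L2P[_ Ifg] := in_L2D Lf Lg.
have /in_L1P[ri _] := in_L2_L1M Lf (in_L2J Lg).
case/in_L2P : Lf => mf If; case/in_L2P : Lg => mg Ig.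
rewrite /= /sqnorm -!RintegralB// -?RintegralZl//; last exact: intgB.
by apply: eq_Rintegral => x _; rewrite !sqr_cnorm !ReImE; ring.
Qed.

Lemma Im_L2inner f g : in_L2 mu f -> in_L2 mu g -> complex.Im (L2inner mu f g) =
  complex.Re (L2inner mu f (fun x => 'i%C * g x)).
Proof.
move=> Lf Lg; apply: eq_Rintegral => x _.
by case: (f x) => a b; case: (g x) => c e /=; ring.
Qed.

(* [2 |f g| <= e |f|^2 + e^-1 |g|^2]; the bound of [cnorm_Cintegral_le] costs the 2. *)
Lemma cnorm_CintegralM_le (e : R) f g : 0 < e -> in_L2 mu f -> in_L2 mu g ->
  cnorm (Cintegral mu (fun x => f x * g x)) <= e * sqnorm f + e^-1 * sqnorm g.
Proof.
move=> e0 Lf Lg; have Ifg := in_L2_L1M Lf Lg.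
apply: (le_trans (cnorm_Cintegral_le Ifg)); have ic := in_L1_cnorm Ifg.
case/in_L2P : Lf => mf If; case/in_L2P : Lg => mg Ig.
rewrite -!RintegralZl// -RintegralD//; try exact: intgZ.
apply: le_Rintegral => //; [exact: intgZ|by apply: intgD; exact: intgZ|].
have amgm (a b : R) : 2 * (a * b) <= e * a ^+ 2 + e^-1 * b ^+ 2.
  rewrite -subr_ge0.
  have -> : e * a ^+ 2 + e^-1 * b ^+ 2 - 2 * (a * b) = e^-1 * (e * a - b) ^+ 2.
    by field; rewrite gt_eqF.
  by rewrite mulr_ge0 ?sqr_ge0// invr_ge0 ltW.
by move=> x _; rewrite cnormM.
Qed.

(** The product is expanded around [(f, g)]. In each cross term a small weight goes to the fixed
    factor and a large one to the vanishing factor, which does the work of the Cauchy-Schwarz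
    inequality. *)
Lemma cvg_CintegralM (f_ g_ : nat -> T -> R[i]) f g :
  (forall n, in_L2 mu (f_ n)) -> in_L2 mu f ->
  (forall n, in_L2 mu (g_ n)) -> in_L2 mu g ->
  sqnorm (fun x => f_ n x - f x) @[n --> \oo] --> (0 : R) ->
  sqnorm (fun x => g_ n x - g x) @[n --> \oo] --> (0 : R) ->
  cnorm (Cintegral mu (fun x => f_ n x * g_ n x) - Cintegral mu (fun x => f x * g x))
    @[n --> \oo] --> (0 : R).
Proof.
move=> Lf_ Lf Lg_ Lg cf cg.
have bound n (e : R) : 0 < e ->
  cnorm (Cintegral mu (fun x => f_ n x * g_ n x) - Cintegral mu (fun x => f x * g x)) <=
  e * sqnorm f + e * sqnorm g + (1 + e^-1) * sqnorm (fun x => f_ n x - f x) +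
   (1 + e^-1) * sqnorm (fun x => g_ n x - g x).
  move=> e0; have LBf := in_L2B (Lf_ n) Lf; have LBg := in_L2B (Lg_ n) Lg.
  rewrite -CintegralB; try exact: in_L2_L1M.
  have -> : (fun x => f_ n x * g_ n x - f x * g x) =
     (fun x => ((f_ n x - f x) * (g_ n x - g x) + f x * (g_ n x - g x))
        + g x * (f_ n x - f x)) by apply/funext => x; ring.
  rewrite CintegralD; [|apply: in_L1D; exact: in_L2_L1M|exact: in_L2_L1M].
  rewrite CintegralD; [|exact: in_L2_L1M..].
  apply: (le_trans (cnormD _ _)); apply: (le_trans (lerD (cnormD _ _) (lexx _))).
  have := cnorm_CintegralM_le ltr01 LBf LBg.
  have := cnorm_CintegralM_le e0 Lf LBg; have := cnorm_CintegralM_le e0 Lg LBf.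
  rewrite invr1; lra.
apply/cvgrPdist_le => /= e e0.
have K0 : 0 < sqnorm f + sqnorm g + 1.
  by have := sqnorm_ge0 f; have := sqnorm_ge0 g; lra.
(* With this weight the two terms that do not tend to 0 contribute at most [e / 3] together. *)
pose c := e / 3 / (sqnorm f + sqnorm g + 1).
have c0 : 0 < c by rewrite divr_gt0 ?divr_gt0.
have c1 : 0 < 1 + c^-1 by rewrite addr_gt0 ?invr_gt0.
have ec0 : 0 < e / 3 / (1 + c^-1) by rewrite divr_gt0 ?divr_gt0.
near=> n; rewrite sub0r normrN ger0_norm ?cnorm_ge0//.
apply: (le_trans (bound n c c0)).
have A : c * sqnorm f + c * sqnorm g <= e / 3.
  rewrite -mulrDr /c -mulrA; apply: ler_piMr; first by rewrite divr_ge0// ltW.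
  by rewrite mulrC ler_pdivrMr// mul1r lerDl ler01.
have B : (1 + c^-1) * sqnorm (fun x => f_ n x - f x) <= e / 3.
  rewrite mulrC -ler_pdivlMr//; near: n.
  move/cvgrPdist_le : cf => /(_ _ ec0); apply: filterS => n.
  by rewrite sub0r normrN ger0_norm ?sqnorm_ge0.
have C : (1 + c^-1) * sqnorm (fun x => g_ n x - g x) <= e / 3.
  rewrite mulrC -ler_pdivlMr//; near: n.
  move/cvgrPdist_le : cg => /(_ _ ec0); apply: filterS => n.
  by rewrite sub0r normrN ger0_norm ?sqnorm_ge0.
by move: A B C; lra.
Unshelve. all: by end_near. Qed.

End complex_integrals.

(** * Gaussian integrals *)

Section lebesgue_line.
Variable R : realType.
Notation leb := (@lebesgue_measure R).
Notation intg f := (leb.-integrable [set: R] (EFin \o f)).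
Implicit Types f : R -> R.

Lemma measurable_shift (a : R) : @measurable_fun _ _ (measurableTypeR R)
  (measurableTypeR R) setT (fun x : R => x + a).
Proof. exact: measurable_funD. Qed.

Lemma lebesgue_measure_shift (a : R) (A : set (measurableTypeR R)) : measurable A ->
  leb A = pushforward leb (fun x : measurableTypeR R => x + a : measurableTypeR R) A.
Proof.
move=> mA.
pose m : {measure set (measurableTypeR R) -> \bar R} :=
  measure_function_pushforward__canonical__measure_function_Measure
    leb (measurable_shift a).
apply: (@lebesgue_measure_unique _ m) => // X [[x y] _ <-].
rewrite /m/= /pushforward.
have -> : (fun x0 : R => x0 + a) @^-1` `]x, y] = `]x - a, y - a]%classic.
  by apply/seteqP; split => z /=; rewrite !in_itv /= ltrBlDr lerBrDr.
rewrite !lebesgue_measure_itv/= !lte_fin ltrD2r; case: ifPn => // _.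
by rewrite -!EFinB; congr EFin; ring.
Qed.

Lemma Rintegral_shift (a : R) f : intg f ->
  intg (fun x => f (x + a)) /\ \int[leb]_x f (x + a) = \int[leb]_x f x.
Proof.
move=> If; have ms := measurable_shift a.
have mf := intg_measurable If.
have mfs : measurable_fun [set: R] (fun x => f (x + a)) by exact: measurableT_comp.
have pE (g : R -> \bar R) : (\int[leb]_x g x =
   \int[pushforward leb (fun x : measurableTypeR R => (x + a)%R : measurableTypeR R)]_x g x)%E.
  by apply: eq_measure_integral => A mA _; exact: lebesgue_measure_shift.
have Ifs : intg (fun x => f (x + a)).
  apply/integrableP; split; first exact/measurable_EFinP.
  case/integrableP : If => _; rewrite pE ge0_integral_pushforward//.
  apply: measurableT_comp => //; exact/measurable_EFinP.
split => //; congr fine; rewrite [RHS]pE integral_pushforward//.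
exact/measurable_EFinP.
Qed.

Lemma cvg_indic_itv (x : R) : \1_`[- n%:R, n%:R] x @[n --> \oo] --> (1 : R).
Proof.
apply/cvgrPdist_le => e e0; near=> n; rewrite indicE mem_set ?subrr ?normr0 ?ltW//=.
rewrite in_itv /= -ler_norml; near: n.
exact: nbhs_infty_ger.
Unshelve. all: by end_near. Qed.

(** The fundamental theorem of calculus on [[-n, n]]; dominated convergence carries the truncated
    integrals to the whole line. *)
Lemma Rintegral_derive0 (F f : R -> R) : (forall x : R, is_derive x 1 F (f x)) ->
  continuous f -> intg f -> F n%:R @[n --> \oo] --> (0 : R) ->
  F (- n%:R) @[n --> \oo] --> (0 : R) -> \int[leb]_x f x = 0.
Proof.
move=> dF cf If Fn FNn; have mf := intg_measurable If.
have cF : continuous F.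
  by move=> x; apply: differentiable_continuous; apply/derivable1_diffP; case: (dF x).
have [|||||_ c] := @Rintegral_dct _ _ _ leb
  (fun n x => \1_`[- n%:R, n%:R] x * f x) f (fun x => `|f x|).
- by move=> n; exact: measurable_funM.
- exact: mf.
- by apply: aeW => x; rewrite -[X in _ --> X]mul1r; apply: cvgM; [exact: cvg_indic_itv|exact: cvg_cst].
- exact: integrable_norm.
- move=> n x; rewrite normrM ler_piMl// indicE.
  by case: (_ \in _); rewrite ?normr1 ?normr0.
have e n : (0 < n)%N -> \int[leb]_x (\1_`[- n%:R, n%:R] x * f x) = F n%:R - F (- n%:R).
  move=> n0.
  have -> : \int[leb]_x (\1_`[- n%:R, n%:R] x * f x) = \int[leb]_(x in `[- n%:R, n%:R]) f x.
    rewrite [RHS]Rintegral_mkcond; apply: eq_Rintegral => x _.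
    by rewrite patchE indicE; case: ifPn => _; rewrite ?mul1r ?mul0r.
  rewrite /Rintegral (@continuous_FTC2 _ f F)//.
  - by rewrite -subr_gt0 opprK -natrD ltr0n addn_gt0 n0.
  - by apply: continuous_subspaceT => x; exact: cf.
  - split.
    + by move=> x _; case: (dF x).
    + by apply: cvg_at_right_filter; exact: cF.
    + by apply: cvg_at_left_filter; exact: cF.
  - by move=> x _; rewrite derive1E; case: (dF x).
apply: (cvg_seq_unique c).
rewrite -[X in _ --> X](subrr (0 : R)).
apply: (@cvg_trans _ (F n%:R - F (- n%:R) @[n --> \oo])); last exact: cvgB.
apply: near_eq_cvg; near=> n; rewrite e//; near: n; exact: nbhs_infty_gt.
Unshelve. all: by end_near. Qed.

Definition gauss (c x : R) := expR (- (c * x ^+ 2)).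

Lemma gauss_normal_fun (c x : R) : 0 < c ->
  gauss c x = normal_fun 0 (Num.sqrt (2 * c)^-1) x.
Proof.
move=> c0; rewrite /gauss /normal_fun subr0; congr expR.
have c20 : 0 <= (2 * c)^-1 by rewrite invr_ge0 mulr_ge0// ltW.
by rewrite sqr_sqrtr// -mulr_natr; field; rewrite gt_eqF.
Qed.

Lemma gauss_ge0 c x : 0 <= gauss c x. Proof. exact: expR_ge0. Qed.

Lemma gauss_gt0 c x : 0 < gauss c x. Proof. exact: expR_gt0. Qed.

Lemma continuous_gauss c : continuous (gauss c).
Proof.
move=> x; apply: differentiable_continuous; apply/derivable1_diffP.
by rewrite /gauss; exact: ex_derive.
Qed.

Lemma measurable_gauss c : measurable_fun [set: R] (gauss c).
Proof. by apply: continuous_measurable_fun; exact: continuous_gauss. Qed.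

Lemma gauss_pdf (c x : R) : 0 < c ->
  gauss c x = Num.sqrt (pi / c) * normal_pdf 0 (Num.sqrt (2 * c)^-1) x.
Proof.
move=> c0; have c20 : 0 < (2 * c)^-1 by rewrite invr_gt0 mulr_gt0.
rewrite normal_pdfE ?gt_eqF ?sqrtr_gt0// -gauss_normal_fun//.
rewrite /normal_peak sqr_sqrtr ?ltW// mulrA.
have -> : (2 * c)^-1 * pi *+ 2 = pi / c by rewrite -mulr_natr; field; rewrite gt_eqF.
by rewrite divff ?mul1r// gt_eqF// sqrtr_gt0 divr_gt0// pi_gt0.
Qed.

Lemma intg_gauss (c : R) : 0 < c -> intg (gauss c).
Proof.
move=> c0; rewrite (_ : gauss c =
    fun x => Num.sqrt (pi / c) * normal_pdf 0 (Num.sqrt (2 * c)^-1) x).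
  by apply: intgZ; exact: integrable_normal_pdf.
by apply/funext => x; exact: gauss_pdf.
Qed.

Lemma Rintegral_gauss (c : R) : 0 < c -> \int[leb]_x gauss c x = Num.sqrt (pi / c).
Proof.
move=> c0; under eq_Rintegral do rewrite gauss_pdf//.
rewrite RintegralZl//; last exact: integrable_normal_pdf.
by rewrite /Rintegral integral_normal_pdf/= mulr1.
Qed.

(** Half of the exponent absorbs the square, since [y <= expR y] for [y = c / 2 * x ^+ 2]. *)
Lemma sqr_gauss_le (c x : R) : 0 < c ->
  x ^+ 2 * gauss c x <= 2 / c * gauss (c / 2) x.
Proof.
move=> c0; have -> : gauss c x = gauss (c / 2) x * expR (- (c / 2 * x ^+ 2)).
  by rewrite /gauss -expRD; congr expR; field.
rewrite mulrCA mulrC ler_wpM2r ?gauss_ge0//.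
rewrite expRN ler_pdivrMr ?expR_gt0// -ler_pdivrMl ?divr_gt0//.
rewrite invf_div; apply: le_trans (expR_ge1Dx _); lra.
Qed.

Lemma intg_sqr_gauss (c : R) : 0 < c -> intg (fun x => x ^+ 2 * gauss c x).
Proof.
move=> c0; have c20 : 0 < c / 2 by rewrite divr_gt0.
apply: (@intg_le _ _ _ leb _ (fun x => 2 / c * gauss (c / 2) x)).
- by apply: measurable_funM => //; exact: measurable_gauss.
- move=> x; rewrite ger0_norm ?sqr_gauss_le//.
  by rewrite mulr_ge0 ?gauss_ge0// sqr_ge0.
- by apply: intgZ; exact: intg_gauss.
Qed.

Lemma intg_norm_gauss (c : R) : 0 < c -> intg (fun x => `|x| * gauss c x).
Proof.
move=> c0; apply: (@intg_le _ _ _ leb _ (fun x => gauss c x + x ^+ 2 * gauss c x)).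
- by apply: measurable_funM; [exact: normr_measurable|exact: measurable_gauss].
- move=> x; rewrite ger0_norm; last by rewrite mulr_ge0 ?gauss_ge0.
  rewrite -[X in _ <= X + _]mul1r -mulrDl ler_wpM2r ?gauss_ge0//.
  by have := sqr_ge0 (`|x| - 1); rewrite -[x ^+ 2]real_normK ?num_real//; nra.
- by apply: intgD; [exact: intg_gauss|exact: intg_sqr_gauss].
Qed.

Lemma gauss_le_inv (c x : R) : 0 < c -> 0 < x -> gauss c x <= c^-1 * x^-1 ^+ 2.
Proof.
move=> c0 x0; rewrite /gauss expRN exprVn -invfM lef_pV2 ?posrE ?expR_gt0//; last first.
  by rewrite mulr_gt0// exprn_gt0.
by apply: le_trans (expR_ge1Dx _); lra.
Qed.

Lemma cvg_gauss_n (c : R) : 0 < c -> gauss c n%:R @[n --> \oo] --> (0 : R).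
Proof.
move=> c0; rewrite -cvg_shiftS.
apply: (@squeeze_cvgr _ _ _ _ (fun=> 0) (fun n => c^-1 * (n.+1%:R)^-1 ^+ 2)).
- by apply: nearW => n; rewrite gauss_ge0 gauss_le_inv.
- exact: cvg_cst.
- rewrite -(mulr0 c^-1); apply: cvgMr; rewrite -[X in _ --> X](mulr0 (0 : R)).
  exact: (cvgM (@cvg_harmonic R) (@cvg_harmonic R)).
Qed.

Lemma intg_cos_gauss (c xi th : R) : 0 < c -> intg (fun x => cos (xi * x + th) * gauss c x).
Proof.
move=> c0; apply: intg_le (intg_gauss c0).
- apply: measurable_funM; last exact: measurable_gauss.
  apply: continuous_measurable_fun => x; apply: differentiable_continuous.
  by apply/derivable1_diffP; exact: ex_derive.
- by move=> x; rewrite normrM [`|gauss _ _|]ger0_norm ?gauss_ge0// ler_piMl ?gauss_ge0// cos_max.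
Qed.

Lemma intg_xsin_gauss (c xi th : R) : 0 < c ->
  intg (fun x => - x * sin (xi * x + th) * gauss c x).
Proof.
move=> c0; apply: intg_le (intg_norm_gauss c0).
- apply: measurable_funM; last exact: measurable_gauss.
  apply: continuous_measurable_fun => x; apply: differentiable_continuous.
  by apply/derivable1_diffP; exact: ex_derive.
- move=> x; rewrite 2!normrM [`|gauss _ _|]ger0_norm ?gauss_ge0// ler_wpM2r ?gauss_ge0//.
  by rewrite normrN ler_piMr// sin_max.
Qed.

(* Integrating the derivative of [sin (xi x + th) gauss c x] gives the equation
   [J' = - xi / (2 c) J] for the left-hand side [J] as a function of [xi]. *)
Lemma Rintegral_cos_gauss (c xi th : R) : 0 < c ->
  \int[leb]_x (cos (xi * x + th) * gauss c x) =
  cos th * Num.sqrt (pi / c) * expR (- (xi ^+ 2 / (4 * c))).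
Proof.
move=> c0; pose J s := \int[leb]_x (cos (s * x + th) * gauss c x).
pose g (s x : R) := cos (s * x + th) * gauss c x.
have dg (s x : R) : is_derive s 1 (g ^~ x) (- x * sin (s * x + th) * gauss c x).
  by rewrite /g; apply: is_derive_eq; rewrite /GRing.scale/=; ring.
have pE s x : partial1of2 g s x = - x * sin (s * x + th) * gauss c x.
  by rewrite partial1of2E; case: (dg s x).
have dJ (s : R) : is_derive s 1 J (- (s / (2 * c)) * J s).
  have h : `]s - 1, s + 1[%classic s by rewrite /= in_itv /=; lra.
  have ub r x : `]s - 1, s + 1[%classic r -> [set: R] x ->
      `|partial1of2 g r x| <= `|x| * gauss c x.
    move=> _ _; rewrite pE 2!normrM normrN [`|gauss _ _|]ger0_norm ?gauss_ge0//.
    by rewrite ler_wpM2r ?gauss_ge0// ler_piMr// sin_max.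
  have ig r : `]s - 1, s + 1[%classic r -> intg (g r) by move=> _; exact: intg_cos_gauss.
  have dr r x : `]s - 1, s + 1[%classic r -> [set: R] x -> derivable (g ^~ x) r 1.
    by move=> _ _; case: (dg r x).
  have G0 (x : R) : 0 <= `|x| * gauss c x by rewrite mulr_ge0 ?gauss_ge0.
  have iG := intg_norm_gauss c0.
  apply: DeriveDef; first exact: (derivable_under_integral measurableT h ig dr G0 iG ub).
  rewrite -derive1E (differentiation_under_integral measurableT h ig dr G0 iG ub).
  under eq_Rintegral do rewrite pE.
  pose F x := sin (s * x + th) * gauss c x.
  pose f x := s * (cos (s * x + th) * gauss c x) +
     (2 * c) * (- x * sin (s * x + th) * gauss c x).
  have dF (x : R) : is_derive x 1 F (f x).
    by rewrite /F /f /gauss; apply: is_derive_eq; rewrite /GRing.scale/=; ring.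
  have cf : continuous f.
    move=> x; apply: differentiable_continuous; apply/derivable1_diffP.
    by rewrite /f /gauss; exact: ex_derive.
  have Fn (u : nat -> R) : (forall n, `|u n| <= gauss c n%:R) -> u n @[n --> \oo] --> (0 : R).
    move=> uP; apply: norm_cvg0.
    apply: (@squeeze_cvgr _ _ _ _ (fun=> 0) (fun n => gauss c n%:R)).
    - by apply: nearW => n; rewrite normr_ge0 uP.
    - exact: cvg_cst.
    - exact: cvg_gauss_n.
  have If : intg f by apply: intgD; apply: intgZ; [exact: intg_cos_gauss|exact: intg_xsin_gauss].
  have := Rintegral_derive0 dF cf If (Fn (fun n => F n%:R) _) (Fn (fun n => F (- n%:R)) _).
  have Fle x : `|F x| <= gauss c x.
    by rewrite normrM [`|gauss _ _|]ger0_norm ?gauss_ge0// ler_piMl ?gauss_ge0// sin_max.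
  have FleN n : `|F (- n%:R)| <= gauss c n%:R by rewrite (le_trans (Fle _))// /gauss sqrrN.
  move=> /(_ (fun n => Fle _) FleN); rewrite /f RintegralD//; last 2 first.
    by apply: intgZ; exact: intg_cos_gauss.
    by apply: intgZ; exact: intg_xsin_gauss.
  rewrite !RintegralZl//; [|exact: intg_xsin_gauss|exact: intg_cos_gauss].
  rewrite -/(J s); set K := \int[leb]_x _ => e0.
  have -> : K = (2 * c)^-1 * (s * J s + 2 * c * K) - (2 * c)^-1 * (s * J s).
    by field; rewrite gt_eqF.
  by rewrite e0; field; rewrite gt_eqF.
have J0 : J 0 = cos th * Num.sqrt (pi / c).
  rewrite /J; under eq_Rintegral do rewrite mul0r add0r.
  by rewrite RintegralZl ?Rintegral_gauss//; exact: intg_gauss.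
(* The integrating factor of the differential equation makes [h] constant. *)
pose h s := J s * expR (s ^+ 2 / (4 * c)).
have dh (s : R) : is_derive s 1 h 0.
  have -> : h = J * (fun s => expR (s ^+ 2 / (4 * c))) by [].
  by apply: is_derive_eq; rewrite /GRing.scale/=; field; rewrite gt_eqF.
have := is_derive_0_is_cst xi 0 dh.
rewrite /h J0 expr0n/= mul0r expR0 mulr1 => <-.
by rewrite -/(J xi) -mulrA -expRD subrr expR0 mulr1.
Qed.

Lemma Cintegral_gauss (c xi : R) : 0 < c ->
  in_L1 leb (fun x => expi (xi * x) * (gauss c x)%:C%C) /\
  Cintegral leb (fun x => expi (xi * x) * (gauss c x)%:C%C) =
  (Num.sqrt (pi / c) * expR (- (xi ^+ 2 / (4 * c))))%:C%C.
Proof.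
move=> c0.
have rE : (fun x => complex.Re (expi (xi * x) * (gauss c x)%:C%C)) =
    (fun x => cos (xi * x + 0) * gauss c x).
  by apply/funext => x; rewrite ReM/= addr0 mulr0 subr0.
(* The sine is a cosine with phase [- pi / 2], so the phase [th] of [Rintegral_cos_gauss] serves
   both parts. *)
have iE : (fun x => complex.Im (expi (xi * x) * (gauss c x)%:C%C)) =
    (fun x => cos (xi * x + (- (pi / 2))) * gauss c x).
  apply/funext => x; rewrite ImM/= mulr0 add0r cosD cosN sinN cos_pihalf sin_pihalf.
  by congr (_ * _); ring.
split; first by apply/in_L1P; rewrite rE iE; split; exact: intg_cos_gauss.
rewrite /Cintegral rE iE !Rintegral_cos_gauss// cos0 cosN cos_pihalf.
by rewrite !mul0r mul1r.
Qed.

End lebesgue_line.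

(** * Uniqueness of the Fourier transform *)

Section fourier_uniqueness.
Variable R : realType.
Notation leb := (@lebesgue_measure R).
Notation intg f := (leb.-integrable [set: R] (EFin \o f)).

(** The derivative of the sine at 0, read along [x / (n + 1)]. It locates the jump of the
    approximate steps below, and later recovers [w] from its phases in [X_invK]. *)
Lemma cvg_n_sin (x : R) : n.+1%:R * sin (x / n.+1%:R) @[n --> \oo] --> x.
Proof.
have [->|x0] := eqVneq x 0.
  under eq_fun do rewrite mul0r sin0 mulr0; exact: cvg_cst.
have [/cvg_ex[l sl] e] := @is_derive_sin R 0.
have l1 : l = 1.
  by rewrite -(cos0 R) -e; apply/esym/cvg_lim => //; exact: sl.
rewrite {}l1 {e} in sl.
move/cvgr_dnbhsP : sl => /(_ (fun n => x / n.+1%:R)).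
have xn0 : (forall n, x / n.+1%:R != 0) /\ x / n.+1%:R @[n --> \oo] --> (0 : R).
  split=> [n|]; first by rewrite mulf_neq0// invr_eq0 pnatr_eq0.
  by rewrite -(mulr0 x); apply: cvgMr; exact: cvg_harmonic.
move=> /(_ xn0) c.
rewrite -[X in _ --> X]mulr1.
have -> : (fun n => n.+1%:R * sin (x / n.+1%:R)) =
    (fun n => x * ((x / n.+1%:R)^-1 *: (sin (x / n.+1%:R *: 1 + 0) - sin 0))).
  apply/funext => n; rewrite /GRing.scale/= sin0 subr0 addr0 mulr1 invf_div.
  by rewrite mulrA mulrCA divff// mulr1.
by apply: cvgMr.
Qed.

Lemma expi_sin (t : R) : (sin t)%:C%C = (- 'i%C / 2) * (expi t - expi (- t)).
Proof.
have -> : (2 : R[i])^-1 = (2^-1 : R)%:C%C by rewrite fmorphV rmorph_nat.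
by rewrite /expi cosN sinN; apply: complexP => /=; field.
Qed.

Lemma cmeasurable_expi (a b : R) :
  @cmeasurable _ (measurableTypeR R) R (fun w : R => expi (a * w + b)).
Proof.
by split => /=; apply: continuous_measurable_fun => x;
  apply: differentiable_continuous; apply/derivable1_diffP; exact: ex_derive.
Qed.

Lemma cmeasurable_expiM (a : R) :
  @cmeasurable _ (measurableTypeR R) R (fun w : R => expi (a * w)).
Proof. by under eq_fun do rewrite -[a * _]addr0; exact: cmeasurable_expi. Qed.

Lemma in_L1_expi (f : R -> R[i]) (a : R) : in_L1 leb f ->
  in_L1 leb (fun w => expi (a * w) * f w).
Proof.
move=> If; apply: (@in_L1_bounded _ _ _ leb 1) => //.
  exact: cmeasurable_expiM.
by move=> x; rewrite cnorm_expi.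
Qed.

Lemma bernoulli_ge (x : R) n : -1 <= x -> 1 + n%:R * x <= (1 + x) ^+ n.
Proof.
move=> x1; elim: n => [|n ih]; first by rewrite mul0r addr0 expr0.
have x10 : 0 <= 1 + x by lra.
have := ler_wpM2l x10 ih; rewrite exprS; apply: le_trans.
have : 0 <= n%:R * x ^+ 2 by rewrite mulr_ge0// sqr_ge0.
by rewrite -natr1; lra.
Qed.

(* The polynomials [(1 - x ^ N) ^ (2 ^ N)] of the Stone-Weierstrass theorem. *)
Definition sharp_step (N : nat) (x : R) := (1 - x ^+ N) ^+ (2 ^ N).

Lemma sharp_step_itv N x : 0 <= x <= 1 -> 0 <= sharp_step N x <= 1.
Proof.
move=> /andP[x0 x1]; have y0 : 0 <= x ^+ N by exact: exprn_ge0.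
have y1 : x ^+ N <= 1 by exact: exprn_ile1.
by rewrite exprn_ge0 ?exprn_ile1//; lra.
Qed.

(** Bernoulli's inequality: the function is close to 1 left of [1 / 2] for large [N]. *)
Lemma sharp_step_ge N x : 0 <= x <= 1 -> 1 - (2 * x) ^+ N <= sharp_step N x.
Proof.
move=> /andP[x0 x1]; have y0 : 0 <= x ^+ N by exact: exprn_ge0.
have y1 : x ^+ N <= 1 by exact: exprn_ile1.
have := @bernoulli_ge (- x ^+ N) (2 ^ N); rewrite /sharp_step natrX exprMn.
by rewrite mulrN; apply; lra.
Qed.

(** With [y = x ^+ N] and [M = 2 ^ N], the product of [(1 - y) ^ M] and [(1 + y) ^ M] is at most 1,
    and the second factor is at least [1 + M y] by Bernoulli's inequality. Hence the function is
    close to 0 right of [1 / 2]. *)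
Lemma sharp_step_le N x : 0 <= x <= 1 -> sharp_step N x <= (1 + (2 * x) ^+ N)^-1.
Proof.
move=> /andP[x0 x1]; have y0 : 0 <= x ^+ N by exact: exprn_ge0.
have y1 : x ^+ N <= 1 by exact: exprn_ile1.
have := @bernoulli_ge (x ^+ N) (2 ^ N); rewrite /sharp_step natrX -exprMn.
move=> /(_ _)/wrap[]; first by lra.
set z := (2 * x) ^+ N => zle.
have z0 : 0 <= z by rewrite exprn_ge0// mulr_ge0.
have p0 : 0 < 1 + z by lra.
rewrite -[leRHS]mul1r ler_pdivlMr//.
apply: le_trans (_ : (1 - x ^+ N) ^+ (2 ^ N) * (1 + x ^+ N) ^+ (2 ^ N) <= 1).
  by rewrite ler_wpM2l// exprn_ge0//; lra.
by rewrite -exprMn exprn_ile1//; nra.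
Qed.

Let half_sin (c : R) n (w : R) := (1 + sin ((w - c) / n.+1%:R)) / 2.

Let half_sin_itv c n w : 0 <= half_sin c n w <= 1.
Proof.
rewrite /half_sin; have := sin_geN1 ((w - c) / n.+1%:R).
by have := sin_le1 ((w - c) / n.+1%:R); lra.
Qed.

(** Twice the argument is [1 + s] with [s] close to [(w - c) / (n + 1)]: the long period eventually
    puts any fixed [w] on the increasing branch of the sine around [c]. The exponent [(n + 1) ^ 2]
    then outweighs the small [s], so that [(1 + s) ^ N] tends to 0 for [w < c] and to infinity for
    [w > c]. *)
Lemma cvg_sharp_step (c w : R) : w != c ->
  sharp_step (n.+1 ^ 2) ((1 + sin ((w - c) / n.+1%:R)) / 2) @[n --> \oo] -->
  (\1_`]-oo, c] w : R).
Proof.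
have twice n : 2 * half_sin c n w = 1 + sin ((w - c) / n.+1%:R).
  by rewrite /half_sin; field.
have sw := @cvg_n_sin (w - c).
rewrite indicE mem_setE in_itv/=; case: ltgtP => // [wc|cw] _.
- have d0 : 0 < (c - w) / 2 by rewrite divr_gt0// subr_gt0.
  apply: (@squeeze_cvgr _ _ _ _ (fun n => 1 - (1 + n.+1%:R * ((c - w) / 2))^-1) (fun=> 1)).
  + near=> n; apply/andP; split; last by case/andP : (sharp_step_itv (n.+1 ^ 2) (half_sin_itv c n w)).
    apply: le_trans (sharp_step_ge _ (half_sin_itv c n w)); rewrite twice.
    rewrite lerD2l lerN2; set s := sin _; set k : R := n.+1%:R.
    have k0 : 0 < k by rewrite ltr0n.
    have sk : k * s <= - ((c - w) / 2).
      rewrite /s /k; near: n; have : w - c < - ((c - w) / 2) by lra.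
      by move=> /(cvgr_lt _ sw); apply: filterS => n /ltW.
    have s1 : 0 <= 1 + s by have := sin_geN1 ((w - c) / k); rewrite -/s; lra.
    apply: (@le_trans _ _ (expR (s * (n.+1 ^ 2)%:R))).
      rewrite mulrC expRM_natl lerXn2r ?nnegrE ?expR_ge0//; exact: expR_ge1Dx.
    have -> : s * (n.+1 ^ 2)%:R = - (- (k * s) * k) by rewrite natrX -/k; ring.
    rewrite expRN lef_pV2 ?posrE ?expR_gt0//; last by rewrite ltr_wpDr// ltW// mulr_gt0.
    apply: le_trans (expR_ge1Dx _); rewrite lerD2l [leLHS]mulrC.
    by apply: ler_wpM2r; [exact: ltW|lra].
  + rewrite -[X in _ --> X]subr0; apply: cvgB; first exact: cvg_cst.
    apply: (@squeeze_cvgr _ _ _ _ (fun=> 0) (fun n => ((c - w) / 2)^-1 * n.+1%:R^-1)).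
    * apply: nearW => n; have k0 : (0 : R) < n.+1%:R by [].
      have kd0 := mulr_gt0 k0 d0.
      rewrite -invfM lef_pV2 ?posrE ?[_ * n.+1%:R]mulrC ?addr_gt0// lerDr ler01 andbT.
      by rewrite invr_ge0 addr_ge0// ltW.
    * exact: cvg_cst.
    * by rewrite -(mulr0 ((c - w) / 2)^-1); apply: cvgMr; exact: cvg_harmonic.
  + exact: cvg_cst.
- have d0 : 0 < (w - c) / 2 by rewrite divr_gt0// subr_gt0.
  apply: (@squeeze_cvgr _ _ _ _ (fun=> 0) (fun n => ((w - c) / 2)^-1 * n.+1%:R^-1)).
  + near=> n; apply/andP; split; first by case/andP : (sharp_step_itv (n.+1 ^ 2) (half_sin_itv c n w)).
    apply: (le_trans (sharp_step_le _ (half_sin_itv c n w))); rewrite twice.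
    set s := sin _; set k : R := n.+1%:R.
    have k0 : 0 < k by rewrite ltr0n.
    have sk : (w - c) / 2 <= k * s.
      rewrite /s /k; near: n; have : (w - c) / 2 < w - c by lra.
      by move=> /(cvgr_gt _ sw); apply: filterS => n /ltW.
    have s0 : 0 <= s by rewrite -(pmulr_rge0 _ k0) (le_trans _ sk)// ltW.
    have kd0 := mulr_gt0 d0 k0.
    have p0 : 0 < 1 + (1 + s) ^+ (n.+1 ^ 2) by rewrite ltr_wpDr// exprn_ge0// addr_ge0.
    rewrite -invfM lef_pV2 ?posrE//.
    apply: (@le_trans _ _ (1 + (n.+1 ^ 2)%:R * s)); last first.
      apply: (@le_trans _ _ ((1 + s) ^+ (n.+1 ^ 2))); last by rewrite lerDr.
      by apply: bernoulli_ge; lra.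
    have -> : (n.+1 ^ 2)%:R * s = (k * s) * k by rewrite natrX -/k; ring.
    by rewrite ler_wpDl// ler_wpM2r// ltW.
  + exact: cvg_cst.
  + by rewrite mulr0n -(mulr0 ((w - c) / 2)^-1); apply: cvgMr; exact: cvg_harmonic.
Unshelve. all: by end_near. Qed.

Section spectrum.
Variable g : R -> R[i].
Hypothesis Ig : in_L1 leb g.

(** The class is stable under linear combinations and under products with [sin (a w + b)], because
    such a product only shifts the frequency by [a] and [- a]. If the transform of [g] vanishes, it
    contains 1 and therefore all the approximate steps. *)
Let annihilated (psi : R -> R) := [/\ measurable_fun [set: R] psi,
  exists M : R, forall x, `|psi x| <= M
  & forall s : R, Cintegral leb (fun w => expi (s * w) * ((psi w)%:C%C * g w)) = 0].

Let in_L1_psi psi (s : R) : annihilated psi ->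
  in_L1 leb (fun w => expi (s * w) * ((psi w)%:C%C * g w)).
Proof.
move=> [mp [M pM] _]; apply: in_L1_expi.
apply: (@in_L1_bounded _ _ _ leb M); [exact: cmeasurable_real| |exact: Ig].
by move=> x; rewrite cnorm_real.
Qed.

Let annihilatedZ (a : R) psi : annihilated psi -> annihilated (fun w => a * psi w).
Proof.
move=> Ap; have [mp [M pM] p0] := Ap; split.
- by apply: measurable_funM => //; exact: measurable_cst.
- by exists (`|a| * M) => x; rewrite normrM ler_wpM2l.
- move=> s; have -> : (fun w => expi (s * w) * ((a * psi w)%:C%C * g w)) =
    (fun w => a%:C%C * (expi (s * w) * ((psi w)%:C%C * g w))).
    by apply/funext => w; rewrite rmorphM/=; ring.
  by rewrite CintegralZ ?p0 ?mulr0//; exact: in_L1_psi.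
Qed.

Let annihilatedD psi psi' : annihilated psi -> annihilated psi' ->
  annihilated (fun w => psi w + psi' w).
Proof.
move=> Ap Ap'; have [mp [M pM] p0] := Ap; have [mp' [M' pM'] p0'] := Ap'; split.
- exact: measurable_funD.
- by exists (M + M') => x; rewrite (le_trans (ler_normD _ _))// lerD.
- move=> s; have -> : (fun w => expi (s * w) * ((psi w + psi' w)%:C%C * g w)) =
    (fun w => expi (s * w) * ((psi w)%:C%C * g w) + expi (s * w) * ((psi' w)%:C%C * g w)).
    by apply/funext => w; rewrite rmorphD/=; ring.
  by rewrite CintegralD ?p0 ?p0' ?addr0//; exact: in_L1_psi.
Qed.

Let annihilated_sin (a b : R) psi : annihilated psi ->
  annihilated (fun w => sin (a * w + b) * psi w).
Proof.
move=> Ap; have [mp [M pM] p0] := Ap; split.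
- by apply: measurable_funM => //; case: (cmeasurable_expi a b).
- exists M => x; rewrite normrM (le_trans _ (pM x))// ler_piMl// sin_max//.
- move=> s.
  have -> : (fun w => expi (s * w) * ((sin (a * w + b) * psi w)%:C%C * g w)) =
    (fun w => (- 'i%C / 2 * expi b) * (expi ((s + a) * w) * ((psi w)%:C%C * g w)) +
       ('i%C / 2 * expi (- b)) * (expi ((s - a) * w) * ((psi w)%:C%C * g w))).
    apply/funext => w; rewrite rmorphM/= expi_sin opprD !mulrDl !expiD !mulNr.
    by field.
  rewrite CintegralD; try by apply: in_L1Z; exact: in_L1_psi.
  by rewrite !CintegralZ ?p0 ?mulr0 ?addr0//; exact: in_L1_psi.
Qed.

Hypothesis g0 : forall s : R, Cintegral leb (fun w => expi (s * w) * g w) = 0.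

Let annihilated1 : annihilated (fun=> 1).
Proof.
split; first exact: measurable_cst.
  by exists 1 => x; rewrite normr1.
by move=> s; under [X in Cintegral _ X]eq_fun do rewrite mul1r.
Qed.

Let annihilated_half_sin c n psi : annihilated psi ->
  annihilated (fun w => half_sin c n w * psi w).
Proof.
move=> Ap.
have -> : (fun w => half_sin c n w * psi w) = (fun w => 2^-1 * psi w +
    2^-1 * (sin (n.+1%:R^-1 * w + (- (c / n.+1%:R))) * psi w)).
  apply/funext => w; rewrite /half_sin.
  have -> : (w - c) / n.+1%:R = n.+1%:R^-1 * w + (- (c / n.+1%:R)) by ring.
  by field.
by apply: annihilatedD; apply: annihilatedZ => //; exact: annihilated_sin.
Qed.

Let annihilated_half_sinX c n N psi : annihilated psi ->
  annihilated (fun w => half_sin c n w ^+ N * psi w).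
Proof.
move=> Ap; elim: N => [|N ih].
  by under eq_fun do rewrite expr0 mul1r.
by under eq_fun do rewrite exprS -mulrA; exact: annihilated_half_sin.
Qed.

Let annihilated_sharp_step c n N : annihilated (fun w => sharp_step N (half_sin c n w)).
Proof.
rewrite /sharp_step; elim: (2 ^ N)%N => [|k ih].
  by under eq_fun do rewrite expr0.
have -> : (fun w => (1 - half_sin c n w ^+ N) ^+ k.+1) =
  (fun w => (1 - half_sin c n w ^+ N) ^+ k +
     (-1) * (half_sin c n w ^+ N * (1 - half_sin c n w ^+ N) ^+ k)).
  by apply/funext => w; rewrite exprS; ring.
by apply: annihilatedD => //; apply: annihilatedZ; exact: annihilated_half_sinX.
Qed.

Let Cintegral_ray (c : R) :
  Cintegral leb (fun w => (\1_`]-oo, c] w)%:C%C * g w) = 0.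
Proof.
have m1 : cmeasurable (fun w : R => (\1_`]-oo, c] w)%:C%C : R[i]).
  exact: cmeasurable_real.
have [mg _] := Ig.
(* At [w = c] the argument is [1 / 2] and the steps tend to [expR (-1)], so this point is set
   aside. *)
have nc : {ae leb, forall w, w != c}.
  exists [set c]; split => //; first exact: lebesgue_measure_set1.
  by move=> x /= /negP; rewrite negbK => /eqP.
pose q n w := sharp_step (n.+1 ^ 2) (half_sin c n w).
have [||||||_ [cr ci]] := @Cintegral_dct _ _ _ leb (fun n w => (q n w)%:C%C * g w)
  (fun w => (\1_`]-oo, c] w)%:C%C * g w) (fun w => cnorm (g w)).
- move=> n; apply: cmeasurableM => //; apply: cmeasurable_real.
  by case: (annihilated_sharp_step c n (n.+1 ^ 2)).
- exact: cmeasurableM.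
- apply: (ae_imp nc) => w wc; under eq_fun do rewrite !ReImE mul0r subr0.
  by rewrite !ReImE mul0r subr0; apply: cvgMl; exact: cvg_sharp_step.
- apply: (ae_imp nc) => w wc; under eq_fun do rewrite !ReImE mul0r addr0.
  by rewrite !ReImE mul0r addr0; apply: cvgMl; exact: cvg_sharp_step.
- exact: in_L1_cnorm.
- move=> n w; rewrite cnormM cnorm_real ler_piMl ?cnorm_ge0//.
  by have /andP[? ?] := sharp_step_itv (n.+1 ^ 2) (half_sin_itv c n w); rewrite ger0_norm.
have q0 n : Cintegral leb (fun w => (q n w)%:C%C * g w) = 0.
  have [_ _ /(_ 0)] := annihilated_sharp_step c n (n.+1 ^ 2).
  by under [X in Cintegral _ X]eq_fun do rewrite mul0r expi0 mul1r.
by apply: complexP; [apply: cvg_seq_cst cr => n|apply: cvg_seq_cst ci => n]; rewrite q0.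
Qed.

(** By Lebesgue differentiation [f] is almost everywhere the derivative of its primitive, here the
    zero function. *)
Lemma ray_integral_eq0 (f : R -> R) : intg f ->
  (forall c : R, \int[leb]_w (\1_`]-oo, c] w * f w) = 0) -> {ae leb, forall w, f w = 0}.
Proof.
move=> If f0.
have F0 x : \int[leb]_(t in `]-oo, x]) f t = 0.
  rewrite -(f0 x) Rintegral_mkcond; apply: eq_Rintegral => t _.
  by rewrite patchE indicE; case: ifPn => _; rewrite ?mul1r ?mul0r.
have iy (y : R) : leb.-integrable `]-oo, y] (EFin \o f) by apply: integrableS If.
have il : locally_integrable [set: R] f by apply: open_integrable_locally If; exact: openT.
apply: (ae_imp (FTC1Ny iy il)) => x [_].
have -> : (fun x : R => \int[leb]_(t in `]-oo, x]) f t) = cst 0 by exact/funext.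
by rewrite derive1_cst.
Qed.

Lemma fourier_unique_real : aeeq leb g (fun=> 0).
Proof.
have /in_L1P[rg ig] := Ig.
have Z c := f_equal (@complex.Re R) (Cintegral_ray c).
have Y c := f_equal (@complex.Im R) (Cintegral_ray c).
have r0 := ray_integral_eq0 rg _; have i0 := ray_integral_eq0 ig _.
apply: (ae_imp2 (r0 _) (i0 _)) => [c|c|w rw iw]; last exact: complexP.
- rewrite -[RHS](Z c); apply: eq_Rintegral => w _.
  by rewrite ReM/= mul0r subr0.
- rewrite -[RHS](Y c); apply: eq_Rintegral => w _.
  by rewrite ImM/= mul0r addr0.
Qed.

End spectrum.

Lemma rat_seq_cvg (x : R) : exists r : nat -> rat, ratr (r n) @[n --> \oo] --> x.
Proof.
have h n : exists r : rat, `|ratr r - x| <= n.+1%:R^-1.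
  have : x < x + n.+1%:R^-1 by rewrite ltrDl.
  move=> /rat_in_itvoo[r]; rewrite in_itv/= => /andP[xr rx]; exists r.
  rewrite ger0_norm; last by rewrite subr_ge0 ltW.
  by rewrite lerBlDl ltW.
have [r rP] := choice h; exists r.
apply/cvgrPdist_le => /= e e0; near=> n; rewrite distrC (le_trans (rP n))//.
near: n; have /cvgrPdist_le /(_ e e0) := @cvg_harmonic R.
by apply: filterS => n; rewrite sub0r normrN ger0_norm// invr_ge0.
Unshelve. all: by end_near. Qed.

(** By dominated convergence the Fourier integral is continuous in the frequency, so it vanishes
    everywhere once it vanishes on the dense set of the [pi r]. *)
Lemma fourier_unique (g : R -> R[i]) : in_L1 leb g ->
  (forall r : rat, Cintegral leb (fun w => expi (pi * ratr r * w) * g w) = 0) ->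
  aeeq leb g (fun=> 0).
Proof.
move=> Ig g0; apply: fourier_unique_real => // s.
have [r rs] := rat_seq_cvg (s / pi).
have prs w : pi * ratr (r n) * w @[n --> \oo] --> s * w.
  have -> : s = pi * (s / pi) by rewrite mulrCA divff ?mulr1// gt_eqF ?pi_gt0.
  by apply: cvgMl; exact: cvgMr.
have cc w : cos (pi * ratr (r n) * w) @[n --> \oo] --> cos (s * w).
  by apply: cvg_seq_comp; [exact: continuous_cos|exact: prs].
have ss w : sin (pi * ratr (r n) * w) @[n --> \oo] --> sin (s * w).
  by apply: cvg_seq_comp; [exact: continuous_sin|exact: prs].
have [||||||_ [cr ci]] := @Cintegral_dct _ _ _ leb
  (fun n w => expi (pi * ratr (r n) * w) * g w)
  (fun w => expi (s * w) * g w) (fun w => cnorm (g w)).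
- by move=> n; case: (in_L1_expi (pi * ratr (r n)) Ig).
- by case: (in_L1_expi s Ig).
- apply: aeW => w; under eq_fun do rewrite ReM/=.
  by rewrite ReM/=; apply: cvgB; apply: cvgMl.
- apply: aeW => w; under eq_fun do rewrite ImM/=.
  by rewrite ImM/=; apply: cvgD; apply: cvgMl.
- exact: in_L1_cnorm.
- by move=> n w; rewrite cnormM cnorm_expi mul1r.
by apply: complexP; [apply: cvg_seq_cst cr => n|apply: cvg_seq_cst ci => n]; rewrite g0.
Qed.

End fourier_uniqueness.

(** * Fatou's lemma and Fubini's theorem for real and complex integrals *)

Section fatou_real.
Context d (T : measurableType d) (R : realType).
Variable mu : {measure set T -> \bar R}.
Notation intg f := (mu.-integrable [set: T] (EFin \o f)).

Lemma Rfatou (f_ : nat -> T -> R) (f : T -> R) (M : R) :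
  (forall n, intg (f_ n)) -> (forall n x, 0 <= f_ n x) ->
  measurable_fun [set: T] f -> (forall x, 0 <= f x) ->
  {ae mu, forall x, f_ n x @[n --> \oo] --> f x} ->
  (forall n, \int[mu]_x f_ n x <= M) -> intg f /\ \int[mu]_x f x <= M.
Proof.
move=> If_ f_0 mf f0 ff fM.
have le : (\int[mu]_x (f x)%:E <= M%:E)%E.
  have mlim : measurable_fun [set: T] (fun x => limn_einf (fun n => (f_ n x)%:E)).
    rewrite /limn_einf; apply: measurableT_comp => //.
    apply: (@measurable_fun_limn_esup _ _ _ _ (fun n x => - (f_ n x)%:E)%E) => n.
    by apply: measurableT_comp => //; apply/measurable_EFinP; exact: (intg_measurable (If_ n)).
  have -> : (\int[mu]_x (f x)%:E = \int[mu]_x limn_einf (fun n => (f_ n x)%:E))%E.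
    apply: ae_eq_integral => //; first exact/measurable_EFinP.
    apply: (ae_imp ff) => x fx _; apply/esym.
    apply: (cvg_limn_einf_sup _).1; apply: cvg_EFin => //; exact: nearW.
  apply: (@le_trans _ _ (limn_einf (fun n => \int[mu]_x (f_ n x)%:E)%E)).
    apply: fatou => //; first by move=> n; apply/measurable_EFinP; exact: (intg_measurable (If_ n)).
    by move=> n x _; rewrite lee_fin.
  rewrite limn_einf_lim; apply: lime_le; first exact: is_cvg_einfs.
  apply: nearW => n; apply: (@le_trans _ _ (\int[mu]_x (f_ n x)%:E)%E).
    by apply: ereal_inf_lbound; exists n => /=.
  by rewrite -EFin_Rintegral// lee_fin.
have If : intg f by apply/ge0_intgP => //; exact: (le_lt_trans le (ltry _)).
by split => //; rewrite -lee_fin EFin_Rintegral.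
Qed.

End fatou_real.

Section fubini_real.
Context d1 d2 (T1 : measurableType d1) (T2 : measurableType d2) (R : realType).
Variable m1 : {sigma_finite_measure set T1 -> \bar R}.
Variable m2 : {sigma_finite_measure set T2 -> \bar R}.
Notation intg1 f := (m1.-integrable [set: T1] (EFin \o f)).
Notation intg2 f := (m2.-integrable [set: T2] (EFin \o f)).
Notation intg12 k := ((m1 \x m2)%E.-integrable [set: T1 * T2] (EFin \o k)).

Lemma prod_intg12 (k : T1 * T2 -> R) (A : T1 -> R) :
  measurable_fun [set: T1 * T2] k -> (forall x, intg2 (fun y => k (x, y))) ->
  (forall x, \int[m2]_y `|k (x, y)| <= A x) -> intg1 A -> intg12 k.
Proof.
move=> mk ik kA iA; apply/integrable12ltyP; first exact/measurable_EFinP.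
case/integrableP : (iA) => mA; apply: le_lt_trans.
apply: ge0_le_integral => //.
- by move=> x _; exact: integral_ge0.
- apply: (@measurable_fun_fubini_tonelli_F _ _ _ _ _ _ (fun z => `|(k z)%:E|%E)) => //.
  by apply: measurableT_comp => //; exact/measurable_EFinP.
- exact: measurableT_comp.
- move=> x _; have ik' := integrable_norm (ik x).
  rewrite [leLHS](_ : _ = (\int[m2]_y `|k (x, y)|)%:E); last first.
    by rewrite (EFin_Rintegral ik').
  by rewrite lee_fin (le_trans (kA x))// ler_norm.
Qed.

Lemma prod_intg21 (k : T1 * T2 -> R) (A : T2 -> R) :
  measurable_fun [set: T1 * T2] k -> (forall y, intg1 (fun x => k (x, y))) ->
  (forall y, \int[m1]_x `|k (x, y)| <= A y) -> intg2 A -> intg12 k.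
Proof.
move=> mk ik kA iA; apply/integrable21ltyP; first exact/measurable_EFinP.
case/integrableP : (iA) => mA; apply: le_lt_trans.
apply: ge0_le_integral => //.
- by move=> x _; exact: integral_ge0.
- apply: (@measurable_fun_fubini_tonelli_G _ _ _ _ _ _ (fun z => `|(k z)%:E|%E)) => //.
  by apply: measurableT_comp => //; exact/measurable_EFinP.
- exact: measurableT_comp.
- move=> y _; have ik' := integrable_norm (ik y).
  rewrite [leLHS](_ : _ = (\int[m1]_x `|k (x, y)|)%:E); last first.
    by rewrite (EFin_Rintegral ik').
  by rewrite lee_fin (le_trans (kA y))// ler_norm.
Qed.

(** Integrability of every slice, not only of almost every one, makes the inner integrals
    real-valued functions that agree everywhere with the extended integrals. *)
Lemma Rfubini (k : T1 * T2 -> R) : intg12 k ->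
  (forall x, intg2 (fun y => k (x, y))) -> (forall y, intg1 (fun x => k (x, y))) ->
  [/\ intg1 (fun x => \int[m2]_y k (x, y)), intg2 (fun y => \int[m1]_x k (x, y))
    & \int[m1]_x (\int[m2]_y k (x, y)) = \int[m2]_y (\int[m1]_x k (x, y))].
Proof.
move=> ik ik2 ik1.
have E2 x : (\int[m2]_y k (x, y))%:E = (\int[m2]_y (k (x, y))%:E)%E.
  exact: EFin_Rintegral.
have E1 y : (\int[m1]_x k (x, y))%:E = (\int[m1]_x (k (x, y))%:E)%E.
  exact: EFin_Rintegral.
have F1 : intg1 (fun x => \int[m2]_y k (x, y)).
  apply/integrableP; split.
    rewrite /comp; under eq_fun do rewrite E2; exact: (measurable_fubini_F ik).
  have : (\int[m1]_x \int[m2]_y `|(k (x, y))%:E| < +oo)%E.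
    by case/integrableP : (ik) => mk _; exact: ((@integrable12ltyP _ _ _ _ _ m1 m2 (EFin \o k) mk).1 ik).
  apply: le_lt_trans; apply: ge0_le_integral => //.
  - apply: measurableT_comp => //; rewrite /comp; under eq_fun do rewrite E2.
    exact: (measurable_fubini_F ik).
  - apply: (@measurable_fun_fubini_tonelli_F _ _ _ _ _ _ (fun z => `|(k z)%:E|%E)) => //.
    by apply: measurableT_comp => //; case/integrableP : ik.
  - move=> x _; rewrite /comp E2; apply: le_abse_integral => //.
    by case/integrableP : (ik2 x).
have F2 : intg2 (fun y => \int[m1]_x k (x, y)).
  apply/integrableP; split.
    rewrite /comp; under eq_fun do rewrite E1; exact: (measurable_fubini_G ik).
  have : (\int[m2]_y \int[m1]_x `|(k (x, y))%:E| < +oo)%E.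
    by case/integrableP : (ik) => mk _; exact: ((@integrable21ltyP _ _ _ _ _ m1 m2 (EFin \o k) mk).1 ik).
  apply: le_lt_trans; apply: ge0_le_integral => //.
  - apply: measurableT_comp => //; rewrite /comp; under eq_fun do rewrite E1.
    exact: (measurable_fubini_G ik).
  - apply: (@measurable_fun_fubini_tonelli_G _ _ _ _ _ _ (fun z => `|(k z)%:E|%E)) => //.
    by apply: measurableT_comp => //; case/integrableP : ik.
  - move=> y _; rewrite /comp E1; apply: le_abse_integral => //.
    by case/integrableP : (ik1 y).
split => //; apply: EFin_inj; rewrite !EFin_Rintegral//.
under eq_integral do rewrite E2; under [RHS]eq_integral do rewrite E1.
exact: (Fubini ik).
Qed.

Lemma Rfubini_dominated (k : T1 * T2 -> R) (a : T1 -> R) (b : T2 -> R) :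
  measurable_fun [set: T1 * T2] k -> intg1 a -> intg2 b ->
  (forall x y, `|k (x, y)| <= a x * b y) ->
  [/\ intg1 (fun x => \int[m2]_y k (x, y)), intg2 (fun y => \int[m1]_x k (x, y))
    & \int[m1]_x (\int[m2]_y k (x, y)) = \int[m2]_y (\int[m1]_x k (x, y))].
Proof.
move=> mk ia ib kab.
have ik2 x : intg2 (fun y => k (x, y)).
  apply: (@intg_le _ _ _ m2 _ (fun y => a x * b y)).
  - exact: measurableT_comp.
  - by move=> y; exact: kab.
  - exact: intgZ.
have ik1 y : intg1 (fun x => k (x, y)).
  apply: (@intg_le _ _ _ m1 _ (fun x => b y * a x)).
  - exact: measurableT_comp.
  - by move=> x; rewrite mulrC kab.
  - exact: intgZ.
apply: Rfubini => //; apply: (@prod_intg12 k (fun x => (\int[m2]_y b y) * a x)) => //.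
  move=> x; rewrite mulrC -RintegralZl//; apply: le_Rintegral => //.
  - exact: integrable_norm.
  - exact: intgZ.
exact: intgZ.
Qed.

Lemma Cfubini (k : T1 * T2 -> R[i]) (a : T1 -> R) (b : T2 -> R) :
  @cmeasurable _ (T1 * T2)%type R k -> intg1 a -> intg2 b ->
  (forall x y, cnorm (k (x, y)) <= a x * b y) ->
  [/\ in_L1 m1 (fun x => Cintegral m2 (fun y => k (x, y))),
      in_L1 m2 (fun y => Cintegral m1 (fun x => k (x, y)))
    & Cintegral m1 (fun x => Cintegral m2 (fun y => k (x, y))) =
      Cintegral m2 (fun y => Cintegral m1 (fun x => k (x, y)))].
Proof.
move=> [mr mi] ia ib kab.
have [r1 r2 rE] := Rfubini_dominated mr ia ib (fun x y => le_trans (normr_Re_le _) (kab x y)).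
have [i1 i2 iE] := Rfubini_dominated mi ia ib (fun x y => le_trans (normr_Im_le _) (kab x y)).
by split; [exact/in_L1P|exact/in_L1P|exact: complexP].
Qed.

End fubini_real.

(** * Plancherel's theorem *)

Section fourier_transform.
Variable R : realType.
Notation leb := (@lebesgue_measure R).
Notation intg f := (leb.-integrable [set: R] (EFin \o f)).
Implicit Types f g : R -> R[i].

(** With frequency [pi w] in the exponent, this is the constant for which the transform extends to a
    unitary map of L_2. *)
Definition FT f (w : R) : R[i] :=
  (Num.sqrt 2)^-1%:C%C * Cintegral leb (fun t => expi (- pi * w * t) * f t).

Lemma cnorm_FT_le f w : in_L1 leb f -> cnorm (FT f w) <= 2 * \int[leb]_t cnorm (f t).
Proof.
move=> If; rewrite cnormM cnorm_real ger0_norm ?invr_ge0 ?sqrtr_ge0//.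
apply: (@le_trans _ _ (cnorm (Cintegral leb (fun t => expi (- pi * w * t) * f t)))).
  rewrite ler_piMl ?cnorm_ge0// invf_le1 ?sqrtr_gt0//.
  by rewrite -[leLHS]sqrtr1 ler_wsqrtr// ler1n.
apply: (le_trans (cnorm_Cintegral_le (in_L1_expi _ If))).
by under eq_Rintegral do rewrite cnormM cnorm_expi mul1r.
Qed.

Lemma measurable_cos_comp d (T : measurableType d) (u : T -> R) :
  measurable_fun [set: T] u -> measurable_fun [set: T] (fun x => cos (u x)).
Proof.
move=> mu; have mc : measurable_fun [set: R] (@cos R).
  by apply: continuous_measurable_fun; exact: continuous_cos.
exact: (measurableT_comp mc mu).
Qed.

Lemma measurable_sin_comp d (T : measurableType d) (u : T -> R) :
  measurable_fun [set: T] u -> measurable_fun [set: T] (fun x => sin (u x)).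
Proof.
move=> mu; have mc : measurable_fun [set: R] (@sin R).
  by apply: continuous_measurable_fun; exact: continuous_sin.
exact: (measurableT_comp mc mu).
Qed.

Lemma cmeasurable_expi_comp d (T : measurableType d) (u : T -> R) :
  measurable_fun [set: T] u -> cmeasurable (fun x => expi (u x)).
Proof. by move=> mu; split; [exact: measurable_cos_comp|exact: measurable_sin_comp]. Qed.

Lemma cmeasurable_comp d d' (T : measurableType d) (T' : measurableType d')
    (u : T -> T') (h : T' -> R[i]) :
  measurable_fun [set: T] u -> cmeasurable h -> cmeasurable (h \o u).
Proof.
by move=> mu [mr mi]; split; [exact: (measurableT_comp mr mu)|exact: (measurableT_comp mi mu)].
Qed.

Lemma cmeasurable_FT f : in_L1 leb f -> @cmeasurable _ (measurableTypeR R) R (FT f).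
Proof.
move=> If; suff : cmeasurable (FT f) by [].
apply: cmeasurableM; first exact: cmeasurable_cst.
have ic := in_L1_cnorm If; have mf := If.1.
(* Measurability comes from continuity in [w]; [p] stands for the real or the imaginary part. *)
have cts (p : R[i] -> R) : (forall z, `|p z| <= cnorm z) ->
    (forall z : R[i], continuous (fun s : R => p (expi s * z))) ->
    (forall w : R, measurable_fun [set: R] (fun t => p (expi (- pi * w * t) * f t))) ->
    continuous (fun w : R => \int[leb]_t p (expi (- pi * w * t) * f t)).
  move=> pn pc pm; move=> w; rewrite /= in w *.
  have ww : w \in `]w - 1, w + 1[%classic by rewrite mem_setE in_itv/=; lra.
  pose F (w t : R) := p (expi (- pi * w * t) * f t).
  have iF (x : R) : `]w - 1, w + 1[%classic x -> intg (F x).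
    move=> _; apply: intg_le ic => [|t]; first exact: pm.
    by rewrite /F (le_trans (pn _))// cnormM cnorm_expi mul1r.
  have cF : {ae leb, forall t, [set: R] t -> {in `]w - 1, w + 1[%classic, continuous (F ^~ t)}}.
    apply: aeW => t _ x _; rewrite /F.
    apply: (@continuous_comp _ _ _ (fun x : R => - pi * x * t) (fun s => p (expi s * f t))).
      apply: differentiable_continuous; apply/derivable1_diffP; exact: ex_derive.
    exact: pc.
  have bF (x : R) : `]w - 1, w + 1[%classic x ->
     {ae leb, forall t, [set: R] t -> `|F x t| <= cnorm (f t)}.
    move=> _; apply: aeW => t _; rewrite (le_trans (pn _))//.
    by rewrite cnormM cnorm_expi mul1r.
  exact: (continuity_under_integral measurableT iF cF ic bF ww).
have mm (w : R) : cmeasurable (fun t => expi (- pi * w * t) * f t).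
  by apply: cmeasurableM => //; exact: cmeasurable_expiM.
split; apply: continuous_measurable_fun; apply: cts.
- exact: normr_Re_le.
- move=> z; rewrite (_ : (fun s => _) = (fun s : R => cos s * complex.Re z - sin s * complex.Im z)).
    move=> s; apply: cvgB; apply: cvgMl; [exact: continuous_cos|exact: continuous_sin].
  by apply/funext => s; rewrite ReM.
- by move=> w; case: (mm w).
- exact: normr_Im_le.
- move=> z; rewrite (_ : (fun s => _) = (fun s : R => cos s * complex.Im z + sin s * complex.Re z)).
    move=> s; apply: cvgD; apply: cvgMl; [exact: continuous_cos|exact: continuous_sin].
  by apply/funext => s; rewrite ImM.
- by move=> w; case: (mm w).
Qed.

Lemma FTD f g w : in_L1 leb f -> in_L1 leb g ->
  FT (fun t => f t + g t) w = FT f w + FT g w.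
Proof.
move=> If Ig; rewrite /FT -mulrDr -CintegralD; try exact: in_L1_expi.
by under [X in Cintegral _ X]eq_fun do rewrite mulrDr.
Qed.

Lemma FTZ (a : R[i]) f w : in_L1 leb f -> FT (fun t => a * f t) w = a * FT f w.
Proof.
move=> If; rewrite /FT mulrCA; congr (_ * _); rewrite -CintegralZ; last exact: in_L1_expi.
by under [X in Cintegral _ X]eq_fun do rewrite mulrCA.
Qed.

Lemma FTB f g w : in_L1 leb f -> in_L1 leb g ->
  FT (fun t => f t - g t) w = FT f w - FT g w.
Proof.
move=> If Ig; rewrite /FT -mulrBr -CintegralB; try exact: in_L1_expi.
by under [X in Cintegral _ X]eq_fun do rewrite mulrBr.
Qed.

Lemma conj_FT f w : in_L1 leb f -> (FT f w)^*%C =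
  (Num.sqrt 2)^-1%:C%C * Cintegral leb (fun s => expi (pi * w * s) * (f s)^*%C).
Proof.
move=> If; rewrite /FT mulJ conjc_real -CintegralJ; last exact: in_L1_expi.
congr (_ * _); congr Cintegral; apply/funext => s; rewrite mulJ -expiN.
by congr (expi _ * _); ring.
Qed.

Let measurable_phase (c : R) :
  measurable_fun [set: measurableTypeR R * measurableTypeR R] (fun z : R * R => c * z.1 * z.2).
Proof.
apply: measurable_funM; last exact: measurable_snd.
by apply: measurable_funM; [exact: measurable_cst|exact: measurable_fst].
Qed.

(** The kernel [expi (- pi w t)] is symmetric in [w] and [t], so both sides are the same double
    integral. *)
Lemma FT_mult_formula f g : in_L1 leb f -> in_L1 leb g ->
  Cintegral leb (fun w => FT f w * g w) = Cintegral leb (fun t => f t * FT g t).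
Proof.
move=> If Ig; have [mf _] := If; have [mg _] := Ig.
pose k (z : measurableTypeR R * measurableTypeR R) := g z.1 * (expi (- pi * z.1 * z.2) * f z.2).
have mk : cmeasurable k.
  apply: cmeasurableM.
    exact: (@cmeasurable_comp _ _ (measurableTypeR R * measurableTypeR R)%type
       (measurableTypeR R) fst g measurable_fst mg).
  apply: cmeasurableM; first exact: cmeasurable_expi_comp.
  exact: (@cmeasurable_comp _ _ (measurableTypeR R * measurableTypeR R)%type
       (measurableTypeR R) snd f measurable_snd mf).
have kle x y : cnorm (k (x, y)) <= cnorm (g x) * cnorm (f y).
  by rewrite /k 2!cnormM cnorm_expi mul1r.
have [i1 i2 e] := Cfubini mk (in_L1_cnorm Ig) (in_L1_cnorm If) kle.
transitivity ((Num.sqrt 2)^-1%:C%C * Cintegral leb (fun w => Cintegral leb (fun t => k (w, t)))).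
  rewrite -(CintegralZ _ i1); congr Cintegral; apply/funext => w.
  rewrite /FT -mulrA; congr (_ * _); rewrite mulrC.
  exact: (esym (CintegralZ (g w) (in_L1_expi (- pi * w) If))).
rewrite e -(CintegralZ _ i2); congr Cintegral; apply/funext => t.
rewrite /FT mulrCA; congr (_ * _); rewrite -(CintegralZ _ (in_L1_expi (- pi * t) Ig)).
congr Cintegral; apply/funext => w; rewrite /k/=.
have -> : - pi * w * t = - pi * t * w by ring.
by ring.
Qed.

(** The Fourier integral of [gauss c] at frequency [pi u]: a heat kernel of mass 2 that concentrates
    at 0 as [c] tends to 0. *)
Let K (c u : R) := Num.sqrt (pi / c) * gauss (pi ^+ 2 / (4 * c)) u.

Let K_ge0 c u : 0 <= K c u.
Proof. by rewrite mulr_ge0 ?sqrtr_ge0 ?gauss_ge0. Qed.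

Let K_le (c u : R) : 0 < c -> K c u <= Num.sqrt (pi / c).
Proof.
move=> c0; rewrite ler_piMr ?sqrtr_ge0// /gauss -[leRHS]expR0 ler_expR oppr_le0.
by rewrite mulr_ge0 ?sqr_ge0// divr_ge0 ?sqr_ge0// mulr_ge0// ltW.
Qed.

Let K_intg (c : R) : 0 < c -> intg (K c) /\ \int[leb]_u K c u = 2.
Proof.
move=> c0; have p0 : 0 < pi ^+ 2 / (4 * c) by rewrite divr_gt0 ?mulr_gt0 ?exprn_gt0 ?pi_gt0.
split; first by apply: intgZ; exact: intg_gauss.
rewrite RintegralZl ?Rintegral_gauss//; last exact: intg_gauss.
have pi0 : (pi : R) != 0 by rewrite gt_eqF// pi_gt0.
rewrite -sqrtrM; last by rewrite divr_ge0 ?pi_ge0// ltW.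
have -> : pi / c * (pi / (pi ^+ 2 / (4 * c))) = 2 ^+ 2 :> R.
  have c1 : c != 0 by rewrite gt_eqF.
  by move: (pi) pi0 c1 => p q0 c1; field; rewrite q0 c1.
by rewrite sqrtr_sqr ger0_norm.
Qed.

Let K_sym c u v : K c (u - v) = K c (v - u).
Proof. by rewrite -opprB /K /gauss sqrrN. Qed.

Let K_shift (c t : R) : 0 < c -> intg (fun s => K c (t - s)) /\ \int[leb]_s K c (t - s) = 2.
Proof.
move=> /K_intg[iK IK]; have [] := Rintegral_shift (- t) iK.
by rewrite IK; under eq_fun do rewrite -/(_ - _) K_sym; under eq_Rintegral do rewrite -/(_ - _) K_sym.
Qed.

Let measurable_K c : measurable_fun [set: measurableTypeR R * measurableTypeR R]
   (fun z : R * R => K c (z.1 - z.2)).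
Proof.
have mK : measurable_fun [set: R] (K c).
  by apply: measurable_funM; [exact: measurable_cst|exact: measurable_gauss].
apply: (measurableT_comp mK); apply: measurable_funB; [exact: measurable_fst|exact: measurable_snd].
Qed.

(** Tonelli's theorem, with the inner integral taken in [t], where it is the translation invariant
    mass 2 of the kernel. *)
Let convolution_intg (c : R) (h : R -> R) : 0 < c -> (forall s, 0 <= h s) -> intg h ->
  [/\ forall t, intg (fun s => h s * K c (t - s)),
    intg (fun t => \int[leb]_s (h s * K c (t - s)))
  & \int[leb]_t (\int[leb]_s (h s * K c (t - s))) = 2 * \int[leb]_s h s].
Proof.
move=> c0 h0 ih.
pose k (z : measurableTypeR R * measurableTypeR R) := h z.2 * K c (z.1 - z.2).
have mk : measurable_fun setT k.
  apply: measurable_funM; last exact: measurable_K.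
  exact: (measurableT_comp (intg_measurable ih) measurable_snd).
have i1 t : intg (fun s => h s * K c (t - s)).
  apply: (@intg_le _ _ _ leb _ (fun s => Num.sqrt (pi / c) * h s)).
  - apply: measurable_funM; first exact: (intg_measurable ih).
    exact: (intg_measurable (K_shift t c0).1).
  - move=> s; rewrite normrM !ger0_norm// mulrC; apply: ler_wpM2r => //; exact: K_le.
  - exact: intgZ.
have sh s : intg (fun t => K c (t - s)) /\ \int[leb]_t K c (t - s) = 2.
  have [a b] := K_shift s c0; split.
    by under eq_fun do rewrite K_sym.
  by under eq_Rintegral do rewrite K_sym.
have i2 s : intg (fun t => h s * K c (t - s)).
  by apply: intgZ; case: (sh s).
have E s : \int[leb]_t (h s * K c (t - s)) = 2 * h s.
  by case: (sh s) => a b; rewrite RintegralZl// b mulrC.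
have ik : ((leb \x leb)%E).-integrable setT (EFin \o k).
  apply: (@prod_intg21 _ _ _ _ _ leb leb k (fun s => 2 * h s)) => //.
  - move=> s; rewrite -(E s) le_eqVlt; apply/orP; left; apply/eqP/eq_Rintegral => t _.
    by rewrite /k/= ger0_norm// mulr_ge0.
  - exact: intgZ.
have [F1 F2 F] := Rfubini ik i1 i2.
split; [exact: i1|exact: F1|apply: (eq_trans F)].
rewrite -(RintegralZl 2 measurableT ih); apply: eq_Rintegral => s _; exact: E.
Qed.

(** Inversion of the transform under a Gaussian cutoff is convolution with the kernel; the cutoff
    makes the double integral absolutely convergent. *)
Let FT_gauss_kernel (c : R) f (t : R) : 0 < c -> in_L1 leb f ->
  FT (fun w => (FT f w)^*%C * (gauss c w)%:C%C) t =
  2^-1%:C%C * Cintegral leb (fun s => (f s)^*%C * (K c (t - s))%:C%C).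
Proof.
move=> c0 If; have [mf _] := If.
pose k (z : measurableTypeR R * measurableTypeR R) :=
  (gauss c z.1)%:C%C * (expi (- pi * z.1 * t) * (expi (pi * z.1 * z.2) * (f z.2)^*%C)).
have mk : cmeasurable k.
  apply: cmeasurableM.
    apply: cmeasurable_real; exact: (measurableT_comp (measurable_gauss c) measurable_fst).
  apply: cmeasurableM.
    apply: cmeasurable_expi_comp; apply: measurable_funM; last exact: measurable_cst.
    by apply: measurable_funM; [exact: measurable_cst|exact: measurable_fst].
  apply: cmeasurableM; first exact: cmeasurable_expi_comp.
  apply: cmeasurableJ.
  exact: (@cmeasurable_comp _ _ (measurableTypeR R * measurableTypeR R)%type
       (measurableTypeR R) snd f measurable_snd mf).
have kle x y : cnorm (k (x, y)) <= gauss c x * cnorm (f y).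
  rewrite /k 3!cnormM !cnorm_expi !mul1r cnorm_real ger0_norm ?gauss_ge0//.
  by rewrite cnormJ.
have [i1 i2 e] := Cfubini mk (intg_gauss c0) (in_L1_cnorm If) kle.
have s2 : (Num.sqrt 2)^-1%:C%C * (Num.sqrt 2)^-1%:C%C = 2^-1%:C%C :> R[i].
  by rewrite -rmorphM/= -invfM -expr2 sqr_sqrtr.
have inner (w : R) : Cintegral leb (fun s => k (w, s)) = (gauss c w)%:C%C *
    (expi (- pi * w * t) * Cintegral leb (fun s => expi (pi * w * s) * (f s)^*%C)).
  have If' := in_L1_expi (pi * w) (in_L1J If).
  by rewrite -(CintegralZ _ If') -(CintegralZ _ (in_L1Z _ If')).
transitivity (2^-1%:C%C * Cintegral leb (fun w => Cintegral leb (fun s => k (w, s)))).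
  rewrite {1}/FT -s2 -mulrA; congr (_ * _); rewrite -(CintegralZ _ i1); congr Cintegral.
  apply/funext => w; transitivity ((Num.sqrt 2)^-1%:C%C * ((gauss c w)%:C%C *
    (expi (- pi * w * t) * Cintegral leb (fun s => expi (pi * w * s) * (f s)^*%C)))); last first.
    congr (_ * _); exact: (esym (inner w)).
  rewrite (conj_FT _ If) [- pi * t * w](_ : _ = - pi * w * t); last by ring.
  set C1 := Cintegral _ _; set C2 := expi _; set C3 := _%:C%C; set C4 := (gauss _ _)%:C%C.
  by ring.
rewrite e; congr (_ * _); congr Cintegral; apply/funext => s.
have -> : (fun w => k (w, s)) = (fun w => (f s)^*%C * (expi (- pi * (t - s) * w) * (gauss c w)%:C%C)).
  apply/funext => w; rewrite /k/=.
  have -> : - pi * (t - s) * w = - pi * w * t + pi * w * s by ring.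
  by rewrite expiD; ring.
have [ig Eg] := Cintegral_gauss (- pi * (t - s)) c0.
rewrite (CintegralZ _ ig) Eg; congr (_ * _%:C%C); rewrite /K /gauss; congr (_ * expR _).
by congr (- _); rewrite mulNr sqrrN exprMn; field; rewrite gt_eqF.
Qed.

(** The multiplication formula turns the left side into half of the double integral of
    [f t * (f s)^* * K c (t - s)]. The product of values is at most half the sum of their squares in
    modulus, and the mass 2 of the kernel then yields exactly [sqnorm f]. *)
Let FT_gauss_le (c : R) f : 0 < c -> in_L1 leb f -> in_L2 leb f ->
  intg (fun w => cnorm (FT f w) ^+ 2 * gauss c w) /\
  \int[leb]_w (cnorm (FT f w) ^+ 2 * gauss c w) <= sqnorm leb f.
Proof.
move=> c0 If Lf; have [mf _] := If; have mF := cmeasurable_FT If.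
set B := 2 * \int[leb]_t cnorm (f t).
have FB w : cnorm (FT f w) <= B := cnorm_FT_le w If.
have iG : intg (fun w => cnorm (FT f w) ^+ 2 * gauss c w).
  apply: (@intg_le _ _ _ leb _ (fun w => B ^+ 2 * gauss c w)).
  - by apply: measurable_funM; [exact: measurable_sqr_cnorm|exact: measurable_gauss].
  - move=> w; rewrite ger0_norm; last by rewrite mulr_ge0 ?gauss_ge0// sqr_ge0.
    by rewrite ler_wpM2r ?gauss_ge0// lerXn2r ?nnegrE ?cnorm_ge0// (le_trans _ (FB w))// cnorm_ge0.
  - by apply: intgZ; exact: intg_gauss.
split => //.
pose h w := (FT f w)^*%C * (gauss c w)%:C%C.
have Lh : in_L1 leb h.
  apply: (@in_L1_bounded _ _ _ leb B); first exact: cmeasurableJ.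
    by move=> w; rewrite cnormJ.
  by apply: (@in_L1_le _ _ _ leb _ (gauss c)); [exact: (cmeasurable_real (measurable_gauss c))| |exact: intg_gauss] => w;
    rewrite cnorm_real ger0_norm ?gauss_ge0.
have -> : \int[leb]_w (cnorm (FT f w) ^+ 2 * gauss c w) =
    complex.Re (Cintegral leb (fun w => FT f w * h w)).
  apply: eq_Rintegral => w _.
  by rewrite /h mulrA mulcJ ReM/= mulr0 subr0.
rewrite FT_mult_formula//.
have /in_L2P[_ i2] := Lf.
have [c1 c2 c3] := convolution_intg c0 (fun s => sqr_ge0 (cnorm (f s))) i2.
have B2 : exists M : R, forall w, cnorm (FT h w) <= M.
  by eexists => w; exact: (cnorm_FT_le w Lh).
have [M hM] := B2.
have iR : in_L1 leb (fun t => f t * FT h t).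
  have := @in_L1_bounded _ _ _ leb M _ _ (cmeasurable_FT Lh) hM If.
  by under eq_fun do rewrite mulrC.
have /in_L1P[iRe _] := iR.
apply: (@le_trans _ _ (\int[leb]_t (2^-1 * cnorm (f t) ^+ 2 +
   4^-1 * \int[leb]_s (cnorm (f s) ^+ 2 * K c (t - s))))); last first.
  rewrite RintegralD//; [|exact: intgZ|exact: intgZ].
  rewrite !RintegralZl// c3 -/(sqnorm leb f); lra.
apply: le_Rintegral => //; first by apply: intgD; exact: intgZ.
move=> t _; rewrite FT_gauss_kernel//.
have [k1 k2] := K_shift t c0.
have iK : in_L1 leb (fun s => (f s)^*%C * (K c (t - s))%:C%C).
  have : in_L1 leb (fun s => (K c (t - s))%:C%C * (f s)^*%C).
    apply: (@in_L1_bounded _ _ _ leb (Num.sqrt (pi / c))); last exact: in_L1J.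
      by apply: cmeasurable_real; exact: (intg_measurable k1).
    by move=> s; rewrite cnorm_real ger0_norm ?K_ge0// K_le.
  by under eq_fun do rewrite mulrC.
rewrite mulrCA -(CintegralZ _ iK) ReM/= mul0r subr0.
have /in_L1P[jr _] := in_L1Z (f t) iK.
have -> : 2^-1 * cnorm (f t) ^+ 2 + 4^-1 * \int[leb]_s (cnorm (f s) ^+ 2 * K c (t - s)) =
  2^-1 * \int[leb]_s (2^-1 * (cnorm (f t) ^+ 2 * K c (t - s)) +
            2^-1 * (cnorm (f s) ^+ 2 * K c (t - s))).
  rewrite RintegralD//; [|exact/intgZ/intgZ|exact: intgZ].
  rewrite (RintegralZl _ measurableT (intgZ _ k1)) (RintegralZl _ measurableT k1).
  by rewrite (RintegralZl _ measurableT (c1 t)) k2; field.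
rewrite ler_wpM2l ?invr_ge0//; apply: le_Rintegral => //.
  by apply: intgD; [exact/intgZ/intgZ|exact: intgZ].
move=> s _; rewrite -mulrDr -mulrDl mulrA.
rewrite ReM ImR mulr0 subr0 ReM ReJ ImJ ReR [leRHS]mulrA; apply: ler_wpM2r => //.
rewrite !sqr_cnorm; case: (f t) => a b; case: (f s) => x y /=.
by have := sqr_ge0 (a - x); have := sqr_ge0 (b - y); lra.
Qed.

(** The cutoff is removed by Fatou's lemma as [c = 1 / (n + 1)] tends to 0. Fatou gives an
    inequality; equality is proved in [FL_isometry]. *)
Lemma FT_contraction f : in_L1 leb f -> in_L2 leb f ->
  in_L2 leb (FT f) /\ sqnorm leb (FT f) <= sqnorm leb f.
Proof.
move=> If Lf; have mF := cmeasurable_FT If.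
have c0 n : (0 : R) < n.+1%:R^-1 by rewrite invr_gt0.
have [||||||i le] := @Rfatou _ _ _ leb
  (fun n w => cnorm (FT f w) ^+ 2 * gauss n.+1%:R^-1 w) (fun w => cnorm (FT f w) ^+ 2) (sqnorm leb f).
- by move=> n; case: (FT_gauss_le (c0 n) If Lf).
- by move=> n w; rewrite mulr_ge0 ?sqr_ge0 ?gauss_ge0.
- exact: measurable_sqr_cnorm.
- by move=> w; exact: sqr_ge0.
- apply: aeW => w; rewrite -[X in _ --> X]mulr1; apply: cvgMr.
  rewrite /gauss -[X in _ --> X]expR0; apply: cvg_seq_comp; first exact: continuous_expR.
  rewrite -[X in _ --> X]oppr0 -[X in _ --> - X](mul0r (w ^+ 2)); apply: cvgN; apply: cvgMl; exact: cvg_harmonic.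
- by move=> n; case: (FT_gauss_le (c0 n) If Lf).
by split => //; apply/in_L2P.
Qed.

End fourier_transform.

(** * Completeness of L_2 *)

Section limsup.
Variable R : realType.

(** A substitute for the limit that is defined for every sequence, is measurable in parameters, and
    agrees with the limit where there is one. *)
Definition Rlimsup (u : nat -> R) : R := fine (limn_esup (fun n => (u n)%:E)).

Lemma cvg_Rlimsup (u : nat -> R) (l : R) : u n @[n --> \oo] --> l -> Rlimsup u = l.
Proof.
move=> ul; rewrite /Rlimsup; have -> // := (@cvg_limn_einf_sup R (fun n => (u n)%:E) l%:E _).2.
by apply: cvg_EFin => //; exact: nearW.
Qed.

Lemma measurable_Rlimsup d (T : measurableType d) (u : nat -> T -> R) :
  (forall n, measurable_fun [set: T] (u n)) ->
  measurable_fun [set: T] (fun x => Rlimsup (u ^~ x)).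
Proof.
move=> mu; apply: measurableT_comp => //.
apply: (@measurable_fun_limn_esup _ _ _ _ (fun n x => (u n x)%:E)) => n.
exact/measurable_EFinP.
Qed.

End limsup.

Section riesz_fischer.
Variable R : realType.
Notation leb := (@lebesgue_measure R).
Notation intg f := (leb.-integrable [set: R] (EFin \o f)).
Implicit Types f g : R -> R[i].

Variable g : nat -> R -> R[i].
Hypothesis Lg : forall n, in_L2 leb (g n).
Hypothesis g4 : forall n, sqnorm leb (fun x => g n.+1 x - g n x) <= 4^-1 ^+ n.

Let diff n x := g n.+1 x - g n x.

Let Ldiff n : in_L2 leb (diff n). Proof. exact: in_L2B. Qed.

Let a n x := cnorm (diff n x) * gauss 1 x.

Let a_ge0 n x : 0 <= a n x.
Proof. by rewrite mulr_ge0 ?cnorm_ge0 ?gauss_ge0. Qed.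

(* [|d| w <= (w^2 / 2^n + 2^n |d|^2) / 2] makes the series of the [a n] integrable
   for the fast Cauchy sequence [g]. *)
Let a_intg n : intg (a n) /\ \int[leb]_x a n x <= (Num.sqrt (pi / 2) + 1) * 2^-1 ^+ n.
Proof.
have /in_L2P[md id] := Ldiff n.
pose b x := 2^-1 ^+ n * gauss 2 x + 2 ^+ n * cnorm (diff n x) ^+ 2.
have p0 : (2 ^+ n : R) != 0 by rewrite expf_neq0.
have ab x : a n x <= b x.
  have -> : b x = 2^-1 ^+ n * (gauss 1 x ^+ 2 + (2 ^+ n * cnorm (diff n x)) ^+ 2).
    rewrite /b; have -> : gauss 2 x = gauss 1 x ^+ 2.
      by rewrite /gauss -expRM_natl; congr expR; ring.
    by rewrite exprVn; move: p0; set p := 2 ^+ n => p0; field.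
  have -> : a n x = 2^-1 ^+ n * (gauss 1 x * (2 ^+ n * cnorm (diff n x))).
    by rewrite /a exprVn; move: p0; set p := 2 ^+ n => p0; field.
  rewrite ler_wpM2l ?exprn_ge0 ?invr_ge0//.
  set y := 2 ^+ n * _; have := sqr_ge0 (gauss 1 x - y).
  have : 0 <= gauss 1 x * y by rewrite mulr_ge0 ?gauss_ge0// mulr_ge0 ?exprn_ge0 ?cnorm_ge0.
  nra.
have ib : intg b by apply: intgD; apply: intgZ => //; exact: intg_gauss.
have ia : intg (a n).
  apply: intg_le ib; first by apply: measurable_funM; [exact: measurable_cnorm|exact: measurable_gauss].
  by move=> x; rewrite ger0_norm.
split => //; apply: (@le_trans _ _ (\int[leb]_x b x)); first exact: le_Rintegral.
rewrite /b RintegralD//; [|by apply: intgZ; exact: intg_gauss|exact: intgZ].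
rewrite !RintegralZl//; last exact: intg_gauss.
rewrite Rintegral_gauss// [leRHS]mulrC [leRHS]mulrDr mulr1; apply: lerD => //.
have p2 : (0 : R) <= 2 ^+ n by rewrite exprn_ge0.
apply: (le_trans (ler_wpM2l p2 (g4 n))).
by rewrite -exprMn; have -> : 2 * 4^-1 = 2^-1 :> R by field.
Qed.

Let a_summable : {ae leb, forall x, cvgn (series (a ^~ x))}.
Proof.
have ma n : measurable_fun [set: R] (a n) by exact: (intg_measurable (a_intg n).1).
pose A x := (\sum_(0 <= k <oo) (a k x)%:E)%E.
have mA : measurable_fun [set: R] A.
  apply: ge0_emeasurable_sum => [k x _ _|k _]; first by rewrite lee_fin.
  exact/measurable_EFinP.
have A0 x : (0 <= A x)%E by apply: nneseries_ge0 => k _ _; rewrite lee_fin.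
have iA : leb.-integrable [set: R] A.
  apply/integrableP; split => //.
  under eq_integral do rewrite gee0_abs//.
  rewrite integral_nneseries//; last 2 first.
  - by move=> n; apply/measurable_EFinP; exact: ma.
  - by move=> n x _; rewrite lee_fin.
  pose C : R := Num.sqrt (pi / 2) + 1.
  apply: (@le_lt_trans _ _ (\sum_(0 <= k <oo) (C * 2^-1 ^+ k)%:E)%E).
    apply: lee_nneseries => [k _ _|k _].
      by apply: integral_ge0 => x _; rewrite lee_fin.
    by rewrite -(EFin_Rintegral (a_intg k).1) lee_fin; case: (a_intg k).
  have h2 : `|2^-1 : R| < 1 by rewrite ger0_norm//; lra.
  have : (fun n => (series (geometric C 2^-1) n)%:E) @ \oo --> (C * (1 - 2^-1)^-1)%:E.
    by apply: cvg_EFin; [exact: nearW|exact: cvg_geometric_series].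
  move=> /cvg_lim c; rewrite [ltLHS](_ : _ = (C * (1 - 2^-1)^-1)%:E) ?ltry//.
  rewrite -c//; congr (lim (_ @ \oo)); apply/funext => n.
  by rewrite /series/= sumEFin.
apply: (ae_imp (integrable_ae measurableT iA)) => x /(_ I) Afin.
apply: nondecreasing_is_cvgn.
  by apply/nondecreasing_series => k _ _; exact: a_ge0.
exists (fine (A x)) => _ [n _ <-]; rewrite -lee_fin fineK// /series/= -sumEFin.
by apply: nneseries_lim_ge => k _ _; rewrite lee_fin.
Qed.

Let lim_g x : R[i] := (Rlimsup (fun n => complex.Re (g n x)) +i*
                       Rlimsup (fun n => complex.Im (g n x)))%C.

Let mlim : @cmeasurable _ (measurableTypeR R) R lim_g.
Proof. by split; apply: measurable_Rlimsup => n; case: (Lg n) => -[]. Qed.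

Let cvg_g : {ae leb, forall x,
  complex.Re (g n x) @[n --> \oo] --> complex.Re (lim_g x) /\
  complex.Im (g n x) @[n --> \oo] --> complex.Im (lim_g x)}.
Proof.
apply: (ae_imp a_summable) => x sx.
have H (p : R[i] -> R) : (forall z, `|p z| <= cnorm z) ->
    (forall z w, p (z - w) = p z - p w) -> cvgn (fun n => p (g n x)).
  move=> pn pB.
  have c1 : cvgn (series (fun n => cnorm (diff n x))).
    (* The Gaussian weight made the series integrable in [x]; at a fixed point it is a positive
       constant and can be divided out. *)
    have -> : (fun n => cnorm (diff n x)) = (fun n => (gauss 1 x)^-1 * a n x).
      by apply/funext => n; rewrite mulrC /a mulfK// gt_eqF// gauss_gt0.
    exact: is_cvg_seriesZ.
  have c2 : cvgn (series (fun n => p (diff n x))).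
    apply: normed_cvg; apply: series_le_cvg c1 => n //=; exact: cnorm_ge0.
  have -> : (fun n => p (g n x)) = (fun n => series (fun n => p (diff n x)) n + p (g 0%N x)).
    apply/funext => n; rewrite /series/= (eq_bigr (fun k => p (g k.+1 x) - p (g k x))).
      by rewrite telescope_sumr// subrK.
    by move=> k _; rewrite /diff pB.
  by apply: is_cvgD => //; exact: is_cvg_cst.
have R1 : cvgn (fun n => complex.Re (g n x)).
  by apply: H; [exact: normr_Re_le|move=> z w; rewrite !ReImE].
have I1 : cvgn (fun n => complex.Im (g n x)).
  by apply: H; [exact: normr_Im_le|move=> z w; rewrite !ReImE].
by split; rewrite /lim_g/=; [rewrite (cvg_Rlimsup R1)|rewrite (cvg_Rlimsup I1)].
Qed.

(** The constant 4 is the fixed point of the recursion from [n.+1] to [n]: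
    [2 * (4 * 4^-1) + 2 = 4]. *)
Let tail n j : sqnorm leb (fun x => g (n + j)%N x - g n x) <= 4 * 4^-1 ^+ n.
Proof.
elim: j n => [|j ih] n.
  rewrite addn0; under [X in sqnorm _ X]eq_fun do rewrite subrr.
  rewrite /sqnorm; under eq_Rintegral do rewrite cnorm0 expr0n/=.
  by rewrite Rintegral_cst// mul0r mulr_ge0// exprn_ge0// invr_ge0.
have := sqnormD_le (in_L2B (Lg (n.+1 + j)) (Lg n.+1)) (Ldiff n).
have -> : (fun x => g (n.+1 + j)%N x - g n.+1 x + diff n x) =
    (fun x => g (n + j.+1)%N x - g n x).
  by apply/funext => x; rewrite addSnnS /diff; ring.
move=> /le_trans; apply; have := ih n.+1; have := g4 n.
have : 0 <= (4^-1 ^+ n : R) by rewrite exprn_ge0// invr_ge0.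
by rewrite exprS; rewrite -/(diff n); lra.
Qed.

(** Riesz-Fischer for increments that decay geometrically: Fatou's lemma in [j] applied to the
    bounds [tail n j]. *)
Lemma L2_complete : exists2 h, in_L2 leb h &
  sqnorm leb (fun x => g n x - h x) @[n --> \oo] --> (0 : R).
Proof.
have main n : in_L2 leb (fun x => lim_g x - g n x) /\
    sqnorm leb (fun x => lim_g x - g n x) <= 4 * 4^-1 ^+ n.
  have mB : cmeasurable (fun x => lim_g x - g n x).
    by apply: cmeasurableB; [exact: mlim|case: (Lg n)].
  have [||||||i le] := @Rfatou _ _ _ leb (fun j x => cnorm (g (n + j)%N x - g n x) ^+ 2)
     (fun x => cnorm (lim_g x - g n x) ^+ 2) (4 * 4^-1 ^+ n).
  - by move=> j; case/in_L2P : (in_L2B (Lg (n + j)) (Lg n)).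
  - by move=> j x; exact: sqr_ge0.
  - exact: measurable_sqr_cnorm.
  - by move=> x; exact: sqr_ge0.
  - apply: (ae_imp cvg_g) => x [cr ci].
    have sh (u : nat -> R) (l : R) : u m @[m --> \oo] --> l -> u (n + j)%N @[j --> \oo] --> l.
      by move=> ul; under eq_fun do rewrite addnC; move: ul; rewrite -(cvg_shiftn n u (nbhs l)).
    have {cr} cr := sh _ _ cr; have {ci} ci := sh _ _ ci.
    move: (lim_g x) cr ci => l cr ci.
    have -> : (fun j => cnorm (g (n + j)%N x - g n x) ^+ 2) = (fun j =>
        (complex.Re (g (n + j)%N x) - complex.Re (g n x)) * (complex.Re (g (n + j)%N x) - complex.Re (g n x)) +
        (complex.Im (g (n + j)%N x) - complex.Im (g n x)) * (complex.Im (g (n + j)%N x) - complex.Im (g n x))).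
      by apply/funext => j; rewrite sqr_cnorm !ReImE !expr2.
    rewrite sqr_cnorm !ReImE !expr2.
    have cr' : complex.Re (g (n + j)%N x) - complex.Re (g n x) @[j --> \oo] -->
        complex.Re l - complex.Re (g n x) by apply: cvgB => //; exact: cvg_cst.
    have ci' : complex.Im (g (n + j)%N x) - complex.Im (g n x) @[j --> \oo] -->
        complex.Im l - complex.Im (g n x) by apply: cvgB => //; exact: cvg_cst.
    exact: (cvgD (cvgM cr' cr') (cvgM ci' ci')).
  - by move=> j; exact: tail.
  by split => //; apply/in_L2P.
have Lh : in_L2 leb lim_g.
  have := in_L2D (main 0%N).1 (Lg 0).
  by under eq_fun do rewrite subrK.
exists lim_g => //.
apply: (@squeeze_cvgr _ _ _ _ (fun=> 0) (fun n => 4 * 4^-1 ^+ n)).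
- apply: nearW => n; rewrite sqnorm_ge0/= -sqnormN.
  by under [X in sqnorm _ X]eq_fun do rewrite opprB; case: (main n).
- exact: cvg_cst.
- rewrite -(mulr0 4); apply: cvgMr; apply: cvg_expr.
  by rewrite ger0_norm; lra.
Qed.

End riesz_fischer.

(** * The Fourier transform on L_2 *)

Section L2_fourier_transform.
Variable R : realType.
Notation leb := (@lebesgue_measure R).
Implicit Types f g h : R -> R[i].

Definition trunc (n : nat) f : R -> R[i] :=
  fun t => (\1_`[- n%:R, n%:R] t)%:C%C * f t.

Lemma cmeasurable_trunc n f : @cmeasurable _ (measurableTypeR R) R f ->
  @cmeasurable _ (measurableTypeR R) R (trunc n f).
Proof. by move=> mf; apply: cmeasurableM => //; exact: cmeasurable_real. Qed.

Lemma cnorm_trunc_le n f t : cnorm (trunc n f t) <= cnorm (f t).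
Proof.
rewrite cnormM cnorm_real ler_piMl ?cnorm_ge0// indicE.
by case: (_ \in _); rewrite ?normr1 ?normr0.
Qed.

Lemma in_L2_trunc n f : in_L2 leb f -> in_L2 leb (trunc n f).
Proof.
move=> /in_L2P[mf If]; apply: (in_L2_le _ _ If); first exact: cmeasurable_trunc.
by move=> t; rewrite lerXn2r ?nnegrE ?cnorm_ge0// cnorm_trunc_le.
Qed.

Lemma in_L1_trunc n f : in_L2 leb f -> in_L1 leb (trunc n f).
Proof.
move=> /in_L2P[mf If].
apply: (@in_L1_le _ _ _ leb _ (fun t => \1_`[- n%:R, n%:R] t + cnorm (f t) ^+ 2)).
- exact: cmeasurable_trunc.
- move=> t; rewrite cnormM cnorm_real indicE.
  have := sqr_ge0 (cnorm (f t) - 1); have := cnorm_ge0 (f t).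
  move: (cnorm (f t)) => y.
  by case: (_ \in _); rewrite ?mulr1n ?mulr0n ?normr1 ?normr0 ?mul1r ?mul0r => ? ?; nra.
- by apply: intgD => //; exact: integrable_indic_itv.
Qed.

Lemma cvg_trunc f : in_L2 leb f ->
  sqnorm leb (fun t => trunc n f t - f t) @[n --> \oo] --> (0 : R).
Proof.
move=> Lf; have /in_L2P[mf If] := Lf.
have [|||||_] := @Rintegral_dct _ _ _ leb
  (fun n t => cnorm (trunc n f t - f t) ^+ 2) (fun=> 0) (fun t => 4 * cnorm (f t) ^+ 2).
- move=> n; apply: measurable_sqr_cnorm; apply: cmeasurableB => //.
  exact: cmeasurable_trunc.
- exact: measurable_cst.
- apply: aeW => t.
  have -> : (fun n => cnorm (trunc n f t - f t) ^+ 2) =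
      (fun n => (1 - \1_`[- n%:R, n%:R] t) ^+ 2 * cnorm (f t) ^+ 2).
    apply/funext => n; rewrite /trunc -{2}(mul1r (f t)) -mulrBl cnormM exprMn.
    rewrite -(rmorph1 (real_complex R)) -rmorphB cnorm_real real_normK ?num_real//.
    by congr (_ * _); ring.
  rewrite -(mul0r (cnorm (f t) ^+ 2)); apply: cvgMl; rewrite -[X in _ --> X](mul0r (0 : R)).
  have c : (1 - \1_`[- n%:R, n%:R] t : R) @[n --> \oo] --> (0 : R).
    by rewrite -[X in _ --> X](subrr (1 : R)); apply: cvgB; [exact: cvg_cst|exact: cvg_indic_itv].
  exact: (cvgM c c).
- exact: intgZ.
- move=> n t; rewrite ger0_norm ?sqr_ge0//.
  apply: (le_trans (sqr_cnormD_le _ _)); rewrite cnormN.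
  have : cnorm (trunc n f t) ^+ 2 <= cnorm (f t) ^+ 2.
    by rewrite lerXn2r ?nnegrE ?cnorm_ge0// cnorm_trunc_le.
  by lra.
by rewrite Rintegral_cst// mul0r.
Qed.

Let FT_trunc_le n m f : in_L2 leb f ->
  sqnorm leb (fun x => FT (trunc n f) x - FT (trunc m f) x) <=
  2 * sqnorm leb (fun t => trunc n f t - f t) + 2 * sqnorm leb (fun t => trunc m f t - f t).
Proof.
move=> Lf; have Ln := in_L2_trunc n Lf; have Lm := in_L2_trunc m Lf.
have In := in_L1_trunc n Lf; have Im := in_L1_trunc m Lf.
have -> : (fun x => FT (trunc n f) x - FT (trunc m f) x) =
   FT (fun t => trunc n f t - trunc m f t) by apply/funext => x; rewrite FTB.
apply: (le_trans (FT_contraction (in_L1B In Im) (in_L2B Ln Lm)).2).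
have -> : (fun t => trunc n f t - trunc m f t) =
   (fun t => (trunc n f t - f t) - (trunc m f t - f t)) by apply/funext => t; ring.
by apply: sqnormB_le; exact: in_L2B.
Qed.

Let L2_FT_trunc n f : in_L2 leb f -> in_L2 leb (FT (trunc n f)).
Proof.
by move=> Lf; apply: (FT_contraction _ _).1; [exact: in_L1_trunc|exact: in_L2_trunc].
Qed.

(** The hypothesis on [f] stands inside the existential so that a choice of [h] defines a total
    function [FL]. A fast subsequence [N k] of truncations meets the hypothesis of [L2_complete],
    and [FT_trunc_le] carries its limit over to the whole sequence. *)
Lemma FL_subproof f : exists h, in_L2 leb f ->
  in_L2 leb h /\ sqnorm leb (fun x => FT (trunc n f) x - h x) @[n --> \oo] --> (0 : R).
Proof.
have [Lf|nLf] := pselect (in_L2 leb f); last by exists (fun=> 0) => /nLf.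
have cf := cvg_trunc Lf.
(* The extra factor [4^-1] leaves room for the two doubled terms of [FT_trunc_le]. *)
have hN k : exists N, forall n, (N <= n)%N ->
    sqnorm leb (fun t => trunc n f t - f t) <= 4^-1 * 4^-1 ^+ k.
  have e0 : (0 : R) < 4^-1 * 4^-1 ^+ k by rewrite mulr_gt0 ?exprn_gt0 ?invr_gt0.
  move/cvgrPdist_le : cf => /(_ _ e0) [N _ NP]; exists N => n Nn.
  by have := NP n Nn; rewrite /= sub0r normrN ger0_norm ?sqnorm_ge0.
have [N NP] := choice hN.
have [||h Lh ch] := @L2_complete R (fun k => FT (trunc (N k) f)).
- by move=> n; exact: L2_FT_trunc.
- move=> k; apply: (le_trans (FT_trunc_le _ _ Lf)).
  have := NP k (N k) (leqnn _); have := NP k.+1 (N k.+1) (leqnn _).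
  have : (0 : R) <= 4^-1 ^+ k by rewrite exprn_ge0// invr_ge0.
  by rewrite exprS; lra.
exists h => _; split; [exact: Lh|]; apply/cvgrPdist_le => /= e e0.
have e4 : 0 < e / 8 by rewrite divr_gt0.
have [k [k1 k2]] : exists k, sqnorm leb (fun x => FT (trunc (N k) f) x - h x) <= e / 8 /\
    4^-1 * 4^-1 ^+ k <= e / 16.
  have e16 : 0 < e / 16 by rewrite divr_gt0.
  have c2 : 4^-1 * 4^-1 ^+ k @[k --> \oo] --> (0 : R).
    rewrite -(mulr0 4^-1); apply: cvgMr; apply: cvg_expr; rewrite ger0_norm; lra.
  near \oo => k; exists k; split; near: k.
    move/cvgrPdist_le : ch => /(_ _ e4); apply: filterS => k.
    by rewrite sub0r normrN ger0_norm ?sqnorm_ge0.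
  move/cvgrPdist_le : c2 => /(_ _ e16); apply: filterS => k.
  by rewrite sub0r normrN ger0_norm// mulr_ge0 ?exprn_ge0 ?invr_ge0.
exists (N k) => // n /= Nn; rewrite sub0r normrN ger0_norm ?sqnorm_ge0//.
have -> : (fun x => FT (trunc n f) x - h x) =
  (fun x => (FT (trunc n f) x - FT (trunc (N k) f) x) + (FT (trunc (N k) f) x - h x)).
  by apply/funext => x; rewrite addrA subrK.
apply: le_trans (sqnormD_le _ _) _; [by apply: in_L2B; exact: L2_FT_trunc|
  by apply: in_L2B => //; exact: L2_FT_trunc|].
have := FT_trunc_le n (N k) Lf; have := NP k n Nn; have := NP k (N k) (leqnn _).
by lra.
Unshelve. all: by end_near. Qed.

(* The Fourier-Plancherel transform, as the limit in L_2 of the Fourier integrals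
   over the segments [-n, n]. *)
Definition FL f : R -> R[i] := projT1 (cid (FL_subproof f)).

Lemma in_L2_FL f : in_L2 leb f -> in_L2 leb (FL f).
Proof. by move=> Lf; rewrite /FL; case: cid => h /= /(_ Lf)[]. Qed.

Lemma cvg_FL f : in_L2 leb f ->
  sqnorm leb (fun x => FT (trunc n f) x - FL f x) @[n --> \oo] --> (0 : R).
Proof. by move=> Lf; rewrite /FL; case: cid => h /= /(_ Lf)[]. Qed.

Lemma L2_limit_unique (u : nat -> R -> R[i]) h h' : (forall n, in_L2 leb (u n)) ->
  in_L2 leb h -> in_L2 leb h' ->
  sqnorm leb (fun x => u n x - h x) @[n --> \oo] --> (0 : R) ->
  sqnorm leb (fun x => u n x - h' x) @[n --> \oo] --> (0 : R) -> aeeq leb h h'.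
Proof.
move=> Lu Lh Lh' uh uh'.
have s0 : sqnorm leb (fun x => h x - h' x) = 0.
  apply/eqP; rewrite eq_le sqnorm_ge0 andbT.
  have c (v : nat -> R) : v n @[n --> \oo] --> (0 : R) -> 2 * v n @[n --> \oo] --> (0 : R).
    by move=> v0; rewrite -(mulr0 2); exact: cvgMr.
  apply: (cvg_le0 (c _ uh') (c _ uh)) => n.
  have -> : (fun x => h x - h' x) =
      (fun x => (u n x - h' x) - (u n x - h x)) by apply/funext => x; ring.
  by apply: sqnormB_le; exact: in_L2B.
apply: (ae_imp (sqnorm_eq0 (in_L2B Lh Lh') s0)) => x /eqP.
by rewrite subr_eq0 => /eqP.
Qed.

Lemma FL_unique f h : in_L2 leb f -> in_L2 leb h ->
  sqnorm leb (fun x => FT (trunc n f) x - h x) @[n --> \oo] --> (0 : R) ->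
  aeeq leb (FL f) h.
Proof.
move=> Lf Lh; apply: L2_limit_unique => //.
- by move=> n; exact: L2_FT_trunc.
- exact: in_L2_FL.
- exact: cvg_FL.
Qed.

Lemma FL_L1 f : in_L1 leb f -> in_L2 leb f -> aeeq leb (FL f) (FT f).
Proof.
move=> If Lf; apply: FL_unique => //; first by case: (FT_contraction If Lf).
apply: (@squeeze_cvgr _ _ _ _ (fun=> 0) (fun n => sqnorm leb (fun t => trunc n f t - f t))).
- apply: nearW => n; rewrite sqnorm_ge0/=.
  have -> : (fun x => FT (trunc n f) x - FT f x) = FT (fun t => trunc n f t - f t).
    by apply/funext => x; rewrite FTB//; exact: in_L1_trunc.
  apply: (FT_contraction _ _).2; first by apply: in_L1B => //; exact: in_L1_trunc.
  by apply: in_L2B => //; exact: in_L2_trunc.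
- exact: cvg_cst.
- exact: cvg_trunc.
Qed.

Lemma FL_ae f g : in_L2 leb f -> in_L2 leb g -> aeeq leb f g -> aeeq leb (FL f) (FL g).
Proof.
move=> Lf Lg fg; apply: FL_unique => //; first exact: in_L2_FL.
have -> : (fun n => sqnorm leb (fun x => FT (trunc n f) x - FL g x)) =
          (fun n => sqnorm leb (fun x => FT (trunc n g) x - FL g x)); last exact: cvg_FL.
apply/funext => n; congr sqnorm; apply/funext => x; congr (_ - _).
rewrite /FT; congr (_ * _); apply: eq_ae_Cintegral.
- by case: (in_L1_expi (- pi * x) (in_L1_trunc n Lf)).
- by case: (in_L1_expi (- pi * x) (in_L1_trunc n Lg)).
- by apply: (ae_imp fg) => t; rewrite /trunc => ->.
Qed.

Lemma FL_linear (a : R[i]) f g : in_L2 leb f -> in_L2 leb g ->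
  aeeq leb (FL (fun t => a * f t + g t)) (fun x => a * FL f x + FL g x).
Proof.
move=> Lf Lg; have Laf := in_L2Z a Lf; have LFf := in_L2_FL Lf; have LFg := in_L2_FL Lg.
apply: (FL_unique (in_L2D Laf Lg) (in_L2D (in_L2Z a LFf) LFg)).
apply: (@squeeze_cvgr _ _ _ _ (fun=> 0) (fun n =>
   2 * (cnorm a ^+ 2 * sqnorm leb (fun x => FT (trunc n f) x - FL f x)) +
   2 * sqnorm leb (fun x => FT (trunc n g) x - FL g x))).
- apply: nearW => n; rewrite sqnorm_ge0/=.
  have -> : (fun x => FT (trunc n (fun t => a * f t + g t)) x - (a * FL f x + FL g x)) =
     (fun x => a * (FT (trunc n f) x - FL f x) + (FT (trunc n g) x - FL g x)).
    apply/funext => x.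
    have -> : trunc n (fun t => a * f t + g t) = (fun t => a * trunc n f t + trunc n g t).
      by apply/funext => t; rewrite /trunc; ring.
    rewrite FTD ?FTZ; [by ring|exact: in_L1_trunc|exact/in_L1Z/in_L1_trunc|exact: in_L1_trunc].
  have Bf := in_L2B (L2_FT_trunc n Lf) LFf; have Bg := in_L2B (L2_FT_trunc n Lg) LFg.
  by rewrite -(sqnormZ a Bf); exact: (sqnormD_le (in_L2Z a Bf) Bg).
- exact: cvg_cst.
- have -> : (0 : R) = 2 * (cnorm a ^+ 2 * 0) + 2 * 0 by rewrite !mulr0 addr0.
  by apply: cvgD; apply: cvgMr; [apply: cvgMr|]; exact: cvg_FL.
Qed.

(** Both pairings are limits of pairings of truncations, where [FT_mult_formula] applies. *)
Lemma FL_mult_formula f g : in_L2 leb f -> in_L2 leb g ->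
  Cintegral leb (fun w => FL f w * g w) = Cintegral leb (fun t => f t * FL g t).
Proof.
move=> Lf Lg.
have c1 := cvg_CintegralM (fun n => L2_FT_trunc n Lf) (in_L2_FL Lf)
   (fun n => in_L2_trunc n Lg) Lg (cvg_FL Lf) (cvg_trunc Lg).
have c2 := cvg_CintegralM (fun n => in_L2_trunc n Lf) Lf
   (fun n => L2_FT_trunc n Lg) (in_L2_FL Lg) (cvg_trunc Lf) (cvg_FL Lg).
apply/eqP; rewrite -subr_eq0; apply/eqP/cnorm_eq0/eqP.
rewrite eq_le cnorm_ge0 andbT.
apply: (cvg_le0 c1 c2) => n.
rewrite FT_mult_formula; [|exact: in_L1_trunc|exact: in_L1_trunc].
set I := Cintegral leb (fun t => trunc n f t * FT (trunc n g) t).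
set A := Cintegral leb (fun w => FL f w * g w); set B := Cintegral leb (fun t => f t * FL g t).
have -> : A - B = - (I - A) + (I - B) by ring.
by rewrite (le_trans (cnormD _ _))// cnormN.
Qed.

End L2_fourier_transform.

Section polarization.
Context d1 (T1 : measurableType d1) d2 (T2 : measurableType d2) (R : realType).
Variables (mu : {measure set T1 -> \bar R}) (nu : {measure set T2 -> \bar R}).

Lemma L2isometry_inner (V : (T1 -> R[i]) -> (T2 -> R[i])) : L2isometry mu nu V ->
  forall f g, in_L2 mu f -> in_L2 mu g -> L2inner nu (V f) (V g) = L2inner mu f g.
Proof.
move=> [[VL Vae Vlin] Viso].
have iso f : in_L2 mu f -> sqnorm nu (V f) = sqnorm mu f.
  by move=> Lf; rewrite -!sqr_L2norm Viso.
have reE f g : in_L2 mu f -> in_L2 mu g ->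
    complex.Re (L2inner nu (V f) (V g)) = complex.Re (L2inner mu f g).
  move=> Lf Lg; apply: (@mulfI _ (2 : R)); first by rewrite pnatr_eq0.
  have lin : aeeq nu (V (fun x => f x + g x)) (fun y => V f y + V g y).
    have := Vlin 1 f g Lf Lg.
    have -> : (fun x => 1 * f x + g x) = (fun x => f x + g x).
      by apply/funext => x; rewrite mul1r.
    by move=> /ae_imp; apply => x ->; rewrite mul1r.
  rewrite !Re_L2inner//; try exact: VL.
  rewrite -(iso _ Lf) -(iso _ Lg) -(iso _ (in_L2D Lf Lg)).
  congr (_ - _ - _); apply/esym/eq_ae_sqnorm => //.
    by case: (VL _ (in_L2D Lf Lg)).
  by apply: cmeasurableD; [case: (VL _ Lf)|case: (VL _ Lg)].
move=> f g Lf Lg; apply: complexP; first exact: reE.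
have Lig := in_L2Z 'i%C Lg.
rewrite (Im_L2inner Lf Lg) -(reE _ _ Lf Lig) (Im_L2inner (VL _ Lf) (VL _ Lg)).
have iV : aeeq nu (V (fun x => 'i%C * g x)) (fun y => 'i%C * V g y).
  (* [L2linear] speaks of [a * f + g], so pure scaling takes [g = 0], whose image vanishes almost
     everywhere by the isometry. *)
  have L0 : in_L2 mu (fun=> 0) by have := in_L2B Lg Lg; under eq_fun do rewrite subrr.
  have V0 : aeeq nu (V (fun=> 0)) (fun=> 0).
    apply: sqnorm_eq0; first exact: VL.
    rewrite iso// /sqnorm; under eq_Rintegral do rewrite cnorm0 expr0n/=.
    by rewrite Rintegral_cst// mul0r.
  have := Vlin 'i%C g _ Lg L0.
  have -> : (fun x => 'i%C * g x + 0) = (fun x => 'i%C * g x).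
    by apply/funext => x; rewrite addr0.
  by move=> l; apply: (ae_imp2 l V0) => x -> ->; rewrite addr0.
congr complex.Re; apply: eq_ae_Cintegral.
- apply: cmeasurableM; first by case: (VL _ Lf).
  by apply/cmeasurableJ/cmeasurableM; [exact: cmeasurable_cst|case: (VL _ Lg)].
- apply: cmeasurableM; first by case: (VL _ Lf).
  by apply/cmeasurableJ; case: (VL _ Lig).
- by apply: (ae_imp iV) => x ->.
Qed.

End polarization.

(** * Inversion and isometry *)

Section plancherel.
Variable R : realType.
Notation leb := (@lebesgue_measure R).
Implicit Types f g h : R -> R[i].

Lemma Cintegral_shift f (a : R) : in_L1 leb f ->
  in_L1 leb (fun x => f (x + a)) /\ Cintegral leb (fun x => f (x + a)) = Cintegral leb f.
Proof.
move=> /in_L1P[rf jf]; have [r1 r2] := Rintegral_shift a rf.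
by have [j1 j2] := Rintegral_shift a jf; split; [exact/in_L1P|exact: complexP].
Qed.

Lemma sqr_gauss (c x : R) : gauss c x ^+ 2 = gauss (2 * c) x.
Proof. by rewrite /gauss -expRM_natl; congr expR; ring. Qed.

Lemma in_L2_gauss (u : R -> R[i]) (a c b : R) : 0 < c ->
  @cmeasurable _ (measurableTypeR R) R u -> (forall x, cnorm (u x) = 1) ->
  in_L1 leb (fun x => u x * (a * gauss c (x + b))%:C%C) /\
  in_L2 leb (fun x => u x * (a * gauss c (x + b))%:C%C).
Proof.
move=> c0 mu u1; have [ig _] := Rintegral_shift b (intg_gauss c0).
have c20 : 0 < 2 * c by rewrite mulr_gt0.
have [ig2 _] := Rintegral_shift b (intg_gauss c20).
have m1 : cmeasurable (fun x => u x * (a * gauss c (x + b))%:C%C).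
  apply: cmeasurableM => //; apply: cmeasurable_real; apply: measurable_funM.
    exact: measurable_cst.
  exact: (intg_measurable ig).
have nE x : cnorm (u x * (a * gauss c (x + b))%:C%C) = `|a| * gauss c (x + b).
  by rewrite cnormM u1 mul1r cnorm_real normrM [`|gauss _ _|]ger0_norm// gauss_ge0.
split.
- apply: (@in_L1_le _ _ _ leb _ (fun x => `|a| * gauss c (x + b))) => //.
  + by move=> x; rewrite nE.
  + exact: intgZ.
- apply: (@in_L2_le _ _ _ leb _ (fun x => `|a| ^+ 2 * gauss (2 * c) (x + b))) => //.
  + by move=> x; rewrite nE exprMn sqr_gauss.
  + exact: intgZ.
Qed.

Let psi (a t : R) : R[i] := expi (pi * a * t) * (1 * gauss 1 (t + 0))%:C%C.

Let K1 : R := (Num.sqrt 2)^-1 * Num.sqrt pi.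

Let gam (a w : R) : R[i] := 1 * (K1 * gauss (pi ^+ 2 / 4) (w + - a))%:C%C.

Let pi2_gt0 : 0 < pi ^+ 2 / 4 :> R.
Proof. by rewrite divr_gt0 ?exprn_gt0 ?pi_gt0. Qed.

Let psi_L a : in_L1 leb (psi a) /\ in_L2 leb (psi a).
Proof.
apply: in_L2_gauss => //; first exact: cmeasurable_expiM.
by move=> x; rewrite cnorm_expi.
Qed.

Let gam_L a : in_L1 leb (gam a) /\ in_L2 leb (gam a).
Proof.
apply: (@in_L2_gauss (fun=> 1)); [exact: pi2_gt0|exact: cmeasurable_cst|].
by move=> x; rewrite -(expi0 R) cnorm_expi.
Qed.

Let FT_psi a w : FT (psi a) w = gam a w.
Proof.
rewrite /FT.
have -> : (fun t => expi (- pi * w * t) * psi a t) =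
    (fun t => expi ((- pi * (w - a)) * t) * (gauss 1 t)%:C%C).
  apply/funext => t; rewrite /psi mulrA -expiD mul1r addr0; congr (expi _ * _); ring.
have [_ ->] := Cintegral_gauss (- pi * (w - a)) (@ltr01 R).
rewrite -rmorphM/= /gam mul1r; congr (_%:C)%C.
rewrite /K1 -[RHS]mulrA divr1; congr (_ * (_ * _)); rewrite /gauss; congr expR.
by field.
Qed.

(* [u] is the integrand of [FT (gam a) t] centred at [a]. *)
Let FT_gam a t : FT (gam a) t = (psi a t)^*%C.
Proof.
pose u x : R[i] := (K1%:C%C * expi (- pi * a * t)) *
   (expi ((- pi * t) * x) * (gauss (pi ^+ 2 / 4) x)%:C%C).
have [ig Eg] := Cintegral_gauss (- pi * t) pi2_gt0.
have iu : in_L1 leb u by exact: in_L1Z.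
rewrite /FT; have -> : (fun w => expi (- pi * t * w) * gam a w) = (fun w => u (w + - a)).
  apply/funext => w; rewrite /u /gam mul1r rmorphM/=.
  have -> : - pi * t * w = - pi * a * t + (- pi * t) * (w + - a) by ring.
  by rewrite expiD; ring.
rewrite (Cintegral_shift _ iu).2 /u (CintegralZ _ ig) Eg.
rewrite /psi mulJ conjc_real -expiN.
have -> : - (pi * a * t) = - pi * a * t by ring.
set s := (Num.sqrt 2)^-1%:C%C; set e := expi _; set y := (X in s * (_ * X)).
rewrite (_ : s * (K1%:C%C * e * y) = e * (s * K1%:C%C * y)); last by ring.
congr (_ * _); rewrite /s /y -!rmorphM/= /K1 mul1r addr0; congr (_%:C)%C.
have pi0 : (pi : R) != 0 by rewrite gt_eqF// pi_gt0.
have -> : Num.sqrt (pi / (pi ^+ 2 / 4)) = 2 / Num.sqrt pi :> R.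
  have -> : pi / (pi ^+ 2 / 4) = 2 ^+ 2 / pi :> R.
    by move: (pi) pi0 => p p0; field.
  by rewrite sqrtrM ?sqr_ge0// sqrtr_sqr ger0_norm// sqrtrV// pi_ge0.
have s2 : Num.sqrt 2 ^+ 2 = 2 :> R by rewrite sqr_sqrtr.
have s20 : Num.sqrt 2 != 0 :> R by rewrite gt_eqF// sqrtr_gt0.
have sp0 : Num.sqrt pi != 0 :> R by rewrite gt_eqF// sqrtr_gt0 pi_gt0.
have -> : expR (- ((- pi * t) ^+ 2 / (4 * (pi ^+ 2 / 4)))) = gauss 1 t.
  by rewrite /gauss; congr expR; move: (pi) pi0 => p p0; field.
rewrite -[RHS]mul1r mulrA; congr (_ * _).
transitivity (2 / Num.sqrt 2 ^+ 2 : R); last by rewrite s2 divff.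
move: s20 sp0; set x := Num.sqrt 2; set p := Num.sqrt pi => x0 p0.
by field; rewrite x0 p0.
Qed.

(** Two uses of the multiplication formula show that the difference [u] of the two sides pairs to 0
    with every [psi r]. As [psi r] is a character times [gauss 1], the integrable function
    [gauss 1 * u] has vanishing transform at all rational frequencies. *)
Lemma FL_involution f : in_L2 leb f ->
  aeeq leb (FL (fun w => (FL f w)^*%C)) (fun t => (f t)^*%C).
Proof.
move=> Lf; have LF := in_L2_FL Lf; have LFJ := in_L2J LF; have LFF := in_L2_FL LFJ.
have LfJ := in_L2J Lf.
pose u t := FL (fun w => (FL f w)^*%C) t - (f t)^*%C.
have Lu : in_L2 leb u by exact: in_L2B.
suff : aeeq leb (fun t => (gauss 1 t)%:C%C * u t) (fun=> 0).
  move=> h; apply: (ae_imp h) => t /eqP; rewrite mulf_eq0 => /orP[|].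
    by rewrite fmorph_eq0 gt_eqF// gauss_gt0.
  by rewrite subr_eq0 => /eqP.
have [_ Lg] := psi_L 0.
have Ig : in_L1 leb (fun t => (gauss 1 t)%:C%C * u t).
  have := in_L2_L1M Lg Lu; congr in_L1; apply/funext => t.
  by rewrite /psi mulr0 mul0r expi0 !mul1r addr0.
apply: fourier_unique => // r.
have [Ip Lp] := psi_L (ratr r); have [Igam Lgam] := gam_L (ratr r).
have -> : (fun w => expi (pi * ratr r * w) * ((gauss 1 w)%:C%C * u w)) =
  (fun w => FL (fun w => (FL f w)^*%C) w * psi (ratr r) w - (f w)^*%C * psi (ratr r) w).
  by apply/funext => w; rewrite /u /psi mul1r addr0; ring.
rewrite (CintegralB (in_L2_L1M LFF Lp) (in_L2_L1M LfJ Lp)).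
apply/eqP; rewrite subr_eq0; apply/eqP.
rewrite (FL_mult_formula LFJ Lp).
have a1 : aeeq leb (FL (psi (ratr r))) (gam (ratr r)).
  by apply: (ae_imp (FL_L1 Ip Lp)) => w ->; exact: FT_psi.
have a2 : aeeq leb (FL (gam (ratr r))) (fun t => (psi (ratr r) t)^*%C).
  by apply: (ae_imp (FL_L1 Igam Lgam)) => w ->; exact: FT_gam.
transitivity (Cintegral leb (fun w => (FL f w * gam (ratr r) w)^*%C)).
  apply: eq_ae_Cintegral.
  - by case: (in_L2_L1M LFJ (in_L2_FL Lp)).
  - by case: (in_L1J (in_L2_L1M LF Lgam)).
  - by apply: (ae_imp a1) => w ->; rewrite mulJ /gam mulJ !conjc_real.
rewrite (CintegralJ (in_L2_L1M LF Lgam)) (FL_mult_formula Lf Lgam).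
rewrite -(CintegralJ (in_L2_L1M Lf (in_L2_FL Lgam))).
apply: eq_ae_Cintegral.
- by case: (in_L1J (in_L2_L1M Lf (in_L2_FL Lgam))).
- by case: (in_L2_L1M LfJ Lp).
- by apply: (ae_imp a2) => w ->; rewrite mulJ conjcK.
Qed.

(** The multiplication formula against the conjugate of [FL f], followed by the inversion
    formula. *)
Lemma FL_isometry f : in_L2 leb f -> sqnorm leb (FL f) = sqnorm leb f.
Proof.
move=> Lf; have LF := in_L2_FL Lf; have LFJ := in_L2J LF.
suff : (sqnorm leb (FL f))%:C%C = (sqnorm leb f)%:C%C by case.
rewrite -!L2inner_sqnorm /L2inner (FL_mult_formula Lf LFJ).
apply: eq_ae_Cintegral.
- by case: (in_L2_L1M Lf (in_L2_FL LFJ)).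
- by case: (in_L2_L1M Lf (in_L2J Lf)).
- by apply: (ae_imp (FL_involution Lf)) => t ->.
Qed.

End plancherel.

(** * The unitary map onto L_2(mu') *)

Section gaussian_measure.
Variable R : realType.
Notation leb := (@lebesgue_measure R).
Notation mup := (@mu' R).
Notation TR := (measurableTypeR R).
Notation intg f := (leb.-integrable [set: R] (EFin \o f)).

Lemma phi_gt0 (w : R) : 0 < phi w.
Proof. by rewrite mulr_gt0 ?expR_gt0// sqrtr_gt0 divr_gt0 ?pi_gt0. Qed.

Lemma phi_ge0 (w : R) : 0 <= phi w. Proof. exact/ltW/phi_gt0. Qed.

Lemma phi_gauss (w : R) : phi w = Num.sqrt (pi / 2) * gauss (pi ^+ 2 / 2) w.
Proof. by rewrite /phi /gauss; congr (_ * expR (- _)); ring. Qed.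

Let pi2_gt0 : 0 < pi ^+ 2 / 2 :> R.
Proof. by rewrite divr_gt0 ?exprn_gt0 ?pi_gt0. Qed.

Lemma intg_phi : intg (@phi R).
Proof.
rewrite (_ : @phi R = fun w => Num.sqrt (pi / 2) * gauss (pi ^+ 2 / 2) w).
  by apply: intgZ; exact: intg_gauss.
by apply/funext => w; exact: phi_gauss.
Qed.

Lemma measurable_phi : @measurable_fun _ _ TR R setT (@phi R).
Proof. exact: (intg_measurable intg_phi). Qed.

Lemma mu'_dominates : mup `<< leb.
Proof. by rewrite mu'E; exact: normal_prob_dominates. Qed.

(** The change of variables is stated for the Radon-Nikodym derivative, which is identified almost
    everywhere with [phi] by comparing integrals over measurable sets. *)
Lemma integral_mu' (f : TR -> \bar R) : (forall x, (0 <= f x)%E) ->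
  measurable_fun setT f ->
  (\int[mup]_x f x = \int[leb]_x (f x * (phi x)%:E))%E.
Proof.
move=> f0 mf.
have dom := mu'_dominates.
rewrite -(@Radon_Nikodym_SigmaFinite.change_of_variables _ _ _ mup leb dom f setT f0 measurableT mf).
have mphi := measurable_phi.
have mRN := measurable_int _ (@Radon_Nikodym_SigmaFinite.f_integrable _ _ _ mup leb dom).
apply: ae_eq_integral => //.
- exact: emeasurable_funM.
- by apply: emeasurable_funM => //; exact/measurable_EFinP.
have h : ae_eq leb setT (Radon_Nikodym_SigmaFinite.f mup leb) (EFin \o @phi R).
  apply: integral_ae_eq => //.
  - exact: Radon_Nikodym_SigmaFinite.f_integrable.
  - exact/measurable_EFinP.
  - by move=> A _ mA; rewrite -Radon_Nikodym_SigmaFinite.f_integral.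
by apply: (ae_imp h) => x /(_ I) /= -> _.
Qed.

(** As [phi] is positive, a set over which it integrates to 0 is Lebesgue null. *)
Lemma ae_mu'_leb (P : TR -> Prop) : {ae mup, forall x, P x} -> {ae leb, forall x, P x}.
Proof.
move=> [N [mN N0 PN]].
have mphi := measurable_phi.
have : (\int[leb]_(x in N) `|(phi x)%:E| = 0)%E.
  by under eq_integral do rewrite gee0_abs ?lee_fin ?phi_ge0//; exact: N0.
have mphiN : measurable_fun N (EFin \o @phi R).
  by apply: measurable_funTS; exact/measurable_EFinP.
move/(ae_eq_integral_abs leb mN mphiN) => h; apply: (ae_imp h) => x hx; apply: contrapT => nPx.
have /hx/= : N x by exact: PN.
by move=> [] /eqP; rewrite gt_eqF// phi_gt0.
Qed.

Lemma ae_leb_mu' (P : TR -> Prop) : {ae leb, forall x, P x} -> {ae mup, forall x, P x}.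
Proof.
move=> [N [mN N0 PN]]; exists N; split => //.
exact: (null_content_dominatesP _ _).1 mu'_dominates _ mN N0.
Qed.

Lemma Rintegral_mu' (f : R -> R) : @measurable_fun _ _ TR R setT f ->
  (mup.-integrable setT (EFin \o f) <-> intg (fun x => f x * phi x)) /\
  \int[mup]_x f x = \int[leb]_x (f x * phi x).
Proof.
move=> mf; have mphi := measurable_phi.
have mfp : measurable_fun [set: TR] (fun x => f x * phi x) by exact: measurable_funM.
split.
- split=> /integrableP[_ h]; apply/integrableP; (split; first exact/measurable_EFinP).
  + move: h; rewrite integral_mu'//; last by apply: measurableT_comp => //; exact/measurable_EFinP.
    by under eq_integral do rewrite /= -EFinM -{1}(ger0_norm (phi_ge0 _)) -normrM.
  + rewrite integral_mu'//; last by apply: measurableT_comp => //; exact/measurable_EFinP.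
    by under eq_integral do rewrite /= -EFinM -{1}(ger0_norm (phi_ge0 _)) -normrM.
- congr fine; rewrite integralE [RHS]integralE.
  rewrite integral_mu'//; last by apply: measurable_funepos; exact/measurable_EFinP.
  rewrite integral_mu'//; last by apply: measurable_funeneg; exact/measurable_EFinP.
  congr (_ - _)%E; apply: eq_integral => x _.
    rewrite !funeposE -!EFin_max -EFinM; congr EFin.
    by rewrite maxr_pMl ?phi_ge0// mul0r.
  rewrite !funenegE -!EFinN -!EFin_max -EFinM; congr EFin.
  by rewrite maxr_pMl ?phi_ge0// mul0r mulNr.
Qed.

(** Multiplication by it carries L_2 of [mu'] isometrically to L_2 of Lebesgue measure, see
    [in_L2_mu']. *)
Definition sphi (w : R) : R := Num.sqrt (phi w).

Lemma sphi_gt0 w : 0 < sphi w. Proof. by rewrite sqrtr_gt0 phi_gt0. Qed.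

Lemma sqr_sphi w : sphi w ^+ 2 = phi w.
Proof. by rewrite sqr_sqrtr ?phi_ge0. Qed.

Lemma measurable_sphi : @measurable_fun _ _ TR R setT sphi.
Proof.
have ms : measurable_fun [set: R] (@Num.sqrt R).
  by apply: continuous_measurable_fun; exact: sqrt_continuous.
exact: (measurableT_comp ms measurable_phi).
Qed.

Lemma measurable_sphiV : @measurable_fun _ _ TR R setT (fun w => (sphi w)^-1).
Proof.
have -> : (fun w => (sphi w)^-1) = (fun w => (Num.sqrt (Num.sqrt (pi / 2)))^-1 * expR (pi ^+ 2 / 4 * w ^+ 2)).
  apply/funext => w; rewrite /sphi phi_gauss sqrtrM ?sqrtr_ge0// invfM; congr (_ * _).
  have -> : gauss (pi ^+ 2 / 2) w = expR (- (pi ^+ 2 / 4 * w ^+ 2)) ^+ 2.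
    by rewrite /gauss -expRM_natl; congr expR; field.
  by rewrite sqrtr_sqr ger0_norm ?expR_ge0// expRN invrK.
apply: measurable_funM; first exact: measurable_cst.
apply: continuous_measurable_fun => x; apply: differentiable_continuous.
by apply/derivable1_diffP; exact: ex_derive.
Qed.

Implicit Types f g h : R -> R[i].

Lemma in_L2_mu' h : @cmeasurable _ TR R h ->
  (in_L2 mup h <-> in_L2 leb (fun w => h w * (sphi w)%:C%C)) /\
  sqnorm mup h = sqnorm leb (fun w => h w * (sphi w)%:C%C).
Proof.
move=> mh; have ms := measurable_sqr_cnorm mh.
have mhs : cmeasurable (fun w => h w * (sphi w)%:C%C).
  by apply: cmeasurableM => //; apply: cmeasurable_real; exact: measurable_sphi.
have E w : cnorm (h w * (sphi w)%:C%C) ^+ 2 = cnorm (h w) ^+ 2 * phi w.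
  by rewrite cnormM exprMn cnorm_real real_normK ?num_real// sqr_sphi.
have [i e] := Rintegral_mu' ms.
split; last by rewrite /sqnorm e; apply: eq_Rintegral => w _; rewrite E.
split=> /in_L2P[_ h2]; apply/in_L2P; split => //.
  by rewrite (_ : (fun x => _) = (fun w => cnorm (h w) ^+ 2 * phi w)); [exact/i|apply/funext].
apply/i; by rewrite (_ : (fun x => _) = (fun w => cnorm (h w * (sphi w)%:C%C) ^+ 2)); [|apply/funext].
Qed.

Lemma Cintegral_mu' h : @cmeasurable _ TR R h ->
  (in_L1 mup h <-> in_L1 leb (fun w => h w * (phi w)%:C%C)) /\
  Cintegral mup h = Cintegral leb (fun w => h w * (phi w)%:C%C).
Proof.
move=> [mr mi]; have [ir er] := Rintegral_mu' mr; have [ii ei] := Rintegral_mu' mi.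
have rE : (fun w => complex.Re (h w * (phi w)%:C%C)) = (fun w => complex.Re (h w) * phi w).
  by apply/funext => w; rewrite ReM/= mulr0 subr0.
have iE : (fun w => complex.Im (h w * (phi w)%:C%C)) = (fun w => complex.Im (h w) * phi w).
  by apply/funext => w; rewrite ImM/= mulr0 add0r.
split; last by rewrite /Cintegral er ei rE iE.
by split=> /in_L1P[a b]; apply/in_L1P; move: a b; rewrite rE iE => a b; split;
  [exact/ir|exact/ii|exact/ir|exact/ii].
Qed.

Definition Vmap f : R -> R[i] := fun w => FL f w * (sphi w)^-1%:C%C.

Lemma cmeasurable_Vmap f : in_L2 leb f -> @cmeasurable _ TR R (Vmap f).
Proof.
move=> Lf; apply: cmeasurableM; first by case: (in_L2_FL Lf).
by apply: cmeasurable_real; exact: measurable_sphiV.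
Qed.

Lemma VmapK f w : Vmap f w * (sphi w)%:C%C = FL f w.
Proof.
by rewrite /Vmap -mulrA -rmorphM/= mulVf ?mulr1// gt_eqF// sphi_gt0.
Qed.

Lemma in_L2_Vmap f : in_L2 leb f -> in_L2 mup (Vmap f).
Proof.
move=> Lf; apply/(in_L2_mu' (cmeasurable_Vmap Lf)).1.
by rewrite (_ : (fun w => _) = FL f); [exact: in_L2_FL|apply/funext => w; exact: VmapK].
Qed.

Lemma Vmap_linear : L2linear leb mup Vmap.
Proof.
split.
- exact: in_L2_Vmap.
- move=> f g Lf Lg fg; apply: ae_leb_mu'.
  by apply: (ae_imp (FL_ae Lf Lg fg)) => w; rewrite /Vmap => ->.
- move=> a f g Lf Lg; apply: ae_leb_mu'.
  by apply: (ae_imp (FL_linear a Lf Lg)) => w; rewrite /Vmap => ->; ring.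
Qed.

Lemma Vmap_isometry : L2isometry leb mup Vmap.
Proof.
split; first exact: Vmap_linear.
move=> f Lf; congr Num.sqrt; rewrite -/(sqnorm mup (Vmap f)) -/(sqnorm leb f).
rewrite (in_L2_mu' (cmeasurable_Vmap Lf)).2 -(FL_isometry Lf).
by congr sqnorm; apply/funext => w; exact: VmapK.
Qed.

Lemma Vmap_unitary : L2unitary leb mup Vmap.
Proof.
split; [exact: Vmap_linear|exact: L2isometry_inner Vmap_isometry|].
move=> h Lh; have mh := Lh.1.
have Lg := (in_L2_mu' mh).1.1 Lh.
set g := (fun w => h w * (sphi w)%:C%C) in Lg.
have LgJ := in_L2J Lg.
(* By [FL_involution] the inverse transform is [FL] between two conjugations. *)
exists (fun t => (FL (fun w => (g w)^*%C) t)^*%C); first exact/in_L2J/in_L2_FL.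
apply: ae_leb_mu'; apply: (ae_imp (FL_involution LgJ)) => w e.
by rewrite /Vmap e conjcK /g -mulrA -rmorphM/= divff ?mulr1// gt_eqF// sphi_gt0.
Qed.

Lemma Vmap_L1 f : in_L1 leb f -> in_L2 leb f -> {ae leb, forall w,
  Vmap f w = (Num.sqrt (2 * phi w))^-1%:C%C *
    Cintegral leb (fun t => expi (- pi * w * t) * f t)}.
Proof.
move=> If Lf; apply: (ae_imp (FL_L1 If Lf)) => w e.
rewrite /Vmap e /FT sqrtrM// invfM rmorphM/= -/(sphi w).
set c := Cintegral _ _; by ring.
Qed.

Lemma E_gauss (t : R) : E t = (2 / pi) `^ 4^-1 * gauss 1 t.
Proof. by rewrite /E /gauss mul1r. Qed.

Lemma FT_shifted_E (s w : R) :
  FT (fun t => (E (t - s))%:C%C) w = expi (- pi * s * w) * (sphi w)%:C%C.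
Proof.
pose a : R := (2 / pi) `^ 4^-1.
pose u x : R[i] := (a%:C%C * expi (- pi * s * w)) * (expi ((- pi * w) * x) * (gauss 1 x)%:C%C).
have [ig Eg] := Cintegral_gauss (- pi * w) (@ltr01 R).
have iu : in_L1 leb u by exact: in_L1Z.
rewrite /FT; have -> : (fun t => expi (- pi * w * t) * (E (t - s))%:C%C) = (fun t => u (t + - s)).
  apply/funext => t; rewrite /u E_gauss -/a rmorphM/=.
  have -> : - pi * w * t = - pi * s * w + (- pi * w) * (t + - s) by ring.
  by rewrite expiD; ring.
rewrite (Cintegral_shift _ iu).2 /u (CintegralZ _ ig) Eg.
set c := (Num.sqrt 2)^-1%:C%C; set e := expi _; set y := (X in c * (_ * X)).
rewrite (_ : c * (a%:C%C * e * y) = e * (c * a%:C%C * y)); last by ring.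
congr (_ * _); rewrite /c /y -!rmorphM/=; congr (_%:C)%C.
have pi0 : 0 < pi :> R by exact: pi_gt0.
have a0 : 0 <= a by exact: powR_ge0.
have a2 : a ^+ 2 = Num.sqrt (2 / pi).
  by rewrite /a -powR_mulrn ?powR_ge0// -powRrM -powR12_sqrt ?divr_ge0 ?pi_ge0//; congr (_ `^ _); field.
(* Both sides are nonnegative, so they may be compared after squaring; this turns the fourth root in
   [E] into a square root and [sphi] into [phi]. *)
apply/eqP; rewrite -(eqrXn2 (n := 2))//; last 2 first.
- by rewrite !mulr_ge0 ?invr_ge0 ?sqrtr_ge0 ?expR_ge0.
- exact/ltW/sphi_gt0.
rewrite sqr_sphi phi_gauss 3!exprMn exprVn !sqr_sqrtr ?divr1 ?pi_ge0//; last first.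
rewrite a2; apply/eqP.
have -> : Num.sqrt (pi / 2) = 2^-1 * Num.sqrt (2 / pi) * pi :> R.
  have -> : pi / 2 = (pi / 2) ^+ 2 * (2 / pi) :> R.
    have pn0 : (pi : R) != 0 by rewrite gt_eqF.
    by move: (pi) pn0 => p p0; field.
  rewrite sqrtrM ?sqr_ge0// sqrtr_sqr ger0_norm ?divr_ge0 ?pi_ge0//; ring.
have -> : expR (- ((- pi * w) ^+ 2 / (4 * 1))) ^+ 2 = gauss (pi ^+ 2 / 2) w.
  by rewrite /gauss -expRM_natl; congr expR; field.
by ring.
Qed.

Lemma shifted_E_L (s : R) : in_L1 leb (fun t => (E (t - s))%:C%C) /\
  in_L2 leb (fun t => (E (t - s))%:C%C).
Proof.
have := @in_L2_gauss R (fun=> 1) ((2 / pi) `^ 4^-1) 1 (- s) (@ltr01 R).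
have -> : (fun x => 1 * ((2 / pi) `^ 4^-1 * gauss 1 (x + - s))%:C%C) =
   (fun t => (E (t - s))%:C%C).
  by apply/funext => x; rewrite mul1r E_gauss.
by apply; [exact: cmeasurable_cst|move=> x; rewrite -(expi0 R) cnorm_expi].
Qed.

Lemma Vmap_shifted_E (s : R) :
  aeeq mup (Vmap (fun t => (E (t - s))%:C%C)) (fun w => expi (- pi * s * w)).
Proof.
have [IE LE] := shifted_E_L s.
apply: ae_leb_mu'; apply: (ae_imp (FL_L1 IE LE)) => w e.
rewrite /Vmap e FT_shifted_E -mulrA -rmorphM/= divff ?mulr1// gt_eqF// sphi_gt0//.
Qed.

Lemma in_L2_expi_mu' (s : R) : in_L2 mup (fun w => expi (s * w)).
Proof.
apply: (@in_L2_le _ _ _ mup _ (fun=> 1)); first exact: cmeasurable_expiM.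
  by move=> w; rewrite cnorm_expi expr1n.
exact: (finite_measure_integrable_cst mup 1 measurableT).
Qed.

Lemma in_L2_L1_mu' h : in_L2 mup h -> in_L1 mup h.
Proof.
move=> Lh; have := in_L2_L1M Lh (in_L2_expi_mu' 0).
by congr in_L1; apply/funext => w; rewrite mul0r expi0 mulr1.
Qed.

Lemma Vmap_unique (U : (R -> R[i]) -> (R -> R[i])) : L2isometry leb mup U ->
  (forall r : rat, aeeq mup (U (fun t => (E (t - ratr r))%:C%C))
                            (fun w => expi (- pi * ratr r * w))) ->
  forall f, in_L2 leb f -> aeeq mup (U f) (Vmap f).
Proof.
move=> Uiso Ue f Lf; have [[UL _ _] _] := Uiso.
have LU := UL _ Lf; have LV := in_L2_Vmap Lf.
pose d w := U f w - Vmap f w.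
have Ld : in_L2 mup d by exact: in_L2B.
have [Id _] := Cintegral_mu' Ld.1.
(* A finite measure has its L_2 inside its L_1, so [d * phi] is Lebesgue integrable and open to
   [fourier_unique]. *)
have Idp : in_L1 leb (fun w => d w * (phi w)%:C%C) by apply/Id; exact: in_L2_L1_mu'.
suff h : aeeq leb (fun w => d w * (phi w)%:C%C) (fun=> 0).
  apply: ae_leb_mu'; apply: (ae_imp h) => w /eqP; rewrite mulf_eq0 => /orP[|].
    by rewrite subr_eq0 => /eqP.
  by rewrite fmorph_eq0 gt_eqF// phi_gt0.
apply: fourier_unique => // r.
have [_ LE] := shifted_E_L (ratr r).
have Lx := in_L2_expi_mu' (- pi * ratr r).
have LxJ := in_L2J Lx.
have inn (W : (R -> R[i]) -> (R -> R[i])) : L2isometry leb mup W ->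
   aeeq mup (W (fun t => (E (t - ratr r))%:C%C)) (fun w => expi (- pi * ratr r * w)) ->
   Cintegral mup (fun w => W f w * (expi (- pi * ratr r * w))^*%C) =
   L2inner leb f (fun t => (E (t - ratr r))%:C%C).
  move=> Wiso We; rewrite -(L2isometry_inner Wiso Lf LE).
  have [[WL _ _] _] := Wiso.
  apply: eq_ae_Cintegral.
  - by case: (in_L2_L1M (WL _ Lf) LxJ).
  - by case: (in_L2_L1M (WL _ Lf) (in_L2J (WL _ LE))).
  - by apply: (ae_imp We) => w ->.
have m1 : cmeasurable (fun w => d w * (expi (- pi * ratr r * w))^*%C).
  by case: (in_L2_L1M Ld LxJ).
transitivity (Cintegral mup (fun w => d w * (expi (- pi * ratr r * w))^*%C)).
  rewrite (Cintegral_mu' m1).2; congr Cintegral; apply/funext => w.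
  by rewrite -expiN mulrA; congr (_ * _); rewrite mulrC; congr (_ * expi _); ring.
have -> : (fun w => d w * (expi (- pi * ratr r * w))^*%C) =
  (fun w => U f w * (expi (- pi * ratr r * w))^*%C - Vmap f w * (expi (- pi * ratr r * w))^*%C).
  by apply/funext => w; rewrite /d; ring.
rewrite (CintegralB (in_L2_L1M LU LxJ) (in_L2_L1M LV LxJ)).
by rewrite (inn U Uiso (Ue r)) (inn Vmap Vmap_isometry (Vmap_shifted_E _)) subrr.
Qed.

End gaussian_measure.

(** * The cube Q *)

(* Instance resolution for [Filter (nbhs x)] does not terminate on [Q R] without
   this shortcut. *)
#[global] Instance nbhs_Q_filter (R : realType) (x : Q R) : Filter (nbhs x).
Proof. exact: nbhs_filter. Qed.

Section cube.
Variable R : realType.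
Implicit Types x y : Q R.

Lemma proj_Q_continuous (j : nat) : continuous (@proj_Q R j).
Proof.
move=> x; apply: (@continuous_comp (Q R) (set_type (disc R)) R[i] (proj j) set_val).
  exact: (@proj_continuous nat (fun=> set_type (disc R)) j).
exact: initial_continuous.
Qed.

Let cylinder x (m : nat) (e : R) : set (Q R) :=
  [set y | forall j, (j < m)%N -> cnorm (proj_Q j y - proj_Q j x) < e].

(** The sets containing a cylinder around [x] form a filter; it converges to [x] because it does so
    for each of the coordinate topologies, whose supremum is the product topology. *)
Lemma nbhs_cylinder x (O : set (Q R)) : nbhs x O -> exists m : nat, exists2 e : R, 0 < e &
  forall y, (forall j, (j < m)%N -> cnorm (proj_Q j y - proj_Q j x) < e) -> O y.
Proof.
pose F : set_system (Q R) := [set A | exists m : nat, exists2 e : R, 0 < e & cylinder x m e `<=` A].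
have FF : Filter F.
  split.
  - by exists 0%N, 1.
  - move=> A B [m [e e0 eA]] [m' [e' e'0 eB]]; exists (maxn m m'), (Num.min e e').
      by rewrite lt_min e0 e'0.
    move=> y yP; split; [apply: eA|apply: eB] => j jm.
      have := yP j (leq_trans jm (leq_maxl _ _)); rewrite lt_min => /andP[] //.
    have := yP j (leq_trans jm (leq_maxr _ _)); rewrite lt_min => /andP[] //.
  - by move=> A B AB [m [e e0 eA]]; exists m, e => // y /eA /AB.
suff Fx : F --> x by move=> /Fx.
apply/cvg_sup => i A /= [B [[W oW WB] Bx BA]].
move: oW => [V oV VW].
have Vx : V (proj_Q i x) by move: Bx; rewrite -WB /= -VW.
move: oV; rewrite openE => /(_ _ Vx) /nbhs_ballP [r /= r0 rV].
have [e er] : exists e : R, r = e%:C%C.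
  exists (complex.Re r); apply: complexP => //=.
  by move: r0; rewrite ltcE /= => /andP[/eqP].
exists i.+1, e; first by move: r0; rewrite er ltcR.
move=> y /(_ i (ltnSn i)) yi; apply: BA; rewrite -WB /= -VW; apply: rV.
by rewrite /ball/= er -opprB normrN normC_cnorm ltcR.
Qed.

Lemma cvg_Q (I : Type) (F : set_system I) (u : I -> Q R) x : Filter F ->
  (forall j, proj_Q j (u t) @[t --> F] --> proj_Q j x) -> u t @[t --> F] --> x.
Proof.
move=> FF ux O /nbhs_cylinder[m [e e0 eO]].
have e2 : 0 < e / 2 by rewrite divr_gt0.
have near_all (k : nat) : \forall t \near F,
    forall j, (j < k)%N -> cnorm (proj_Q j (u t) - proj_Q j x) < e.
  elim: k => [|k ih]; first exact: nearW.
  near=> t => j; rewrite ltnS leq_eqVlt => /orP[/eqP ->|jk].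
    rewrite -opprB cnormN; apply: (@le_lt_trans _ _ (e / 2)); last by lra.
    by near: t; exact: (cvg_cnorm FF (ux k)).
  by have := jk; move: j {jk}; near: t.
by apply: filterS (near_all m) => t; exact: eO.
Unshelve. all: by end_near. Qed.

Lemma cnorm_le1 (z : R[i]) : (`|z| <= 1) = (cnorm z <= 1).
Proof. by rewrite normC_cnorm -(rmorph1 (real_complex R)) lecR. Qed.

(** The disc is the continuous image of a square. The sines in [F] keep its values in the disc at
    every point of the plane, so that [f] is continuous everywhere. *)
Lemma disc_compact : compact [set: set_type (disc R)].
Proof.
pose F (z : R * R) : R[i] := (sin z.1 +i* (cos z.1 * sin z.2))%C.
have Fd z : `|F z| <= 1.
  rewrite cnorm_le1 -(@expr_le1 _ 2) ?cnorm_ge0// sqr_cnorm/=.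
  rewrite exprMn -(cos2Dsin2 z.1) addrC lerD2r.
  apply: ler_piMr; first exact: sqr_ge0.
  by rewrite -(cos2Dsin2 z.2) lerDr sqr_ge0.
pose f := fun z : R * R => to_disc (F z).
have fc : continuous f.
  apply: continuous_comp_initial => z.
  have -> : set_val \o f = F by apply/funext => w /=; exact: to_discK.
  apply: cvg_complexP => /=.
    apply: (cvg_comp fst sin); [exact: cvg_fst|exact: continuous_sin].
  apply: cvgM.
    apply: (cvg_comp fst cos); [exact: cvg_fst|exact: continuous_cos].
  apply: (cvg_comp snd sin); [exact: cvg_snd|exact: continuous_sin].
pose K : set (R * R) := `[- pi, pi]%classic `*` `[- pi, pi]%classic.
have cK : compact K by apply: compact_setX; exact: segment_compact.
suff -> : [set: set_type (disc R)] = f @` K.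
  by apply: continuous_compact => //; exact: continuous_subspaceT.
apply/seteqP; split => // z _.
have zd : cnorm (\val z) <= 1.
  by rewrite -cnorm_le1; exact: (set_mem (valP z)).
have [x1 y1] : -1 <= complex.Re (\val z) <= 1 /\ complex.Re (\val z) ^+ 2 + complex.Im (\val z) ^+ 2 <= 1.
  split; first by rewrite -ler_norml (le_trans (normr_Re_le _)).
  by rewrite -sqr_cnorm expr_le1 ?cnorm_ge0.
pose s := asin (complex.Re (\val z)).
have cs : cos s = Num.sqrt (1 - complex.Re (\val z) ^+ 2) by exact: cos_asin.
(* If [cos s = 0], the real part has modulus 1 and the imaginary part is 0, so that any [b] solves
   [cos s * b = Im z]. *)
pose b := if cos s == 0 then 0 else complex.Im (\val z) / cos s.
have cb : cos s * b = complex.Im (\val z) /\ -1 <= b <= 1.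
  rewrite /b; case: eqP => [c0|/eqP c0].
    split; last by lra.
    have := cs; rewrite c0 => /esym/eqP; rewrite sqrtr_eq0 => h.
    have : complex.Im (\val z) ^+ 2 <= 0 by lra.
    by rewrite mulr0 => h2; apply/esym/eqP; rewrite -sqrf_eq0 eq_le h2 sqr_ge0.
  split; first by rewrite mulrCA divff// mulr1.
  have cp : 0 < cos s by rewrite lt_neqAle eq_sym c0 cs sqrtr_ge0.
  rewrite -ler_norml normrM normfV ler_pdivrMr ?normr_gt0// mul1r (gtr0_norm cp).
  rewrite cs -sqrtr_sqr ler_wsqrtr//; lra.
have pi0 := pi_ge0 R.
exists (s, asin b).
  split => /=; rewrite in_itv/=.
    have := asin_geNpi2 x1; have := asin_lepi2 x1; rewrite -/s; lra.
  by have := asin_geNpi2 cb.2; have := asin_lepi2 cb.2; lra.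
apply: val_inj; rewrite /f /to_disc insubdK; last exact/mem_set/Fd.
have e1 : sin s = complex.Re (\val z) by rewrite asinK// in_itv.
have e2 : sin (asin b) = b by rewrite asinK// in_itv; exact: cb.2.
rewrite /F; apply: complexP; first exact: e1.
by rewrite [LHS]/= e2; exact: cb.1.
Qed.

Lemma Q_compact : compact [set: Q R].
Proof.
have := @tychonoff nat (fun=> set_type (disc R)) (fun=> setT) (fun=> disc_compact).
by congr compact; apply/seteqP; split.
Qed.

Lemma cvg_cnormf (I : Type) (F : set_system I) (u : I -> R[i]) (l : R[i]) :
  Filter F -> u n @[n --> F] --> l -> cnorm (u n) @[n --> F] --> cnorm l.
Proof.
move=> FF ul; apply/cvgrPdist_le => /= e e0; near=> n.
have h : cnorm (l - u n) <= e by near: n; exact: (cvg_cnorm FF ul).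
rewrite ler_norml; apply/andP; split.
  have := cnormD l (- (l - u n)); rewrite cnormN.
  by rewrite opprB addrCA subrr addr0; lra.
by have := cnormD (l - u n) (u n); rewrite subrK; lra.
Unshelve. all: by end_near. Qed.

Lemma Q_bounded (h : Q R -> R[i]) : continuous h -> exists M : R, forall x, cnorm (h x) <= M.
Proof.
move=> ch.
have cn : continuous (fun x => cnorm (h x)).
  by move=> x; apply: cvg_cnormf (ch x); exact: nbhs_filter.
have : compact ((fun x => cnorm (h x)) @` [set: Q R]).
  by apply: continuous_compact; [exact: continuous_subspaceT|exact: Q_compact].
move=> /compact_bounded [M [_ MP]]; exists (M + 1) => x.
have := MP (M + 1); rewrite ltrDl => /(_ ltr01 (cnorm (h x))).
by rewrite /= ger0_norm ?cnorm_ge0//; apply; exists x.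
Qed.

Notation BQ := (BorelQ R).

Lemma measurable_continuous_Q (g : Q R -> R) : continuous g ->
  measurable_fun [set: BQ] (g : BQ -> R).
Proof.
move=> cg; apply: (measurability _ (RGenOpens.measurableE R)).
move=> _ [_ [a [b ->]] <-]; rewrite setTI.
apply: sub_sigma_algebra; apply: open_comp; last exact: interval_open.
by move=> x _; exact: cg.
Qed.

Lemma cmeasurable_continuous_Q (h : Q R -> R[i]) : continuous h ->
  @cmeasurable _ BQ R h.
Proof.
move=> ch; split; apply: measurable_continuous_Q => x.
  exact: (cvg_Re (nbhs_filter x) (ch x)).
exact: (cvg_Im (nbhs_filter x) (ch x)).
Qed.

(** A continuous pseudometric that sees the first [m] coordinates. *)
Let S (m : nat) x y : R := \sum_(j < m) cnorm (proj_Q j x - proj_Q j y).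

Let S_ge0 m x y : 0 <= S m x y.
Proof. by apply: sumr_ge0 => j _; exact: cnorm_ge0. Qed.

Let S_tri m x y z : S m x z <= S m x y + S m y z.
Proof.
rewrite /S -big_split; apply: ler_sum => j _.
by have := cnormD (proj_Q j x - proj_Q j y) (proj_Q j y - proj_Q j z); rewrite addrA subrK.
Qed.

Let S_sym m x y : S m x y = S m y x.
Proof. by apply: eq_bigr => j _; rewrite -cnormN opprB. Qed.

Let S_cvg m x : S m x y @[y --> x] --> (0 : R).
Proof.
have FF := nbhs_filter x; elim: m => [|m ih].
  have -> : S 0 x = (fun=> 0) by apply/funext => y; rewrite /S big_ord0.
  exact: cvg_cst.
have -> : S m.+1 x = (fun y => S m x y + cnorm (proj_Q m x - proj_Q m y)).
  by apply/funext => y; rewrite /S big_ord_recr.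
rewrite -[X in _ --> X](addr0 (0 : R)); apply: cvgD; first exact: ih.
have -> : (0 : R) = cnorm (proj_Q m x - proj_Q m x) by rewrite subrr cnorm0.
by apply: cvg_cnormf; apply: cvgB; [exact: cvg_cst|exact: proj_Q_continuous].
Qed.

Section open_sets.
Variable O : set (Q R).
Hypothesis oO : open O.
Variable y0 : Q R.
Hypothesis Oy0 : ~ O y0.

Let D (m : nat) x : set R := [set S m x y | y in ~` O].

(** The distance from [x] to the complement of [O] for the pseudometric [S m]; the point [y0] makes
    that complement nonempty. A point of the open set [O] has positive distance for some [m], since
    [O] contains a cylinder around it. *)
Let gap (m : nat) x : R := inf (D m x).

Let D_inf m x : has_inf (D m x).
Proof.
split; first by exists (S m x y0), y0.
by exists 0 => _ [y _ <-].
Qed.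

Let gap_le m x y : ~ O y -> gap m x <= S m x y.
Proof. by move=> Oy; apply: inf_lbound; [case: (D_inf m x)|exists y]. Qed.

Let gap_ge0 m x : 0 <= gap m x.
Proof. by apply: lb_le_inf; [case: (D_inf m x)|move=> _ [y _ <-]]. Qed.

Let gap_lip m x y : gap m x <= S m x y + gap m y.
Proof.
rewrite -lerBlDl; apply: lb_le_inf; first by case: (D_inf m y).
move=> _ [z Oz <-]; rewrite lerBlDl; apply: le_trans (S_tri _ _ _ _); exact: gap_le.
Qed.

Let gap_continuous m : continuous (gap m).
Proof.
move=> x; have FF := nbhs_filter x.
have h : forall e : R, 0 < e -> \forall y \near x, `|gap m x - gap m y| <= e.
  move=> e e0; have /cvgrPdist_le/(_ e e0) := S_cvg m x.
  apply: filterS => y; rewrite sub0r normrN ger0_norm// => Se.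
  have := gap_lip m x y; have := gap_lip m y x; rewrite (S_sym m y x) => h1 h2.
  by rewrite ler_norml; apply/andP; split; lra.
by apply/cvgrPdist_le.
Qed.

Let gap_cover : O = \bigcup_m [set x | 0 < gap m x].
Proof.
apply/seteqP; split=> [x Ox|x [m _ /= gx]].
  have [m [e e0 eO]] := nbhs_cylinder (open_nbhs_nbhs (conj oO Ox)).
  exists m => //=; apply: (lt_le_trans e0); apply: lb_le_inf; first by case: (D_inf m x).
  move=> _ [y Oy <-]; rewrite leNgt; apply/negP => Se; apply: Oy; apply: eO => j jm.
  apply: le_lt_trans Se; rewrite /S (bigD1 (Ordinal jm)) //= -opprB cnormN lerDl.
  by apply: sumr_ge0 => k _; exact: cnorm_ge0.
apply: contrapT => Ox; have := @gap_le m x x Ox.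
by rewrite /S big1 ?leNgt ?gx// => j _; rewrite subrr cnorm0.
Qed.

Lemma open_Q_gap : exists g : nat -> Q R -> R,
  (forall m, continuous (g m) /\ forall x, 0 <= g m x) /\
  O = \bigcup_m [set x | 0 < g m x].
Proof. by exists gap; split; [move=> m; split|exact: gap_cover]. Qed.

End open_sets.

Let G : set (set BQ) := [set A | exists g : Q R -> R,
  [/\ continuous g, forall x, 0 <= g x & A = [set x | 0 < g x]]].

(** The positivity sets [G] of continuous nonnegative functions are closed under intersection, by
    taking products, and generate the Borel sets, by [open_Q_gap]. On such a set the measures agree
    because its indicator is a bounded limit of continuous functions. *)
Lemma BorelQ_unique (nu nu' : probability BQ R) :
  (forall h : Q R -> R[i], continuous h -> Cintegral nu h = Cintegral nu' h) ->
  forall A, measurable A -> nu A = nu' A.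
Proof.
move=> hE.
have GT : G setT.
  exists (fun=> 1); split; [by move=> x; exact: cvg_cst|by move=> x; exact: ler01|].
  by apply/seteqP; split => // x _; exact: ltr01.
apply: (measure_unique G (fun=> setT)).
- rewrite eqEsubset; split.
    apply: smallest_sub; first exact: smallest_sigma_algebra.
    move=> O oO; have [[y0 Oy0]|nO] := pselect (exists y, ~ O y).
      have [g [gP ->]] := open_Q_gap oO Oy0.
      apply: sigma_algebra_bigcup => m; apply: sub_sigma_algebra.
      by exists (g m); case: (gP m).
    have -> : O = setT.
      by apply/seteqP; split => // x _; apply: contrapT => Ox; apply: nO; exists x.
    exact: sub_sigma_algebra.
  apply: smallest_sub; first exact: smallest_sigma_algebra.
  move=> _ [g [cg _ ->]]; apply: sub_sigma_algebra.
  rewrite (_ : [set x | _] = g @^-1` `]0, +oo[%classic); last first.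
    by apply/seteqP; split => x /=; rewrite in_itv/= andbT.
  by apply: open_comp; [move=> x _; exact: cg|exact: rray_open].
- move=> _ _ [g [cg g0 ->]] [g' [cg' g0' ->]].
  exists (fun x => g x * g' x); split.
  + by move=> x; apply: cvgM; [exact: cg|exact: cg'].
  + by move=> x; rewrite mulr_ge0.
  + apply/seteqP; split => x /=; first by move=> [a b]; rewrite mulr_gt0.
    move=> p; split; rewrite lt_neqAle ?g0 ?g0' andbT; apply/negP => /eqP e;
    by move: p; rewrite -e ?mul0r ?mulr0 ltxx.
- by move=> k; exact: GT.
- exact: bigcup_const.
- move=> _ [g [cg g0 ->]]; pose A : set BQ := [set x | 0 < g x].
  have mg := measurable_continuous_Q cg.
  have mA : measurable A.
    have -> : A = setT `&` g @^-1` `]0, +oo[%classic.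
      by rewrite setTI; apply/seteqP; split => x /=; rewrite in_itv/= andbT.
    exact: mg.
  (* These functions tend pointwise to the indicator of [A] and stay between 0 and 1. *)
  pose u k x := 1 - expR (- (k%:R * g x)).
  have cu k : continuous (u k).
    move=> x; apply: cvgB; first exact: cvg_cst.
    apply: (@cvg_comp _ _ _ (fun x => - (k%:R * g x)) expR); last exact: continuous_expR.
    by apply: cvgN; apply: cvgMr; exact: cg.
  have u1 k x : `|u k x| <= 1.
    have e1 : expR (- (k%:R * g x)) <= 1 by rewrite -[leRHS]expR0 ler_expR oppr_le0 mulr_ge0.
    have := expR_ge0 (- (k%:R * g x)); rewrite /u => e0.
    by rewrite ler_norml; apply/andP; split; lra.
  have cvu x : u k x @[k --> \oo] --> (\1_A x : R).
    rewrite indicE; have [xA|xA] := boolP (x \in A).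
      have gx : 0 < g x by move: xA; rewrite inE.
      rewrite -[X in _ --> X]subr0; apply: cvgB; first exact: cvg_cst.
      have -> : (fun k => expR (- (k%:R * g x))) = (fun k => expR (- g x) ^+ k).
        by apply/funext => k; rewrite -expRM_natl mulrN.
      apply: cvg_expr; rewrite ger0_norm ?expR_ge0// -[ltRHS]expR0 ltr_expR; lra.
    have gx : g x = 0.
      apply/eqP; rewrite eq_le g0 andbT leNgt; apply: contra xA; rewrite inE//.
    under eq_fun do rewrite /u gx mulr0 oppr0 expR0 subrr; exact: cvg_cst.
  have lim (m : probability BQ R) : \int[m]_x u k x @[k --> \oo] --> fine (m A).
    have [|||||_] := @Rintegral_dct _ _ _ m u (\1_A) (fun=> 1).
    - by move=> k; exact: measurable_continuous_Q.
    - exact: measurable_indic.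
    - exact: aeW.
    - exact: (finite_measure_integrable_cst m 1 measurableT).
    - exact: u1.
    by rewrite [X in _ --> X -> _]/Rintegral integral_indic// setIT.
  have e : fine (nu A) = fine (nu' A).
    apply: (cvg_seq_unique (lim nu)).
    have -> : (fun k => \int[nu]_x u k x) = (fun k => \int[nu']_x u k x); last exact: lim.
    apply/funext => k; have := hE (fun x => (u k x)%:C%C) _.
    rewrite !Cintegral_real => /(_ _)/wrap[|[]//].
    move=> x; apply: cvg_complexP => /=; [exact: cu|exact: cvg_cst].
  have f1 : nu A \is a fin_num by exact: fin_num_measure.
  have f2 : nu' A \is a fin_num by exact: fin_num_measure.
  by rewrite -[LHS](fineK f1) -[RHS](fineK f2); exact: (congr1 EFin e).
- by move=> _; apply: (le_lt_trans (probability_le1 nu measurableT)); exact: ltry.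
Qed.

End cube.

(** * The map X, transfer of integrals, and the left inverse *)

Section embedding.
Variable R : realType.
Notation leb := (@lebesgue_measure R).
Notation mup := (@mu' R).
Notation TR := (measurableTypeR R).
Notation BQ := (BorelQ R).
Variable q : nat -> rat.
Notation XQ := (X q : TR -> BQ).

Lemma X_continuous : continuous (X q : R -> Q R).
Proof.
move=> w; apply: cvg_Q => j.
have -> : (fun t : R => proj_Q j (X q t)) = (fun t : R =>
    (Num.sqrt (2 ^+ j.+1))^-1%:C%C * expi (- pi * ratr (q j) * t)).
  by apply/funext => t; rewrite projX.
have cr (a : R) : continuous (fun t : R => a * cos (- pi * ratr (q j) * t)).
  by move=> x; apply: differentiable_continuous; apply/derivable1_diffP; exact: ex_derive.
have ci (a : R) : continuous (fun t : R => a * sin (- pi * ratr (q j) * t)).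
  by move=> x; apply: differentiable_continuous; apply/derivable1_diffP; exact: ex_derive.
rewrite projX; apply: cvg_complexP.
  have e (t : R) : complex.Re ((Num.sqrt (2 ^+ j.+1))^-1%:C%C * expi (- pi * ratr (q j) * t)) =
     (Num.sqrt (2 ^+ j.+1))^-1 * cos (- pi * ratr (q j) * t) by rewrite ReM/= mul0r subr0.
  by rewrite e (funext e); exact: cr.
have e (t : R) : complex.Im ((Num.sqrt (2 ^+ j.+1))^-1%:C%C * expi (- pi * ratr (q j) * t)) =
   (Num.sqrt (2 ^+ j.+1))^-1 * sin (- pi * ratr (q j) * t) by rewrite ImM/= mul0r addr0.
by rewrite e (funext e); exact: ci.
Qed.

Lemma measurable_X : measurable_fun setT XQ.
Proof.
apply: (@measurability _ _ TR BQ setT XQ (@open (Q R)) erefl) => _ [B oB <-].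
rewrite setTI; apply: open_measurable.
by apply: open_comp => // w _; exact: X_continuous.
Qed.

HB.instance Definition _ := isMeasurableFun.Build _ _ TR BQ XQ measurable_X.

Definition hat_mu_X : probability BQ R := distribution mup XQ.

Section transfer.
Variable nu : probability BQ R.
Hypothesis nuX : forall B : set BQ, measurable B -> nu B = pushforward mup XQ B.

Lemma integral_X (f : BQ -> \bar R) : measurable_fun setT f -> (forall x, (0 <= f x)%E) ->
  (\int[nu]_x f x = \int[mup]_w f (X q w))%E.
Proof.
move=> mf f0; transitivity (\int[pushforward mup XQ]_x f x)%E.
  by apply: eq_measure_integral => A mA _; exact: nuX.
by rewrite ge0_integral_pushforward//; exact: measurable_X.
Qed.

Lemma Rintegral_X (f : Q R -> R) : @measurable_fun _ _ BQ R setT f ->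
  (nu.-integrable setT (EFin \o f) <-> mup.-integrable setT (EFin \o (fun w => f (X q w)))) /\
  \int[nu]_x f x = \int[mup]_w f (X q w).
Proof.
move=> mf; have mfX : measurable_fun [set: TR] (fun w => f (X q w)).
  exact: (measurableT_comp mf measurable_X).
have i : nu.-integrable setT (EFin \o f) <-> mup.-integrable setT (EFin \o (fun w => f (X q w))).
  split=> /integrableP[_ h]; apply/integrableP; (split; first exact/measurable_EFinP).
    by move: h; rewrite integral_X//; apply: measurableT_comp => //; exact/measurable_EFinP.
  by rewrite integral_X//; apply: measurableT_comp => //; exact/measurable_EFinP.
split => //; congr fine; rewrite integralE [RHS]integralE.
rewrite integral_X//; last by apply: measurable_funepos; exact/measurable_EFinP.
rewrite integral_X//; last by apply: measurable_funeneg; exact/measurable_EFinP.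
by congr (_ - _)%E; apply: eq_integral => w _; rewrite ?funeposE ?funenegE.
Qed.

Lemma cmeasurable_X (h : Q R -> R[i]) : @cmeasurable _ BQ R h ->
  @cmeasurable _ TR R (h \o X q).
Proof. by move=> mh; exact: (cmeasurable_comp measurable_X mh). Qed.

Lemma in_L2_X (h : Q R -> R[i]) : @cmeasurable _ BQ R h ->
  (in_L2 nu h <-> in_L2 mup (h \o X q)) /\ sqnorm nu h = sqnorm mup (h \o X q).
Proof.
move=> mh; have mhX := cmeasurable_X mh.
have [i e] := Rintegral_X (measurable_sqr_cnorm mh).
by split => //; split=> /in_L2P[_ h2]; apply/in_L2P; split => //; exact/i.
Qed.

Lemma Cintegral_X (h : Q R -> R[i]) : @cmeasurable _ BQ R h ->
  Cintegral nu h = Cintegral mup (h \o X q).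
Proof.
by move=> [mr mi]; apply: complexP => /=; [exact: (Rintegral_X mr).2|exact: (Rintegral_X mi).2].
Qed.

Lemma ae_X (P : Q R -> Prop) : {ae nu, forall x, P x} -> {ae mup, forall w, P (X q w)}.
Proof.
move=> [N [mN N0 PN]]; exists (X q @^-1` N); split.
- by rewrite -[X in measurable X]setTI; exact: measurable_X.
- by rewrite -N0 nuX.
- by move=> w /= nP; apply: PN.
Qed.

(** A converse of [ae_X]: measurability of both functions allows the integral of the squared
    distance to be moved between [nu] and [mu']. *)
Lemma aeeq_X (h k : Q R -> R[i]) : @cmeasurable _ BQ R h -> @cmeasurable _ BQ R k ->
  aeeq mup (h \o X q) (k \o X q) -> aeeq nu h k.
Proof.
move=> mh mk hk; pose d (x : Q R) := cnorm (h x - k x) ^+ 2.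
have md : @measurable_fun _ _ BQ R setT d.
  by apply: measurable_sqr_cnorm; exact: cmeasurableB.
have mdX : measurable_fun [set: TR] (fun w => d (X q w)) by exact: (measurableT_comp md measurable_X).
have d0 x : 0 <= d x by exact: sqr_ge0.
have z : (\int[mup]_w (d (X q w))%:E = 0)%E.
  rewrite (@ae_eq_integral _ _ _ mup setT (cst 0%E)) ?integral0//.
    exact/measurable_EFinP.
  by apply: (ae_imp hk) => w /= e _; rewrite /d /= e subrr cnorm0 expr0n.
have : (\int[nu]_x `|(d x)%:E| = 0)%E.
  under eq_integral do rewrite gee0_abs ?lee_fin//.
  rewrite integral_X//; first exact/measurable_EFinP.
have mdE : measurable_fun setT (EFin \o (d : BQ -> R)) by exact/measurable_EFinP.
move/(ae_eq_integral_abs nu measurableT mdE) => hd; apply: (ae_imp hd) => x /(_ I)/= [] /eqP.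
by rewrite sqrf_eq0 => /eqP/cnorm_eq0/eqP; rewrite subr_eq0 => /eqP.
Qed.

Lemma L2isometry_X (U : (R -> R[i]) -> (Q R -> R[i])) : L2isometry leb nu U ->
  L2isometry leb mup (fun g => U g \o X q).
Proof.
move=> [[UL Uae Ulin] Uiso]; split; first split.
- by move=> f /UL Lf; apply/(in_L2_X Lf.1).1.
- by move=> f g Lf Lg /(Uae _ _ Lf Lg)/ae_X.
- by move=> a f g Lf Lg; exact: (ae_X (Ulin a f g Lf Lg)).
- move=> f Lf; rewrite -(Uiso f Lf); congr Num.sqrt.
  exact/esym/(in_L2_X (UL _ Lf).1).2.
Qed.

End transfer.

Hypothesis q_enum : forall r : rat, exists j : nat, q j = r.

Let idx (k : nat) : nat := projT1 (cid (q_enum k.+1%:R^-1)).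

Let q_idx k : q (idx k) = k.+1%:R^-1.
Proof. by rewrite /idx; case: cid. Qed.

(* The phases of the coordinates of index [1 / k] determine [pi w] in the limit. *)
Definition X_inv (x : Q R) : R := - pi^-1 * Rlimsup (fun k =>
  k.+1%:R * (Num.sqrt (2 ^+ (idx k).+1) * complex.Im (proj_Q (idx k) x))).

Lemma X_invK (w : R) : X_inv (X q w) = w.
Proof.
rewrite /X_inv (@cvg_Rlimsup _ _ (- (pi * w))).
  by rewrite mulrN mulNr opprK mulrA mulVf ?mul1r// gt_eqF// pi_gt0.
have -> : (fun k => k.+1%:R * (Num.sqrt (2 ^+ (idx k).+1) * complex.Im (proj_Q (idx k) (X q w)))) =
   (fun k => k.+1%:R * sin (- (pi * w) / k.+1%:R)).
  apply/funext => k; congr (_ * _); rewrite projX q_idx ImM/= mul0r addr0.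
  rewrite mulrA divff ?mul1r; last by rewrite gt_eqF// sqrtr_gt0 exprn_gt0.
  by congr sin; rewrite fmorphV/= ratr_nat; ring.
exact: cvg_n_sin.
Qed.

Lemma measurable_X_inv : @measurable_fun _ _ BQ TR setT X_inv.
Proof.
apply: measurable_funM; first exact: measurable_cst.
apply: measurable_Rlimsup => k.
apply: measurable_funM; first exact: measurable_cst.
apply: measurable_funM; first exact: measurable_cst.
by case: (cmeasurable_continuous_Q (@proj_Q_continuous R (idx k))).
Qed.

Lemma L2isometry_X_inv (nu : probability BQ R)
    (nuX : forall B : set BQ, measurable B -> nu B = pushforward mup XQ B)
    (V : (R -> R[i]) -> (R -> R[i])) : L2isometry leb mup V ->
  L2isometry leb nu (fun g => V g \o X_inv).
Proof.
move=> [[VL Vae Vlin] Viso].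
have comp (h : R -> R[i]) : @cmeasurable _ TR R h -> @cmeasurable _ BQ R (h \o X_inv).
  by move=> mh; exact: (cmeasurable_comp measurable_X_inv mh).
have K (h : R -> R[i]) : (h \o X_inv) \o X q = h.
  by apply/funext => w /=; rewrite X_invK.
split; first split.
- by move=> f /VL Lf; apply/((in_L2_X nuX) _ (comp _ Lf.1)).1; rewrite K.
- move=> f g Lf Lg fg; apply: (aeeq_X nuX); [exact: comp (VL _ Lf).1|exact: comp (VL _ Lg).1|].
  by rewrite !K; exact: Vae.
- move=> a f g Lf Lg; apply: (aeeq_X nuX).
  + by apply: comp; apply: (VL _ _).1; exact/in_L2D/Lg/in_L2Z.
  + apply: (@comp (fun w => a * V f w + V g w)); apply: cmeasurableD; last exact: (VL _ Lg).1.
    by apply: cmeasurableM; [exact: cmeasurable_cst|exact: (VL _ Lf).1].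
  + have := Vlin a f g Lf Lg; rewrite -{1}(K (V _)).
    rewrite -{1}(K (fun w => a * V f w + V g w)) //.
- move=> f Lf; rewrite -(Viso f Lf); congr Num.sqrt.
  by have := ((in_L2_X nuX) _ (comp _ (VL _ Lf).1)).2; rewrite K.
Qed.

End embedding.

(** * Cells and the discrete Fourier basis *)

Section integral_sums.
Context d (T : measurableType d) (R : realType).
Variable mu : {measure set T -> \bar R}.

Lemma Cintegral_sum (I : Type) (s : seq I) (F : I -> T -> R[i]) :
  (forall i, in_L1 mu (F i)) -> in_L1 mu (fun x => \sum_(i <- s) F i x) /\
  Cintegral mu (fun x => \sum_(i <- s) F i x) = \sum_(i <- s) Cintegral mu (F i).
Proof.
move=> IF; elim: s => [|i s [ih1 ih2]].
  rewrite big_nil; under eq_fun do rewrite big_nil; split.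
    by apply/in_L1P; split; exact: intg0.
  by rewrite (Cintegral_real mu (fun=> 0)) Rintegral_cst// mul0r.
have -> : (fun x => \sum_(j <- i :: s) F j x) = (fun x => F i x + \sum_(j <- s) F j x).
  by apply/funext => x; rewrite big_cons.
by rewrite big_cons; split; [exact: in_L1D|rewrite CintegralD// ih2].
Qed.

End integral_sums.

Section roots_of_unity.
Variable R : realType.

Lemma expiMn (t : R) (n : nat) : expi (n%:R * t) = expi t ^+ n.
Proof.
elim: n => [|n ih]; first by rewrite mul0r expi0 expr0.
by rewrite exprS -ih -expiD; congr expi; rewrite -natr1; ring.
Qed.

Lemma expi2pi (m : int) : expi (2 * pi * m%:~R : R) = 1.
Proof.
have e (n : nat) : expi (2 * pi * n%:R : R) = 1.
  rewrite mulrC expiMn (_ : expi _ = 1) ?expr1n//.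
  by apply: complexP => /=; rewrite mulr_natl ?cos2pi ?sin2pi.
case: m => n; first exact: e.
by rewrite NegzE rmorphN mulrN expiN e; apply: complexP => //=; rewrite oppr0.
Qed.

Lemma expi_neq1 (x : R) : `|x| < 2 * pi -> x != 0 -> expi x != 1.
Proof.
move=> x2 x0; apply/negP => /eqP/(congr1 (@complex.Re R)) /= cx.
have : sin (`|x| / 2) > 0.
  by apply: sin_gt0_pi; rewrite divr_gt0 ?normr_gt0//= ltr_pdivrMr// mulrC.
have : cos `|x| = 1 by case: (ger0P x); rewrite ?cosN.
rewrite {1}(splitr `|x|) cosD -!expr2 => c1 s0.
have := cos2Dsin2 (`|x| / 2); have : 0 < sin (`|x| / 2) ^+ 2 by rewrite exprn_gt0.
lra.
Qed.

End roots_of_unity.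

Section cells.
Variable R : realType.
Notation half := Defs.half.
Notation leb := (@lebesgue_measure R).
Notation TR := (measurableTypeR R).
Implicit Types (n : nat) (l k p : int) (a b : int -> R[i]) (t : R).

Lemma fact_pos n : (0 : R) < n`!%:R. Proof. by rewrite ltr0n fact_gt0. Qed.

Lemma fact_neq0 n : (n`!%:R : R) != 0. Proof. by rewrite gt_eqF ?fact_pos. Qed.

Lemma halfE n : (half n)%:R = n`!%:R ^+ 2 :> R. Proof. by rewrite natrX. Qed.

Lemma double_halfE n : (half n).*2%:Z%:~R = 2 * n`!%:R ^+ 2 :> R.
Proof. by rewrite -[LHS]/((half n).*2%:R) -muln2 natrM halfE mulrC. Qed.

Definition cell_index n (t : R) : int := Num.floor (n`!%:R * t).

Lemma one_cellE n l t : one_cell n l t = (l == cell_index n t)%:R.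
Proof.
rewrite /one_cell indicE /cell mem_setE in_itv/= [l == _]eq_sym floor_eq.
rewrite ler_pdivrMr ?fact_pos// ltr_pdivlMr ?fact_pos// [t * _]mulrC.
by rewrite rmorph_nat.
Qed.

Lemma cell_index_grid n l : cell_index n (l%:~R / n`!%:R) = l.
Proof. by rewrite /cell_index mulrC divfK ?fact_neq0// intrKfloor. Qed.

(** At a given [t] only the cell containing [t] contributes, provided that it is among the summed
    ones. *)
Lemma sum_one_cell n (m p : nat) a t :
  \sum_(k < m) a (k%:Z - p%:Z) * one_cell n (k%:Z - p%:Z) t =
  if 0 <= cell_index n t + p%:Z < m%:Z then a (cell_index n t) else 0.
Proof.
case: ifPn => [h|h].
  have kP : (`|(cell_index n t + p%:Z)%R|%N < m)%N by lia.
  have kE : `|(cell_index n t + p%:Z)%R|%N%:Z - p%:Z = cell_index n t by lia.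
  rewrite (bigD1 (Ordinal kP)) //= kE one_cellE eqxx mulr1 big1 ?addr0 // => i ik.
  rewrite one_cellE; case: eqP => [e|]; rewrite ?mulr0//.
  by move: ik; rewrite -val_eqE /= -e; case/eqP; lia.
apply: big1 => i _; rewrite one_cellE; case: eqP => [e|]; rewrite ?mulr0//.
by move: (ltn_ord i) h; rewrite -e => im /negP []; move: (i : nat) im => {e}i im; lia.
Qed.

Lemma cell_sumE n a t : cell_sum n a id t =
  if in_range n (cell_index n t) then a (cell_index n t) else 0.
Proof.
rewrite /cell_sum sum_one_cell /in_range; congr (if _ then _ else _).
by move: (half n) (cell_index n t) => h c; lia.
Qed.

Lemma coord_cell_sum n a l : in_range n l -> coord_cell n (cell_sum n a id) l = a l.
Proof. by move=> lr; rewrite /coord_cell cell_sumE cell_index_grid lr. Qed.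

Lemma measurable_cell n l : measurable (@cell R n l : set TR).
Proof. exact: measurable_itv. Qed.

Lemma cell_measure n l : leb (cell n l) = (n`!%:R^-1)%:E.
Proof.
rewrite /cell lebesgue_measure_itv/= lte_fin ltr_pM2r ?invr_gt0 ?fact_pos//.
rewrite ltr_int ltrDl ltr01 -EFinB /= -mulrBl rmorphD/= addrAC subrr add0r.
by rewrite mul1r.
Qed.

Lemma intg_cell n l : leb.-integrable setT (EFin \o (\1_(cell n l) : R -> R)).
Proof.
apply/integrableP; split; first by apply/measurable_EFinP; apply: measurable_indic; exact: measurable_cell.
under eq_integral do rewrite /= ger0_norm//.
rewrite integral_indic//; last exact: measurable_cell.
by rewrite setIT; apply: (le_lt_trans _ (ltry (n`!%:R^-1))); rewrite -(cell_measure n l).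
Qed.

Lemma in_L1_one_cell n l : in_L1 leb (one_cell n l).
Proof. by apply/in_L1P; split; [exact: intg_cell|exact: intg0]. Qed.

Lemma Cintegral_one_cell n l : Cintegral leb (one_cell n l) = (n`!%:R^-1)%:C%C.
Proof.
rewrite (Cintegral_real leb (\1_(cell n l))); congr (_%:C%C).
rewrite /Rintegral integral_indic//; last exact: measurable_cell.
by rewrite setIT; exact: (congr1 fine (cell_measure n l)).
Qed.

Lemma in_L2_one_cell n l : in_L2 leb (one_cell n l).
Proof.
apply/in_L2P; split; first by case: (in_L1_one_cell n l).
have -> : (fun x : R => cnorm (one_cell n l x) ^+ 2) = \1_(cell n l); last exact: intg_cell.
apply/funext => x; rewrite /one_cell cnorm_real indicE.
by case: (x \in _); rewrite ?normr1 ?normr0 ?expr1n ?expr0n.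
Qed.

Lemma in_L2_cell_sum n a (sigma : int -> int) : in_L2 leb (cell_sum n a sigma).
Proof.
rewrite /cell_sum; elim: (index_enum _) => [|i s ih].
  under eq_fun do rewrite big_nil.
  by have := in_L2Z 0 (in_L2_one_cell n 0); under eq_fun do rewrite mul0r.
under eq_fun do rewrite big_cons.
by apply: in_L2D ih; apply: in_L2Z; exact: in_L2_one_cell.
Qed.

Lemma L2inner_cell_sum n a (sigma : int -> int) (g : R -> R[i]) :
    (forall t, g t = coord_cell n g (cell_index n t)) ->
  L2inner leb (cell_sum n a sigma) g = (n`!%:R^-1)%:C%C *
    \sum_(i < (half n).*2) a (i%:Z - (half n)%:Z) *
      (coord_cell n g (sigma (i%:Z - (half n)%:Z)))^*%C.
Proof.
move=> gc; rewrite /L2inner.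
have -> : (fun t => cell_sum n a sigma t * (g t)^*%C) = (fun t => \sum_(i < (half n).*2)
    (a (i%:Z - (half n)%:Z) * (coord_cell n g (sigma (i%:Z - (half n)%:Z)))^*%C) *
    one_cell n (sigma (i%:Z - (half n)%:Z)) t).
  apply/funext => t; rewrite /cell_sum mulr_suml; apply: eq_bigr => i _.
  rewrite one_cellE; case: eqP => [->|]; last by rewrite !mulr0 mul0r.
  by rewrite !mulr1 -gc.
rewrite (Cintegral_sum _ (fun i => in_L1Z _ (in_L1_one_cell n _))).2 mulr_sumr.
by apply: eq_bigr => i _; rewrite (CintegralZ _ (in_L1_one_cell n _)) Cintegral_one_cell mulrC.
Qed.

Lemma coord_cell_const n a (sigma : int -> int) t :
  cell_sum n a sigma t = coord_cell n (cell_sum n a sigma) (cell_index n t).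
Proof.
by apply: eq_bigr => i _; rewrite !one_cellE cell_index_grid.
Qed.

Lemma fk_const n k t : @fk R n k t = coord_cell n (fk n k) (cell_index n t).
Proof. by rewrite /fk coord_cell_const. Qed.

Lemma coord_fk n k l : in_range n l -> coord_cell n (@fk R n k) l =
  (Num.sqrt (2 * n`!%:R))^-1%:C%C * expi (2 * pi * l%:~R * (k%:~R / (2 * n`!%:R ^+ 2))).
Proof. by move=> lr; rewrite /coord_cell /fk cell_sumE cell_index_grid lr. Qed.

(** Translation by [p] modulo the number of cells, with representatives kept in the range. *)
Definition is_shift n p (sigma : int -> int) := forall l, in_range n l ->
  in_range n (sigma l) /\ exists m : int, sigma l = l + p + m * (half n).*2%:Z.

Lemma RS_pow_cell_sum n p a : exists2 sigma, is_shift n p sigma &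
  RS_pow n p (cell_sum n a id) = cell_sum n a sigma.
Proof.
have pos (k : nat) : exists2 sigma, is_shift n k%:Z sigma &
    iter k (@RS R n) (cell_sum n a id) = cell_sum n a sigma.
  elim: k => [|k [s sP ih]].
    by exists id => // l lr; split => //; exists 0; rewrite mul0r !addr0.
  exists (next_cell n \o s).
    move=> l lr /=; have [slr [m e]] := sP l lr; split; first exact: next_range.
    rewrite /next_cell; case: ifP => h; first by exists m; rewrite e; lia.
    by exists (m - 1); move: slr h; rewrite /in_range; lia.
  by rewrite iterS ih /RS shift_cell_sum// => l lr; case: (sP l lr).
have neg (k : nat) : exists2 sigma, is_shift n (- k%:Z) sigma &
    iter k (@LS R n) (cell_sum n a id) = cell_sum n a sigma.
  elim: k => [|k [s sP ih]].
    by exists id => // l lr; split => //; exists 0; rewrite mul0r !addr0.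
  exists (prev_cell n \o s).
    move=> l lr /=; have [slr [m e]] := sP l lr; split; first exact: prev_range.
    rewrite /prev_cell; case: ifP => h; first by exists m; rewrite e; lia.
    by exists (m + 1); move: slr h; rewrite /in_range; lia.
  by rewrite iterS ih /LS shift_cell_sum// => l lr; case: (sP l lr).
by case: p => k; [exact: pos|have := neg k.+1; rewrite -NegzE].
Qed.

(** Wrapping round [m] times changes the phase of [fk n k] by [2 pi m k], which is invisible; the
    cyclic shift therefore acts by the same phase on every cell. *)
Lemma inner_RS_pow n p k (f : R -> R[i]) : Hn n f ->
  L2inner leb (RS_pow n p f) (fk n k) =
  expi (- (2 * pi * p%:~R * (k%:~R / (2 * n`!%:R ^+ 2)))) * L2inner leb f (fk n k).
Proof.
move=> [a ->]; have [s sP ->] := RS_pow_cell_sum n p a.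
rewrite !(L2inner_cell_sum _ _ (fk_const n k)) mulrCA; congr (_ * _).
rewrite mulr_sumr; apply: eq_bigr => i _.
have ir := index_range i; have [sr [m e]] := sP _ ir.
rewrite mulrCA; congr (_ * _); rewrite !coord_fk// !mulJ [RHS]mulrCA; congr (_ * _).
rewrite -!expiN -expiD e.
set l := _ - _; set v := k%:~R / _.
have -> : - (2 * pi * (l + p + m * ((half n).*2)%:Z)%:~R * v) =
  - (2 * pi * p%:~R * v) - 2 * pi * l%:~R * v + 2 * pi * (- (m * k))%:~R.
  rewrite /v !intrD mulrNz !intrM double_halfE.
  by move: (pi) (fact_neq0 n) => x y; field.
by rewrite [LHS]expiD (expi2pi R (- (m * k))) mulr1.
Qed.

Lemma expi_root_neq1 n (d : int) : d != 0 -> `|d| < (half n).*2%:Z ->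
  expi (2 * pi * d%:~R / (2 * n`!%:R ^+ 2) : R) != 1.
Proof.
move=> d0 dn; have N0 := fact_neq0 n; apply: expi_neq1; last first.
  by rewrite !mulf_neq0 ?invr_neq0 ?mulf_neq0 ?expf_neq0// ?intr_eq0// gt_eqF// pi_gt0.
rewrite normrM normfV normrM [`|2 * pi|]ger0_norm; last by rewrite mulr_ge0// pi_ge0.
rewrite [`|2 * _ ^+ 2|]ger0_norm; last by rewrite mulr_ge0// sqr_ge0.
rewrite ltr_pdivrMr; last by rewrite mulr_gt0// exprn_gt0// fact_pos.
rewrite ltr_pM2l; last by rewrite mulr_gt0// pi_gt0.
by rewrite -intr_norm -double_halfE ltr_int.
Qed.

Lemma sum_expi n (d : int) : `|d| < (half n).*2%:Z ->
  \sum_(i < (half n).*2)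
    expi (2 * pi * d%:~R * ((i%:Z - (half n)%:Z)%:~R / (2 * n`!%:R ^+ 2)) : R) =
  if d == 0 then (half n).*2%:R else 0.
Proof.
move=> dn; case: eqP => [->|/eqP d0].
  under eq_bigr do rewrite mulr0 mul0r expi0.
  by rewrite sumr_const card_ord.
have N0 := fact_neq0 n.
pose th : R := 2 * pi * d%:~R / (2 * n`!%:R ^+ 2).
have z1 : expi th != 1 by exact: expi_root_neq1.
transitivity (expi (- ((half n)%:R * th)) * \sum_(i < (half n).*2) expi th ^+ i).
  rewrite mulr_sumr; apply: eq_bigr => i _; rewrite -expiMn -expiD; congr expi.
  by rewrite /th rmorphB/=; move: (pi) N0 => x y; field.
suff -> : \sum_(i < (half n).*2) expi th ^+ i = 0 by rewrite mulr0.
have := subrX1 (expi th) (half n).*2.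
have -> : expi th ^+ (half n).*2 = 1.
  rewrite -expiMn -(expi2pi R d); congr expi.
  by rewrite /th -muln2 natrM halfE; move: (pi) N0 => x y; field.
by rewrite subrr => /esym/eqP; rewrite mulf_eq0 subr_eq0 (negbTE z1) => /eqP.
Qed.

(** The values on the cell 1 already tell the frequencies apart; this cell is in the range because
    [1 < n]. *)
Lemma fk_inj n k k' : (1 < n)%N -> in_range n k -> in_range n k' ->
  fk n k = fk n k' :> (R -> R[i]) -> k = k'.
Proof.
move=> n1 kr kr' /(congr1 (fun f => coord_cell n f 1)).
have h1 : (1 < half n)%N.
  by rewrite /half -[1%N](exp1n 2) ltn_exp2r// (leq_trans n1)// fact_geq.
have r1 : in_range n 1 by rewrite /in_range; lia.
rewrite !coord_fk// => /(congr1 (fun z => (Num.sqrt (2 * n`!%:R))%:C%C * z)).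
have s0 : (Num.sqrt (2 * n`!%:R : R))%:C%C != 0 :> R[i].
  by rewrite (fmorph_eq0 (real_complex R)) gt_eqF// sqrtr_gt0 mulr_gt0// fact_pos.
rewrite !fmorphV !(mulVKf s0) => e; apply/eqP; rewrite -subr_eq0; apply/negPn/negP => d0.
have N0 := fact_neq0 n.
have : expi (2 * pi * (k - k')%:~R / (2 * n`!%:R ^+ 2) : R) != 1.
  by apply: expi_root_neq1 => //; move: kr kr'; rewrite /in_range; lia.
apply/negP/negPn/eqP.
have -> : 2 * pi * (k - k')%:~R / (2 * n`!%:R ^+ 2) =
    2 * pi * 1%:~R * (k%:~R / (2 * n`!%:R ^+ 2)) + - (2 * pi * 1%:~R * (k'%:~R / (2 * n`!%:R ^+ 2))) :> R.
  by rewrite rmorphB/=; move: (pi) N0 => x y; field.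
by rewrite expiD expiN e mulcJ cnorm_expi expr1n.
Qed.

Lemma sqnorm_cell_sum n a : sqnorm leb (cell_sum n a id) =
  n`!%:R^-1 * \sum_(i < (half n).*2) cnorm (a (i%:Z - (half n)%:Z)) ^+ 2.
Proof.
have /(congr1 (@complex.Re R)) := L2inner_sqnorm leb (cell_sum n a id).
rewrite (L2inner_cell_sum _ _ (coord_cell_const n a id)) /= => <-.
rewrite ReM ReR ImR mul0r subr0; congr (_ * _).
rewrite raddf_sum; apply: eq_bigr => i _.
by rewrite coord_cell_sum ?index_range// mulcJ.
Qed.

(** The squares are expanded into a double sum over cells and the sum over frequencies is taken
    first: by [sum_expi] only the diagonal survives. *)
Lemma parseval n (f : R -> R[i]) : Hn n f ->
  \sum_(i < (half n).*2) cnorm (L2inner leb f (fk n (i%:Z - (half n)%:Z))) ^+ 2 =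
  sqnorm leb f.
Proof.
move=> [a ->]; apply: (@complexI R).
rewrite rmorph_sum sqnorm_cell_sum.
pose c : R[i] := (Num.sqrt (2 * n`!%:R))^-1%:C%C.
pose x (i : 'I_(half n).*2) : int := i%:Z - (half n)%:Z.
pose e (i k : 'I_(half n).*2) : R := 2 * pi * (x i)%:~R * ((x k)%:~R / (2 * n`!%:R ^+ 2)).
have inner (k : 'I_(half n).*2) : L2inner leb (cell_sum n a id) (fk n (x k)) =
    (n`!%:R^-1)%:C%C * c * \sum_i a (x i) * expi (- e i k).
  rewrite (L2inner_cell_sum _ _ (fk_const n _)) -mulrA; congr (_ * _).
  rewrite mulr_sumr; apply: eq_bigr => i _; rewrite coord_fk ?index_range//.
  rewrite mulJ -expiN mulrCA; congr (_ * (_ * _)).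
  by apply: complexP => //=; rewrite oppr0.
transitivity ((n`!%:R^-1)%:C%C ^+ 2 * c ^+ 2 * \sum_i \sum_j
    (a (x i) * (a (x j))^*%C) * \sum_k expi (2 * pi * (x j - x i)%:~R * ((x k)%:~R / (2 * n`!%:R ^+ 2)))).
  have cJ : (n`!%:R^-1)%:C%C^*%C = (n`!%:R^-1)%:C%C :> R[i] by apply: complexP => //=; rewrite oppr0.
  have cJ' : c^*%C = c by apply: complexP => //=; rewrite oppr0.
  rewrite (eq_bigr (fun k : 'I_(half n).*2 => ((n`!%:R^-1)%:C%C ^+ 2 * c ^+ 2) *
     ((\sum_i a (x i) * expi (- e i k)) * (\sum_i a (x i) * expi (- e i k))^*%C))); last first.
    move=> k _; rewrite -[LHS]/((cnorm (L2inner leb (cell_sum n a id) (fk n (x k))) ^+ 2)%:C%C).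
    by rewrite -mulcJ inner !mulJ cJ cJ' mulrACA -expr2 exprMn.
  rewrite -mulr_sumr; congr (_ * _).
  under eq_bigr => k _.
    rewrite rmorph_sum mulr_suml.
    under eq_bigr => i _ do rewrite mulr_sumr.
    over.
  rewrite exchange_big; apply: eq_bigr => i _.
  rewrite exchange_big; apply: eq_bigr => j _.
  rewrite mulr_sumr; apply: eq_bigr => k _.
  rewrite /= mulJ -expiN opprK mulrACA -expiD; congr (_ * expi _).
  by rewrite /e intrB; move: (_ / _) (pi) => u v; ring.
have diag i : \sum_j (a (x i) * (a (x j))^*%C) * (\sum_(k < (half n).*2)
      expi (2 * pi * (x j - x i)%:~R * ((x k)%:~R / (2 * n`!%:R ^+ 2)))) =
    (cnorm (a (x i)) ^+ 2)%:C%C * (half n).*2%:R.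
  have dn j : `|x j - x i| < (half n).*2%:Z.
    by rewrite /x; move: (ltn_ord i) (ltn_ord j); lia.
  rewrite (bigD1 i)//= (sum_expi (dn i)) subrr eqxx big1 ?addr0 ?mulcJ// => j ji.
  rewrite (sum_expi (dn j)) (_ : (_ == 0) = false) ?mulr0//; apply/negbTE.
  by apply: contra ji => /eqP; rewrite /x => h; apply/eqP/val_inj => /=; lia.
rewrite (eq_bigr _ (fun i _ => diag i)).
rewrite -mulr_suml.
have c2 : c ^+ 2 = ((2 * n`!%:R)^-1)%:C%C.
  by rewrite /c -rmorphXn/= exprVn sqr_sqrtr// mulr_ge0// ltW// fact_pos.
rewrite c2 -rmorph_sum -(rmorph_nat (real_complex R)) -!rmorphXn -!rmorphM/=; congr (_%:C%C).
have d2 : (half n).*2%:R = 2 * n`!%:R ^+ 2 :> R by exact: double_halfE.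
have -> : \sum_i cnorm (a (x i)) ^+ 2 = \sum_(i < (half n).*2) cnorm (a (i%:Z - (half n)%:Z)) ^+ 2 by [].
rewrite d2 exprVn; move: (\sum_(_ < _) _) => u.
by rewrite ?natrM; move: (fact_neq0 n) => y; field.
Qed.

End cells.

(** * The sampled measures as step densities *)

Section sampled_densities.
Variable R : realType.
Notation leb := (@lebesgue_measure R).
Notation half := Defs.half.
Variables (q : nat -> rat) (L : nat -> nat).
Implicit Types (n j : nat) (l k p : int) (t w : R).
Notation S n := (Sn R q L n).

Lemma Cintegral_cell_sum n (a : int -> R[i]) : in_L1 leb (cell_sum n a id) /\
  Cintegral leb (cell_sum n a id) =
    (n`!%:R^-1)%:C%C * \sum_(i < (half n).*2) a (i%:Z - (half n)%:Z).
Proof.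
have [I1 I2] := Cintegral_sum (index_enum 'I_(half n).*2)
  (fun i : 'I_(half n).*2 => in_L1Z (a (i%:Z - (half n)%:Z)) (in_L1_one_cell R n (i%:Z - (half n)%:Z))).
split; first exact: I1.
rewrite [LHS]I2 mulr_sumr; apply: eq_bigr => i _.
by rewrite (CintegralZ _ (in_L1_one_cell R n _)) Cintegral_one_cell mulrC.
Qed.

Definition Ecoef n l : R[i] :=
  (if `|l| <= (L n)%:Z then (E (l%:~R / n`!%:R))%:C%C else 0) + 'i%C / n`!%:R * (l == 0)%:R.

Lemma EnE n t : En L n t = Ecoef n (cell_index n t).
Proof.
rewrite /En (sum_one_cell n (L n).*2.+1 (L n) (fun l => (E (l%:~R / n`!%:R))%:C%C)).
rewrite one_cellE eq_sym; congr (_ + _); congr (if _ then _ else _).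
by move: (cell_index n t) (L n) => c m; lia.
Qed.

Lemma En_cell_sum n : (L n < half n)%N -> En L n = cell_sum n (Ecoef n) id.
Proof.
move=> Ln; apply/funext => t; rewrite EnE cell_sumE; case: ifPn => // h.
rewrite /Ecoef ifF; last by apply/negbTE; move: h Ln; rewrite /in_range; lia.
rewrite (_ : (_ == 0) = false) ?mulr0 ?addr0//.
by apply/negbTE; move: h Ln; rewrite /in_range; lia.
Qed.

Lemma En_Hn n : (L n < half n)%N -> Hn n (En L n : R -> R[i]).
Proof. by move=> Ln; exists (Ecoef n); exact: En_cell_sum. Qed.

Lemma in_L2_En n : (L n < half n)%N -> in_L2 leb (En L n).
Proof. by move=> Ln; rewrite (En_cell_sum Ln); exact: in_L2_cell_sum. Qed.

Notation s n := (sqnorm leb (En L n)).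

Lemma sum_half_pow (m : nat) : \sum_(j < m) (2 ^+ j.+1)^-1 = 1 - 2 ^- m :> R.
Proof.
elim: m => [|m ih]; first by rewrite big_ord0 expr0 invr1 subrr.
by rewrite big_ord_recr/= ih exprS; have h : (2 ^+ m : R) != 0 by []; field.
Qed.

Lemma half_pow_lt1 n : 0 < 1 - 2 ^- n`! :> R.
Proof.
by rewrite subr_gt0 invf_lt1 ?exprn_gt0// exprn_egt1 ?ltr1n// -lt0n fact_gt0.
Qed.

Lemma sample_cE n j : sample_c (S n) j = (2 ^+ j.+1)^-1 * (1 - 2 ^- n`!)^-1 * (s n)^-1.
Proof. by rewrite /= sqr_L2norm !invfM. Qed.

Lemma sample_c_ge0 n j : 0 <= sample_c (S n) j.
Proof.
rewrite sample_cE !mulr_ge0// invr_ge0 ?exprn_ge0// ?sqnorm_ge0//.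
exact/ltW/half_pow_lt1.
Qed.

Notation amp n k := (L2inner leb (En L n) (fk n k)).

(** A shift alters the amplitude by a phase only, and the factor [1 - 2 ^- n!] normalizes the
    weights so that they sum to [1 / s n]. *)
Lemma mass_fk n k : (L n < half n)%N -> mass (S n) (fk n k) = cnorm (amp n k) ^+ 2 / s n.
Proof.
move=> Ln; rewrite /mass.
transitivity ((\sum_(j < n`!) (2 ^+ j.+1)^-1) * ((1 - 2 ^- n`!)^-1 * ((s n)^-1 * cnorm (amp n k) ^+ 2))).
  rewrite mulr_suml; apply: eq_bigr => j _.
  by rewrite sample_cE inner_RS_pow ?cnormM ?cnorm_expi ?mul1r ?mulrA//; exact: En_Hn.
by rewrite sum_half_pow mulVKf ?(gt_eqF (half_pow_lt1 n))// mulrC.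
Qed.

(** The norm of [En] cancels between the weight and the mass. If the amplitude is 0, both sides are
    0 because the inverse of 0 is 0. *)
Lemma proj_Xn_fk n k j : (L n < half n)%N -> 0 < s n -> (j < n`!)%N ->
  proj_Q j (Xn (S n) (fk n k)) =
  (Num.sqrt (2 ^+ j.+1) * Num.sqrt (1 - 2 ^- n`!))^-1%:C%C *
  expi (- (2 * pi * (Num.floor (n`!%:R * q j))%:~R * (k%:~R / (2 * n`!%:R ^+ 2)))) *
  (amp n k / (cnorm (amp n k))%:C%C).
Proof.
move=> Ln s0 jN; rewrite projXn; last exact: sample_c_ge0.
rewrite jN /Un mass_fk// sample_cE [sample_e _ _]/= inner_RS_pow; last exact: En_Hn.
have -> : Num.sqrt (cnorm (amp n k) ^+ 2 / s n) = cnorm (amp n k) / Num.sqrt (s n).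
  by rewrite sqrtrM ?sqr_ge0// sqrtr_sqr ger0_norm ?cnorm_ge0// sqrtrV// ltW.
have -> : Num.sqrt ((2 ^+ j.+1)^-1 * (1 - 2 ^- n`!)^-1 * (s n)^-1) =
    (Num.sqrt (2 ^+ j.+1) * Num.sqrt (1 - 2 ^- n`!))^-1 / Num.sqrt (s n).
  have h := half_pow_lt1 n; rewrite invfM sqrtrM.
    by rewrite sqrtrM ?invr_ge0 ?exprn_ge0// !sqrtrV ?exprn_ge0// ltW.
  by rewrite mulr_ge0// invr_ge0 ?exprn_ge0// ltW.
have gen (x y r : R) (u v : R[i]) : r != 0 ->
    (x / r)%:C%C * (u * v / (y / r)%:C%C) = x%:C%C * u * (v / y%:C%C).
  move=> r0; have : r%:C%C != 0 :> R[i] by rewrite (fmorph_eq0 (real_complex R)).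
  rewrite !(rmorphM (real_complex R)) !(fmorphV (real_complex R)) invfM invrK /=.
  move: (y%:C%C)^-1 r%:C%C x%:C%C => y' r' x' r0'.
  by field.
by apply: gen; rewrite gt_eqF// sqrtr_gt0.
Qed.

(** Replacing the sum over the set [Omega] by a sum over frequencies rests on [fk_inj], whence the
    condition on [n]. *)
Lemma integral_n_sum n (h : Q R -> R[i]) : (1 < n)%N ->
  integral_n (S n) h = \sum_(i < (half n).*2)
    (mass (S n) (fk n (i%:Z - (half n)%:Z)))%:C%C * h (Xn (S n) (fk n (i%:Z - (half n)%:Z))).
Proof.
move=> n1; rewrite /integral_n.
have -> : sample_Omega (S n) = (fun i : nat => fk n (i%:Z - (half n)%:Z)) @` `I_(half n).*2.
  apply/seteqP; split => [_ [k kr ->]|_ [i /= ir <-]].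
    exists `|(k + (half n)%:Z)%R|%N; first by move: kr => /=; lia.
    by congr (fk n _); move: kr; lia.
  by exists (i%:Z - (half n)%:Z) => //; move: ir; lia.
rewrite fsbig_image; last first.
  move=> i i'; rewrite !inE /= => ir ir' /fk_inj e.
  suff : i%:Z - (half n)%:Z = i'%:Z - (half n)%:Z by lia.
  by apply: e => //; rewrite /in_range; lia.
by rewrite [RHS](fsbig_ord _ _ (fun i : nat => (mass (S n) (fk n (i%:Z - (half n)%:Z)))%:C%C *
  h (Xn (S n) (fk n (i%:Z - (half n)%:Z))))).
Qed.

(** The Riemann sum of the Fourier integral of [E], written as the integral of a step function so
    that dominated convergence applies. *)
Definition Gn n w : R[i] := Cintegral leb (fun t =>
  expi (- (pi * w * ((cell_index n t)%:~R / n`!%:R))) * En L n t).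

Lemma Gn_cell_sum n w : (L n < half n)%N ->
  (fun t => expi (- (pi * w * ((cell_index n t)%:~R / n`!%:R))) * En L n t) =
  cell_sum n (fun l => expi (- (pi * w * (l%:~R / n`!%:R))) * Ecoef n l) id.
Proof.
move=> Ln; apply/funext => t; rewrite (En_cell_sum Ln) !cell_sumE.
by case: ifP; rewrite ?mulr0.
Qed.

Lemma amp_Gn n k : (L n < half n)%N ->
  amp n k = (Num.sqrt (2 * n`!%:R))^-1%:C%C * Gn n (k%:~R / n`!%:R).
Proof.
move=> Ln.
have e t : En L n t * (fk n k t)^*%C = (Num.sqrt (2 * n`!%:R))^-1%:C%C *
    (expi (- (pi * (k%:~R / n`!%:R) * ((cell_index n t)%:~R / n`!%:R))) * En L n t).
  have [r|r] := boolP (in_range n (cell_index n t)); last first.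
    by rewrite (En_cell_sum Ln) cell_sumE (negbTE r) mul0r !mulr0.
  rewrite fk_const coord_fk// mulJ -expiN mulrCA [En _ _ _ * _]mulrC; congr (_ * (expi _ * _)).
    by apply: complexP => //=; rewrite oppr0.
  by move: (pi) (fact_neq0 R n) => x y; field.
rewrite /L2inner (funext e) CintegralZ//.
by rewrite (Gn_cell_sum _ Ln); exact: (Cintegral_cell_sum n _).1.
Qed.

(** This is [n!] times the mass of [fk n k], for [k] the cell of [w]; the factor [n!] cancels
    against the normalization of [fk]. *)
Definition dens n w : R := if in_range n (cell_index n w)
  then cnorm (Gn n ((cell_index n w)%:~R / n`!%:R)) ^+ 2 / (2 * s n) else 0.

Lemma dens_ge0 n w : 0 <= dens n w.
Proof.
by rewrite /dens; case: ifP => // _; rewrite divr_ge0 ?sqr_ge0// mulr_ge0// sqnorm_ge0.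
Qed.

Definition Xcell n w : Q R := Xn (S n) (fk n (cell_index n w)).

Lemma integral_n_dens n (h : Q R -> R[i]) : (1 < n)%N -> (L n < half n)%N -> 0 < s n ->
  in_L1 leb (fun w => (dens n w)%:C%C * h (Xcell n w)) /\
  integral_n (S n) h = Cintegral leb (fun w => (dens n w)%:C%C * h (Xcell n w)).
Proof.
move=> n1 Ln s0; pose a k := (cnorm (Gn n (k%:~R / n`!%:R)) ^+ 2 / (2 * s n))%:C%C *
  h (Xn (S n) (fk n k)).
have -> : (fun w => (dens n w)%:C%C * h (Xcell n w)) = cell_sum n a id.
  by apply/funext => w; rewrite cell_sumE /dens; case: ifP => _ //; rewrite mul0r.
have [I1 ->] := Cintegral_cell_sum n a; split => //.
rewrite integral_n_sum// mulr_sumr; apply: eq_bigr => i _.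
rewrite /a mulrA; congr (_ * _); rewrite mass_fk// amp_Gn//.
rewrite -(rmorphM (real_complex R)) cnormM cnorm_real exprMn normfV exprVn real_normK ?num_real// sqr_sqrtr; last first.
  by rewrite mulr_ge0// ltW// fact_pos.
by congr (_%:C%C); move: (cnorm _ ^+ 2) (s n) => u r; rewrite !invfM; ring.
Qed.

Lemma Rintegral_dens n : (1 < n)%N -> (L n < half n)%N -> 0 < s n ->
  leb.-integrable setT (EFin \o dens n) /\ \int[leb]_w dens n w = 1.
Proof.
move=> n1 Ln s0; have [] := integral_n_dens (fun=> 1) n1 Ln s0.
under eq_fun do rewrite mulr1.
move=> /in_L1P[I1 _]; rewrite Cintegral_real integral_n_sum// => /(congr1 (@complex.Re R)) /= <-.
split => //; rewrite raddf_sum/=.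
transitivity ((\sum_(i < (half n).*2) cnorm (amp n (i%:Z - (half n)%:Z)) ^+ 2) / s n).
  by rewrite mulr_suml; apply: eq_bigr => i _; rewrite mulr1 mul0r subr0 mass_fk.
by rewrite (parseval (En_Hn Ln)) divff// gt_eqF.
Qed.

End sampled_densities.

(** * Limits of the samples *)

(** The samples are controlled from index 2 on, so limits are computed along [n.+2] and transported
    back. *)
Lemma cvg_shift2 (T : ptopologicalType) (u : nat -> T) (a : T) :
  u n.+2 @[n --> \oo] --> a <-> u n @[n --> \oo] --> a.
Proof.
have -> : (fun n => u n.+2) = (fun n => u (n + 2)%N) by apply/funext => n; rewrite addn2.
by rewrite (cvg_shiftn 2 u).
Qed.

Section complex_limits.
Variables (R : realType) (I : Type) (F : set_system I).
Hypothesis FF : Filter F.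

Lemma cvgMC (u v : I -> R[i]) (a b : R[i]) : u n @[n --> F] --> a -> v n @[n --> F] --> b ->
  u n * v n @[n --> F] --> a * b.
Proof.
move=> ua vb; have [ru rv] := (cvg_Re FF ua, cvg_Re FF vb).
have [iu iv] := (cvg_Im FF ua, cvg_Im FF vb).
apply: cvg_complexP.
  rewrite ReM (_ : (fun n => _) = (fun n => complex.Re (u n) * complex.Re (v n) -
    complex.Im (u n) * complex.Im (v n))); last by apply/funext => n; rewrite ReM.
  by apply: cvgB; exact: cvgM.
rewrite ImM (_ : (fun n => _) = (fun n => complex.Re (u n) * complex.Im (v n) +
  complex.Im (u n) * complex.Re (v n))); last by apply/funext => n; rewrite ImM.
by apply: cvgD; exact: cvgM.
Qed.

Lemma cvgC_sub0 (u : I -> R[i]) (a : R[i]) : u n @[n --> F] --> a ->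
  u n - a @[n --> F] --> (0 : R[i]).
Proof.
by move=> ua; rewrite -[X in _ --> X](subrr a); apply: cvgB; [exact: ua|exact: cvg_cst].
Qed.

Lemma cvg_realC (u : I -> R) (a : R) : u n @[n --> F] --> a ->
  (u n)%:C%C @[n --> F] --> (a%:C%C : R[i]).
Proof. by move=> ua; apply: cvg_complexP => //=; exact: cvg_cst. Qed.

Lemma cvg_expi (u : I -> R) (a : R) : u n @[n --> F] --> a ->
  expi (u n) @[n --> F] --> expi a.
Proof.
move=> ua; apply: cvg_complexP => /=.
  by apply: (cvg_comp u cos); [exact: ua|exact: continuous_cos].
by apply: (cvg_comp u sin); [exact: ua|exact: continuous_sin].
Qed.

Lemma squeeze_cvgC (u : I -> R[i]) (b : I -> R) (a : R[i]) :
  (\forall n \near F, cnorm (a - u n) <= b n) -> b n @[n --> F] --> (0 : R) ->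
  u n @[n --> F] --> a.
Proof.
move=> ub b0.
have le (f : R[i] -> R) : (forall z, `|f z| <= cnorm z) -> (forall z w, f (z - w) = f z - f w) ->
    f (u n) @[n --> F] --> f a.
  move=> f1 f2; apply/cvgrPdist_le => /= e e0; near=> n.
  rewrite -f2 (le_trans (f1 _))//; apply: (@le_trans _ _ (b n)); first by near: n.
  rewrite -[b n]opprK -[leLHS]sub0r (le_trans (ler_norm _))//.
  by rewrite sub0r opprK -normrN -[- b n]sub0r; near: n; move/cvgrPdist_le : b0; exact.
apply: cvg_complexP; apply: le.
- exact: normr_Re_le.
- by move=> z w; rewrite ReD ReN.
- exact: normr_Im_le.
- by move=> z w; rewrite ImD ImN.
Unshelve. all: by end_near. Qed.

End complex_limits.

Section sampling_limits.
Variable R : realType.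
Notation leb := (@lebesgue_measure R).
Notation mup := (@mu' R).
Notation TR := (measurableTypeR R).
Notation half := Defs.half.
Notation intg f := (leb.-integrable [set: R] (EFin \o f)).
Variables (q : nat -> rat) (L : nat -> nat).
Hypothesis L_range : forall n : nat, (2 <= n)%N -> (0 < L n < n`! ^ 2 - 1)%N.
Hypothesis L_large : (n`!%:R : R) `^ (3 / 2) / (L n)%:R @[n --> \oo] --> (0 : R).
Hypothesis L_small : (L n)%:R / n`!%:R ^+ 2 @[n --> \oo] --> (0 : R).
Implicit Types (n j : nat) (l k p : int) (t w : R).
Notation S n := (Sn R q L n).
Notation s n := (sqnorm leb (En L n)).
Notation grid n t := ((cell_index n t)%:~R / n`!%:R).

Lemma L_half n : (L n.+2 < half n.+2)%N.
Proof. by have /andP[_] := @L_range n.+2 isT; rewrite /half; lia. Qed.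

Lemma cvg_inv_fact : (n.+2`!%:R^-1 : R) @[n --> \oo] --> (0 : R).
Proof.
apply: (@squeeze_cvgr _ _ _ _ (fun=> 0) (fun n => n.+1%:R^-1)); last 2 first.
- exact: cvg_cst.
- exact: cvg_harmonic.
near=> n; rewrite invr_ge0 ler0n /= lef_pV2 ?posrE ?fact_pos ?ltr0n// ler_nat.
exact: leq_trans (fact_geq _).
Unshelve. all: by end_near. Qed.

Lemma grid_itv n t : t - n`!%:R^-1 < grid n t <= t.
Proof.
have /andP[a b] := floor_itv (n`!%:R * t); have N0 := fact_pos R n.
rewrite ler_pdivrMr// [t * _]mulrC a andbT ltr_pdivlMr// mulrBl mulVf ?gt_eqF//.
by move: b; rewrite intrD /cell_index [t * _]mulrC; lra.
Qed.

Lemma cvg_grid t : grid n.+2 t @[n --> \oo] --> t.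
Proof.
apply: (@squeeze_cvgr _ _ _ _ (fun n => t - n.+2`!%:R^-1) (fun=> t)).
- by near=> n; have /andP[a b] := grid_itv n.+2 t; rewrite (ltW a) b.
- by rewrite -[X in _ --> X]subr0; apply: cvgB; [exact: cvg_cst|exact: cvg_inv_fact].
- exact: cvg_cst.
Unshelve. all: by end_near. Qed.

(** Since [n! <= n! ^ (3 / 2)], the ratio of [L n] to [n!] is unbounded: the window of half-width
    [L n / n!] eventually covers any bounded set. *)
Lemma near_L_ge (K : R) : 0 <= K -> \forall n \near \oo, K * n.+2`!%:R <= (L n.+2)%:R.
Proof.
move=> K0; have K1 : 0 < (K + 1)^-1 by rewrite invr_gt0; lra.
have /cvgrPdist_le/(_ _ K1) : (n.+2`!%:R : R) `^ (3 / 2) / (L n.+2)%:R @[n --> \oo] --> (0 : R).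
  exact/(cvg_shift2 (fun n => (n`!%:R : R) `^ (3 / 2) / (L n)%:R)).
apply: filterS => n; rewrite sub0r normrN ger0_norm ?divr_ge0 ?powR_ge0//.
have /andP[L0 _] := @L_range n.+2 isT.
rewrite ler_pdivrMr ?ltr0n// -ler_pdivrMl ?invr_gt0; last by lra.
rewrite invrK => h; apply: le_trans h; have N1 : 1 <= n.+2`!%:R :> R by rewrite ler1n fact_gt0.
have : (n.+2`!%:R : R) `^ 1 <= n.+2`!%:R `^ (3 / 2) by apply: ler_powR => //; lra.
rewrite powRr1 ?ler0n//; nra.
Qed.

Lemma near_index_le t : \forall n \near \oo, `|cell_index n.+2 t| <= (L n.+2)%:Z.
Proof.
have := @near_L_ge (`|t| + 1) (addr_ge0 (normr_ge0 _) ler01); apply: filterS => n h.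
have /andP[a b] := floor_itv (n.+2`!%:R * t); have N1 : 1 <= n.+2`!%:R :> R by rewrite ler1n fact_gt0.
rewrite -(ler_int R) intr_norm; apply: le_trans h; rewrite mulrDl mul1r.
have : `|n.+2`!%:R * t| = `|t| * n.+2`!%:R by rewrite normrM mulrC normr_nat.
move: b; rewrite intrD /cell_index => b.
set c := (Num.floor _)%:~R in a b *; set y := n.+2`!%:R * t in a b * => <-.
have := ler_norm y; have := ler_norm (- y); rewrite normrN => y1 y2.
rewrite ler_norml; apply/andP; split; lra.
Qed.

Lemma continuous_E : continuous (@E R).
Proof.
move=> x; rewrite (_ : @E R = fun t => (2 / pi) `^ 4^-1 * gauss 1 t); last first.
  by apply/funext => t; exact: E_gauss.
by apply: cvgMr; exact: continuous_gauss.
Qed.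

Lemma cvg_En t : En L n.+2 t @[n --> \oo] --> (E t)%:C%C.
Proof.
have -> : (fun n => En L n.+2 t) = (fun n => Ecoef R L n.+2 (cell_index n.+2 t)).
  by apply/funext => n; exact: EnE.
have dE n : 'i%C / n.+2`!%:R * (cell_index n.+2 t == 0)%:R =
    (0 +i* (n.+2`!%:R^-1 * (cell_index n.+2 t == 0)%:R))%C :> R[i].
  rewrite -(rmorph_nat (real_complex R) n.+2`!) -(rmorph_nat (real_complex R) (_ == 0)).
  move: (n.+2`!%:R) ((_ == 0)%:R) => x y; rewrite -[x%:C%C^-1](fmorphV (real_complex R)).
  by apply: complexP; rewrite !(ReM, ImM) /=; ring.
apply: cvg_complexP.
  apply: (@cvg_trans _ (E (grid n.+2 t) @[n --> \oo])); last first.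
    by apply: cvg_seq_comp; [exact: continuous_E|exact: cvg_grid].
  apply: near_eq_cvg; have := near_index_le t; apply: filterS => n h.
  by rewrite /Ecoef h dE ReD /= addr0.
apply: (@squeeze_cvgr _ _ _ _ (fun=> 0) (fun n => n.+2`!%:R^-1)); last 2 first.
- exact: cvg_cst.
- exact: cvg_inv_fact.
near=> n.
have -> : complex.Im (Ecoef R L n.+2 (cell_index n.+2 t)) =
    n.+2`!%:R^-1 * (cell_index n.+2 t == 0)%:R.
  by rewrite /Ecoef dE ImD /=; case: ifP => _ /=; rewrite add0r.
by case: (_ == 0); rewrite ?mulr1 ?mulr0 ?lexx invr_ge0 ler0n.
Unshelve. all: by end_near. Qed.

(** An integrable majorant of all the [En]. A grid point [r] lies within 1 of [t], and
    [(2 r - t) ^ 2 >= 0] means [t ^ 2 / 2 <= r ^ 2 + (r - t) ^ 2]: hence the halved exponent and the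
    factor [expR 1]. The summand 1 covers the imaginary term on the cell 0. *)
Definition Ebound t : R := (((2 / pi) `^ 4^-1 + 1) * expR 1) * gauss 2^-1 t.

Lemma intg_Ebound : intg Ebound.
Proof. by apply: intgZ; apply: intg_gauss; lra. Qed.

Lemma Ebound_ge0 t : 0 <= Ebound t.
Proof. by rewrite !mulr_ge0 ?gauss_ge0 ?expR_ge0// addr_ge0 ?powR_ge0. Qed.

Lemma intg_sqr_Ebound : intg (fun t => Ebound t ^+ 2).
Proof.
have -> : (fun t => Ebound t ^+ 2) = (fun t => (((2 / pi) `^ 4^-1 + 1) * expR 1) ^+ 2 * gauss 1 t).
  by apply/funext => t; rewrite exprMn /gauss -expRM_natl; congr (_ * expR _); field.
by apply: intgZ; apply: intg_gauss; lra.
Qed.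

Lemma cnorm_En_le n t : cnorm (En L n t) <= Ebound t.
Proof.
have /andP[a b] := grid_itv n t; have N1 : 1 <= n`!%:R :> R by rewrite ler1n fact_gt0.
have i1 : n`!%:R^-1 <= 1 :> R by rewrite invf_le1// fact_pos.
have g (r : R) : `|r - t| <= 1 -> expR (- r ^+ 2) <= expR 1 * gauss 2^-1 t.
  move=> h; rewrite /gauss -expRD ler_expR.
  have : (r - t) ^+ 2 <= 1 by rewrite -real_normK ?num_real// expr_le1.
  have : 0 <= (2 * r - t) ^+ 2 by exact: sqr_ge0.
  nra.
rewrite EnE /Ecoef (le_trans (cnormD _ _))// /Ebound mulrDl mulrDl lerD//.
  case: ifP => _; last by rewrite cnorm0 mulr_ge0 ?gauss_ge0// mulr_ge0 ?expR_ge0 ?powR_ge0.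
  rewrite cnorm_real ger0_norm; last by rewrite mulr_ge0 ?expR_ge0 ?powR_ge0.
  rewrite -mulrA ler_wpM2l ?powR_ge0//; apply: g.
  by rewrite ler_norml; apply/andP; split; lra.
rewrite mul1r; case: eqP => [z|_]; last by rewrite mulr0 cnorm0 mulr_ge0 ?gauss_ge0 ?expR_ge0.
have -> : (n`!%:R : R[i])^-1 = (n`!%:R^-1)%:C%C.
  by rewrite (fmorphV (real_complex R)) (rmorph_nat (real_complex R)).
rewrite mulr1 cnormM cnorm_real ger0_norm ?invr_ge0//.
have -> : cnorm ('i%C : R[i]) = 1 by rewrite /= expr0n expr1n add0r sqrtr1.
rewrite mul1r; apply: (le_trans i1).
have := g 0; rewrite expr0n oppr0 expR0; apply; move: a b; rewrite z mul0r => a b.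
by rewrite ler_norml; apply/andP; split; lra.
Qed.

Let mEn n : @cmeasurable _ TR R (En L n.+2).
Proof. by case: (in_L2_En R (L_half n)). Qed.

Let mE : @cmeasurable _ TR R (fun t => (E t)%:C%C).
Proof.
by apply: cmeasurable_real; apply: continuous_measurable_fun; exact: continuous_E.
Qed.

(** [Vmap] is an isometry that sends [E] to the constant 1, and [mu'] has mass 1. *)
Lemma sqnorm_E : sqnorm leb (fun t => (E t)%:C%C) = 1.
Proof.
have [_ L2E] := shifted_E_L (0 : R).
have := Vmap_shifted_E (0 : R).
have e0 : (fun t : R => (E (t - 0))%:C%C) = (fun t => (E t)%:C%C).
  by apply/funext => t; rewrite subr0.
rewrite e0 in L2E *; move=> VE.
have /(congr1 (fun x => x ^+ 2)) := (Vmap_isometry R).2 _ L2E; rewrite !sqr_L2norm => <-.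
rewrite (eq_ae_sqnorm (in_L2_Vmap L2E).1 (in_L2_expi_mu' (- pi * 0)).1 VE).
rewrite /sqnorm; under eq_Rintegral do rewrite cnorm_expi expr1n.
by rewrite Rintegral_cst// mul1r; exact: (congr1 fine (probability_setT mup)).
Qed.

Lemma cvg_sqnorm_En : s n.+2 @[n --> \oo] --> (1 : R).
Proof.
rewrite -[X in _ --> X]sqnorm_E.
have [|||||_ //] := @Rintegral_dct _ _ _ leb (fun n t => cnorm (En L n.+2 t) ^+ 2)
  (fun t => cnorm ((E t)%:C%C : R[i]) ^+ 2) (fun t => Ebound t ^+ 2).
- by move=> n; exact: measurable_sqr_cnorm.
- exact: measurable_sqr_cnorm.
- by apply: aeW => t; have c := cvg_cnormf eventually_filter (@cvg_En t); exact: (cvgM c c).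
- exact: intg_sqr_Ebound.
- move=> n t; rewrite ger0_norm ?sqr_ge0// lerXn2r ?nnegrE ?cnorm_ge0 ?Ebound_ge0//.
  exact: cnorm_En_le.
Qed.

Lemma near_sqnorm_En : \forall n \near \oo, 0 < s n.+2.
Proof. exact: (cvgr_gt _ cvg_sqnorm_En _ ltr01). Qed.

(** The frequency is allowed to move with [n] because [dens] evaluates [Gn] at the grid point of
    [w]. *)
Lemma cvg_Gn (u : nat -> R) w : u n @[n --> \oo] --> w ->
  Gn L n.+2 (u n) @[n --> \oo] --> (Num.sqrt 2 * sphi w)%:C%C.
Proof.
move=> uw; pose f t : R[i] := expi (- pi * w * t) * (E t)%:C%C.
have -> : (Num.sqrt 2 * sphi w)%:C%C = Cintegral leb f.
  have := FT_shifted_E 0 w; rewrite /FT mulr0 mul0r expi0 mul1r.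
  have -> : (fun t : R => expi (- pi * w * t) * (E (t - 0))%:C%C) = f.
    by apply/funext => t; rewrite subr0.
  have s2 : (Num.sqrt 2 : R) != 0 by rewrite gt_eqF// sqrtr_gt0.
  move=> e; rewrite (rmorphM (real_complex R)) [X in _ * X]/= -e mulrA.
  by rewrite -(rmorphM (real_complex R)) divff// mul1r.
pose fn n t : R[i] := expi (- (pi * u n * grid n.+2 t)) * En L n.+2 t.
have ft t : fn n t @[n --> \oo] --> f t.
  apply: cvgMC; last exact: cvg_En.
  apply: cvg_expi; rewrite -mulrA mulNr mulrA; apply: cvgN; apply: cvgM; last exact: cvg_grid.
  by apply: cvgMr.
have [||||||_ [] //] := @Cintegral_dct _ _ _ leb fn f Ebound.
- move=> n; rewrite /fn (Gn_cell_sum _ (L_half n)).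
  by case: (Cintegral_cell_sum n.+2 (fun l => expi (- (pi * u n * (l%:~R / n.+2`!%:R))) * Ecoef R L n.+2 l)) => -[].
- apply: cmeasurableM => //; exact: cmeasurable_expiM.
- by apply: aeW => t; exact: cvg_Re (ft t).
- by apply: aeW => t; exact: cvg_Im (ft t).
- exact: intg_Ebound.
- by move=> n t; rewrite cnormM cnorm_expi mul1r; exact: cnorm_En_le.
by move=> cr ci; exact: cvg_complexP.
Qed.

Lemma near_in_range w : \forall n \near \oo, in_range n.+2 (cell_index n.+2 w).
Proof.
have := near_index_le w; apply: filterS => n; have := L_half n.
by move: (cell_index _ _) (L _) => c m; rewrite /in_range; move: (half _) => h; lia.
Qed.

Lemma cvg_dens w : dens L n.+2 w @[n --> \oo] --> phi w.
Proof.
apply: (@cvg_trans _ (cnorm (Gn L n.+2 (grid n.+2 w)) ^+ 2 / (2 * s n.+2) @[n --> \oo])).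
  by apply: near_eq_cvg; have := near_in_range w; apply: filterS => n h; rewrite /dens h.
have -> : phi w = cnorm ((Num.sqrt 2 * sphi w)%:C%C : R[i]) ^+ 2 / (2 * 1).
  by rewrite cnorm_real real_normK ?num_real// exprMn sqr_sqrtr// sqr_sphi; field.
apply: cvgM.
  by have c := cvg_cnormf eventually_filter (cvg_Gn (@cvg_grid w)); exact: (cvgM c c).
apply: cvgV; first by rewrite mulr1.
by apply: cvgMr; exact: cvg_sqnorm_En.
Qed.


(** Once [n] reaches the denominator of [q j], that denominator divides the factorial and the floor
    is exact. *)
Lemma floor_fact j : \forall n \near \oo,
  (Num.floor (n.+2`!%:R * q j))%:~R = n.+2`!%:R * ratr (q j) :> R.
Proof.
exists `|denq (q j)|%N => // n /= dn.
have dv : (`|denq (q j)|%N %| n.+2`!)%N.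
  by apply: dvdn_fact; rewrite absz_gt0 denq_eq0 /= (leq_trans dn)// -addn2 leq_addr.
have e : n.+2`!%:R * q j = ((n.+2`! %/ `|denq (q j)|%N)%N%:Z * numq (q j))%:~R.
  rewrite -{1}(divnK dv) natrM -[X in _ * X = _](divq_num_den (q j)).
  have -> : (`|denq (q j)|%N%:R : rat) = (denq (q j))%:~R.
    by rewrite -[LHS]/(`|denq (q j)|%N%:Z%:~R) gez0_abs// denq_ge0.
  have d0 : (denq (q j))%:~R != 0 :> rat by rewrite intr_eq0 denq_eq0.
  by rewrite intrM -mulrA [X in _ * X]mulrCA divff// mulr1.
have -> : n.+2`!%:R * ratr (q j) = ratr (n.+2`!%:R * q j) :> R by rewrite rmorphM/= ratr_nat.
by rewrite e intrKfloor ratr_int.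
Qed.

Lemma cvg_half_pow : (2 ^- n.+2`! : R) @[n --> \oo] --> (0 : R).
Proof.
apply: (@squeeze_cvgr _ _ _ _ (fun=> 0) (fun n => n.+2`!%:R^-1)); last 2 first.
- exact: cvg_cst.
- exact: cvg_inv_fact.
near=> n; rewrite invr_ge0 exprn_ge0//= lef_pV2 ?posrE ?fact_pos ?exprn_gt0//.
by rewrite -natrX ler_nat ltnW// ltn_expl.
Unshelve. all: by end_near. Qed.

(** The amplitude tends to a positive real number, so its phase [G / |G|] tends to 1 and only the
    character of frequency [q j] is left. *)
Lemma cvg_Xcell w : Xcell q L n.+2 w @[n --> \oo] --> X q w.
Proof.
apply: cvg_Q => j; rewrite projX.
pose c n : R := (Num.sqrt (2 ^+ j.+1) * Num.sqrt (1 - 2 ^- n.+2`!))^-1.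
pose G n : R[i] := Gn L n.+2 (grid n.+2 w).
apply: (@cvg_trans _ ((c n)%:C%C * expi (- (pi * ratr (q j) * grid n.+2 w)) *
    (G n * ((cnorm (G n))^-1)%:C%C) @[n --> \oo])).
  apply: near_eq_cvg; near=> n; rewrite /Xcell proj_Xn_fk; last 3 first.
  - exact: L_half.
  - by near: n; exact: near_sqnorm_En.
  - apply: (@leq_trans n); last by apply: leq_trans (fact_geq _); rewrite -addn2 leq_addr.
    by near: n; exact: nbhs_infty_gt.
  have -> : (Num.floor (n.+2`!%:R * q j))%:~R = n.+2`!%:R * ratr (q j) :> R.
    by near: n; exact: floor_fact.
  congr (_ * expi _ * _).
    by move: (pi) (fact_neq0 R n.+2) => x y; field.
  rewrite amp_Gn ?L_half//.
  have r0 : (Num.sqrt (2 * n.+2`!%:R))^-1 != 0 :> R.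
    by rewrite invr_eq0 gt_eqF// sqrtr_gt0 mulr_gt0// fact_pos.
  rewrite cnormM cnorm_real ger0_norm ?invr_ge0 ?sqrtr_ge0//.
  move: r0; move: (_^-1) => r r0.
  rewrite -[G n]/(Gn L n.+2 (grid n.+2 w)); move: (Gn _ _ _) => g.
  rewrite (rmorphM (real_complex R)) invfM (fmorphV (real_complex R)) /=.
  have r0' : r%:C%C != 0 :> R[i] by rewrite (fmorph_eq0 (real_complex R)).
  by move: r0' (cnorm g)%:C%C^-1; move: r%:C%C => r' r0' z; field.
have G0 : 0 < Num.sqrt 2 * sphi w by rewrite mulr_gt0 ?sphi_gt0// sqrtr_gt0.
have cG : G n @[n --> \oo] --> (Num.sqrt 2 * sphi w)%:C%C by exact: cvg_Gn (@cvg_grid w).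
rewrite -[_^-1%:C%C * expi (- pi * _ * w)]mulr1; apply: cvgMC; first apply: cvgMC.
- apply: cvg_realC; apply: cvgV; first by rewrite gt_eqF// sqrtr_gt0 exprn_gt0.
  rewrite -[X in _ --> X]mulr1; apply: cvgMr.
  rewrite -[X in _ --> X]sqrtr1; apply: cvg_seq_comp; first exact: sqrt_continuous.
  rewrite -[X in _ --> X]subr0; apply: cvgB; [exact: cvg_cst|exact: cvg_half_pow].
- apply: cvg_expi; rewrite !mulNr; apply: cvgN; apply: cvgMr; exact: cvg_grid.
- have -> : 1 = (Num.sqrt 2 * sphi w)%:C%C * ((Num.sqrt 2 * sphi w)^-1)%:C%C :> R[i].
    by rewrite -(rmorphM (real_complex R)) divff// gt_eqF.
  apply: cvgMC; [exact: cG|]; apply: cvg_realC; apply: cvgV; first by rewrite gt_eqF.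
  have := cvg_cnormf eventually_filter cG; rewrite cnorm_real ger0_norm ?ltW//.
Unshelve. all: by end_near. Qed.

Lemma measurable_dens n : @measurable_fun _ _ TR R setT (dens L n).
Proof.
have := (in_L2_cell_sum n (fun k => (cnorm (Gn L n (k%:~R / n`!%:R)) ^+ 2 / (2 * s n))%:C%C) id).1.1.
congr measurable_fun; apply/funext => w.
by rewrite cell_sumE /dens; case: ifP.
Qed.

Lemma Rintegral_phi : \int[leb]_w phi w = 1 :> R.
Proof.
have := (Rintegral_mu' (@measurable_cst _ _ TR R setT 1)).2.
rewrite Rintegral_cst// mul1r; under [X in _ = X -> _]eq_Rintegral do rewrite mul1r.
by move=> <-; exact: (congr1 fine (probability_setT mup)).
Qed.

(* Scheffe's lemma: the densities have mass one, so that the integral of their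
   distance is twice that of the positive part of the difference. *)
Lemma cvg_dens_L1 : \int[leb]_w `|dens L n.+2 w - phi w| @[n --> \oo] --> (0 : R).
Proof.
(* The positive part of [phi - dens] is dominated by [phi], since [dens] is nonnegative; no such
   majorant is at hand for the absolute value. *)
pose d n w : R := (`|phi w - dens L n.+2 w| + (phi w - dens L n.+2 w)) / 2.
have md n : @measurable_fun _ _ TR R setT (d n).
  have m : @measurable_fun _ _ TR R setT (fun w => phi w - dens L n.+2 w).
    by apply: measurable_funB; [exact: measurable_phi|exact: measurable_dens].
  apply: measurable_funM; last exact: measurable_cst.
  apply: measurable_funD; last exact: m.
  exact: (measurableT_comp (@normr_measurable R setT) m).
have d_le n w : `|d n w| <= phi w.
  have := dens_ge0 L n.+2 w; have := phi_ge0 w; rewrite /d => p0 d0.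
  by case: (lerP 0 (phi w - dens L n.+2 w)) => h;
    [rewrite (ger0_norm h)|rewrite (ltr0_norm h)]; rewrite ger0_norm; lra.
have dc w : d n w @[n --> \oo] --> (0 : R).
  have c : phi w - dens L n.+2 w @[n --> \oo] --> (0 : R).
    by rewrite -(subrr (phi w)); apply: cvgB; [exact: cvg_cst|exact: cvg_dens].
  rewrite -[X in _ --> X](mul0r 2^-1); apply: cvgMl.
  rewrite -[X in _ --> X](addr0 (0 : R)); apply: cvgD; last exact: c.
  by rewrite -[X in _ --> X](normr0 R); apply: cvg_norm; exact: c.
have [||||| _] := @Rintegral_dct _ _ _ leb d (fun=> 0) (@phi R).
- exact: md.
- exact: measurable_cst.
- exact: aeW.
- exact: intg_phi.
- exact: d_le.
rewrite Rintegral_cst// mul0r => id.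
have id2 : 2 * \int[leb]_w d n w @[n --> \oo] --> (0 : R).
  by rewrite -[X in _ --> X](mulr0 (2 : R)); apply: cvgMr.
apply: (@cvg_trans _ (2 * \int[leb]_w d n w @[n --> \oo])); last exact: id2.
apply: near_eq_cvg; near=> n.
have [I1 I2] : intg (dens L n.+2) /\ \int[leb]_w dens L n.+2 w = 1.
  apply: (Rintegral_dens q) => //; first exact: L_half.
  by near: n; exact: near_sqnorm_En.
have Id : intg (d n) by apply: (@intg_le _ _ _ leb _ (@phi R)); [exact: md|exact: d_le|exact: intg_phi].
have e w : `|dens L n.+2 w - phi w| = (dens L n.+2 w - phi w) + 2 * d n w.
  by rewrite /d -normrN opprB; field.
rewrite [RHS](_ : _ = \int[leb]_w ((dens L n.+2 w - phi w) + 2 * d n w)); last first.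
  by apply: eq_Rintegral => w _; exact: e.
rewrite RintegralD//; [|exact: (intgB I1 (intg_phi R))|exact: (intgZ 2 Id)].
rewrite RintegralB//; last exact: intg_phi.
by rewrite I2 Rintegral_phi subrr add0r RintegralZl.
Unshelve. all: by end_near. Qed.

(** The density is split as [(dens - phi) + phi]. The first part is small in L_1 against the bounded
    [k n]; for the second [M * phi] is a majorant. *)
Lemma integral_n_cvg (h : Q R -> R[i]) : continuous h ->
  integral_n (S n) h @[n --> \oo] --> Cintegral mup (h \o X q).
Proof.
move=> ch; have [M hM] := Q_bounded ch.
have M0 : 0 <= M by apply: le_trans (hM point); exact: cnorm_ge0.
have mhX : @cmeasurable _ TR R (h \o X q).
  exact: (cmeasurable_X q (cmeasurable_continuous_Q ch)).
pose k n := cell_sum n.+2 (fun l => h (Xn (S n.+2) (fk n.+2 l))) id.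
have mk n : @cmeasurable _ TR R (k n) by case: (in_L2_cell_sum n.+2 (fun l => h (Xn (S n.+2) (fk n.+2 l))) id).
have kM n w : cnorm (k n w) <= M.
  by rewrite /k cell_sumE; case: ifP => _ //; rewrite cnorm0.
have ck w : k n w @[n --> \oo] --> h (X q w).
  apply: (@cvg_trans _ (h (Xcell q L n.+2 w) @[n --> \oo])).
    apply: near_eq_cvg; have := near_in_range w; apply: filterS => n r.
    by rewrite /k cell_sumE r.
  exact: (cvg_comp _ h (@cvg_Xcell w) (ch (X q w))).
have Iphi : in_L1 leb (fun w => (phi w)%:C%C).
  by apply/in_L1P; split; [exact: intg_phi|exact: intg0].
have mphi : @cmeasurable _ TR R (fun w => (phi w)%:C%C) by case: Iphi.
have [||||||_ [c2r c2i]] := @Cintegral_dct _ _ _ leb (fun n w => k n w * (phi w)%:C%C)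
   (fun w => h (X q w) * (phi w)%:C%C) (fun w => M * phi w).
- by move=> n; exact: cmeasurableM.
- exact: cmeasurableM mhX mphi.
- by apply: aeW => w; apply: cvg_Re; apply: cvgMC; [exact: ck|exact: cvg_cst].
- by apply: aeW => w; apply: cvg_Im; apply: cvgMC; [exact: ck|exact: cvg_cst].
- by apply: intgZ; exact: intg_phi.
- by move=> n w; rewrite cnormM cnorm_real (ger0_norm (phi_ge0 w)) ler_wpM2r ?phi_ge0.
have c2 := cvg_complexP eventually_filter c2r c2i.
rewrite (Cintegral_mu' mhX).2.
apply/cvg_shift2.
have c1 : Cintegral leb (fun w => k n w * (dens L n.+2 w - phi w)%:C%C) @[n --> \oo] --> (0 : R[i]).
  have b : 2 * (M * \int[leb]_w `|dens L n.+2 w - phi w|) @[n --> \oo] --> (0 : R).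
    rewrite -[X in _ --> X](mulr0 (2 : R)); apply: cvgMr.
    rewrite -[X in _ --> X](mulr0 M); apply: cvgMr; exact: cvg_dens_L1.
  apply: squeeze_cvgC b; near=> n.
  have [I1 _] : intg (dens L n.+2) /\ \int[leb]_w dens L n.+2 w = 1.
    apply: (Rintegral_dens q) => //; first exact: L_half.
    by near: n; exact: near_sqnorm_En.
  have Id := intgB I1 (intg_phi R).
  have IdC : in_L1 leb (fun w => (dens L n.+2 w - phi w)%:C%C).
    by apply/in_L1P; split; [exact: Id|exact: intg0].
  have Ik := in_L1_bounded (mk n) (kM n) IdC.
  rewrite sub0r cnormN (le_trans (cnorm_Cintegral_le Ik))// ler_pM2l//.
  have In := integrable_norm Id.
  rewrite -RintegralZl//; apply: le_Rintegral => //.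
  + exact: in_L1_cnorm.
  + exact: (intgZ M In).
  + by move=> w _; rewrite cnormM cnorm_real ler_wpM2r.
have c12 : Cintegral leb (fun w => k n w * (dens L n.+2 w - phi w)%:C%C) +
    Cintegral leb (fun w => k n w * (phi w)%:C%C) @[n --> \oo] -->
    Cintegral leb (fun w => h (X q w) * (phi w)%:C%C).
  by rewrite -[X in _ --> X]add0r; exact: (cvgD c1 c2).
apply: cvg_trans c12; apply: near_eq_cvg; near=> n.
have s0 : 0 < s n.+2 by near: n; exact: near_sqnorm_En.
have [I1 _] := Rintegral_dens q (isT : (1 < n.+2)%N) (L_half n) s0.
have IdC : in_L1 leb (fun w => (dens L n.+2 w - phi w)%:C%C).
  by apply/in_L1P; split; [exact: (intgB I1 (intg_phi R))|exact: intg0].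
rewrite [RHS](integral_n_dens q h (isT : (1 < n.+2)%N) (L_half n) s0).2.
rewrite -(CintegralD (in_L1_bounded (mk n) (kM n) IdC) (in_L1_bounded (mk n) (kM n) Iphi)).
congr Cintegral; apply/funext => w; rewrite /k cell_sumE /dens /Xcell.
case: ifP => _; last by rewrite !mul0r addr0.
by rewrite -mulrDr -(rmorphD (real_complex R)) subrK mulrC.
Unshelve. all: by end_near. Qed.

Lemma lim_c_Sn j : lim_c (Sn R q L) j (2 ^+ j.+1)^-1.
Proof.
apply/cvg_shift2.
have -> : (fun n => sample_c (S n.+2) j) =
    (fun n => (2 ^+ j.+1)^-1 * ((1 - 2 ^- n.+2`!)^-1 * (s n.+2)^-1)).
  by apply/funext => n; rewrite sample_cE mulrA.
have c1 : (1 - 2 ^- n.+2`!)^-1 @[n --> \oo] --> (1 : R).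
  rewrite -[X in _ --> X]invr1; apply: cvgV; first exact: oner_neq0.
  by rewrite -[X in _ --> X]subr0; apply: cvgB; [exact: cvg_cst|exact: cvg_half_pow].
have c2 : (s n.+2)^-1 @[n --> \oo] --> (1 : R).
  rewrite -[X in _ --> X]invr1; apply: cvgV; [exact: oner_neq0|exact: cvg_sqnorm_En].
rewrite -[X in _ --> X]mulr1; apply: cvgMr.
by rewrite -[X in _ --> X]mulr1; exact: (cvgM c1 c2).
Qed.

(** The hypothesis keeps the shifted support inside the range, where the cyclic shift is an honest
    translation. *)
Lemma RS_pow_En n p : (L n < half n)%N -> (L n)%:Z + `|p| < (half n)%:Z ->
  RS_pow n p (En L n) = (fun t => En L n (t - p%:~R / n`!%:R)).
Proof.
move=> Ln Lp; rewrite (En_cell_sum R Ln).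
have [sg sP ->] := RS_pow_cell_sum n p (Ecoef R L n); apply/funext => t.
apply: eq_bigr => i _; have ir := index_range i; have [sr [m e]] := sP _ ir.
move: e sr; rewrite !one_cellE.
have -> : cell_index n (t - p%:~R / n`!%:R) = cell_index n t - p.
  rewrite /cell_index mulrBr [n`!%:R * (_ / _)]mulrC divfK ?fact_neq0//.
  by rewrite floorDrz ?rpredN ?intr_int// -rmorphN intrKfloor.
move: (i%:Z - _) ir (sg _) => l lr x e xr.
(* Only cells with a nonzero coefficient matter, and for these the number [m] of turns is 0. *)
have [->|] := eqVneq (Ecoef R L n l) 0; first by rewrite !mul0r.
rewrite /Ecoef; case: ifP => ll.
  move=> _; congr (_ * _%:R); rewrite e; have -> : m = 0; last by lia.
  by move: xr lr Lp ll; rewrite e /in_range; nia.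
rewrite (_ : (l == 0) = false) ?mulr0 ?addr0 ?eqxx//.
by apply/negbTE; apply/eqP => l0; move: ll; rewrite l0.
Qed.

Lemma E_le_Ebound t : E t <= Ebound t.
Proof.
rewrite /Ebound mulrDl mulrDl; apply: ler_wpDr.
  by rewrite mul1r mulr_ge0 ?gauss_ge0 ?expR_ge0.
rewrite -mulrA ler_wpM2l ?powR_ge0// /gauss -expRD ler_expR.
by have := sqr_ge0 t; lra.
Qed.

Lemma cvg_En_L2 : sqnorm leb (fun t => En L n.+2 t - (E t)%:C%C) @[n --> \oo] --> (0 : R).
Proof.
have [|||||_] := @Rintegral_dct _ _ _ leb (fun n t => cnorm (En L n.+2 t - (E t)%:C%C) ^+ 2)
  (fun=> 0) (fun t => 4 * Ebound t ^+ 2).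
- by move=> n; apply: measurable_sqr_cnorm; exact: cmeasurableB.
- exact: measurable_cst.
- apply: aeW => t.
  have c : cnorm (En L n.+2 t - (E t)%:C%C) @[n --> \oo] --> (0 : R).
    rewrite -[X in _ --> X](@cnorm0 R); apply: cvg_cnormf.
    exact: (cvgC_sub0 eventually_filter (@cvg_En t)).
  by rewrite -[X in _ --> X](mulr0 (0 : R)); exact: (cvgM c c).
- by apply: intgZ; exact: intg_sqr_Ebound.
- move=> n t; rewrite ger0_norm ?sqr_ge0// (le_trans (sqr_cnormD_le _ _))//.
  rewrite cnormN cnorm_real ger0_norm; last by rewrite mulr_ge0 ?expR_ge0 ?powR_ge0.
  have h1 : cnorm (En L n.+2 t) ^+ 2 <= Ebound t ^+ 2.
    by rewrite lerXn2r ?nnegrE ?cnorm_ge0 ?Ebound_ge0// cnorm_En_le.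
  have h2 : E t ^+ 2 <= Ebound t ^+ 2.
    by rewrite lerXn2r ?nnegrE ?Ebound_ge0 ?E_le_Ebound// mulr_ge0 ?expR_ge0 ?powR_ge0.
  lra.
by rewrite Rintegral_cst// mul0r.
Qed.

(** Eventually [L n] and [|q j| n!] are each at most a quarter of [n! ^ 2], so the shift does not
    wrap round. *)
Lemma near_sample_e j : \forall n \near \oo,
  sample_e (S n.+2) j = (fun t => En L n.+2 (t - ratr (q j))).
Proof.
near=> n; rewrite [sample_e _ _]/=.
have fE : (Num.floor (n.+2`!%:R * q j))%:~R = n.+2`!%:R * ratr (q j) :> R.
  by near: n; exact: floor_fact.
rewrite RS_pow_En ?L_half//; last first.
  rewrite -(ltr_int R) intrD intr_norm fE.
  have N1 : 1 <= n.+2`!%:R :> R by rewrite ler1n fact_gt0.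
  have h1 : (L n.+2)%:R / n.+2`!%:R ^+ 2 <= 4^-1 :> R.
    near: n; have /cvgrPdist_le/(_ (4^-1)) : (L n.+2)%:R / n.+2`!%:R ^+ 2 @[n --> \oo] --> (0 : R).
      exact/(cvg_shift2 (fun n => (L n)%:R / n`!%:R ^+ 2 : R)).
    rewrite invr_gt0 ltr0n => /(_ isT); apply: filterS => n.
    by rewrite sub0r normrN ger0_norm// divr_ge0// sqr_ge0.
  have h2 : `|ratr (q j)| * n.+2`!%:R^-1 <= 4^-1 :> R.
    near: n; have /cvgrPdist_le/(_ (4^-1)) : `|ratr (q j)| * n.+2`!%:R^-1 @[n --> \oo] --> (0 : R).
      by rewrite -[X in _ --> X](mulr0 `|ratr (q j)|); apply: cvgMr; exact: cvg_inv_fact.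
    rewrite invr_gt0 ltr0n => /(_ isT); apply: filterS => n.
    by rewrite sub0r normrN; apply: le_trans; exact: ler_norm.
  rewrite -[(L n.+2)%:Z%:~R]/((L n.+2)%:R : R) -[(half n.+2)%:Z%:~R]/((half n.+2)%:R : R) halfE.
  rewrite normrM normr_nat.
  have N0 : 0 < n.+2`!%:R :> R by exact: fact_pos.
  move: h1 h2; rewrite ler_pdivrMr ?exprn_gt0// ler_pdivrMr//.
  move: (n.+2`!%:R : R) N1 N0 => N N1 N0; move: ((L _)%:R) (`|_|) => l r h1 h2; nra.
by apply/funext => t; rewrite fE [n.+2`!%:R * _]mulrC mulfK ?fact_neq0.
Unshelve. all: by end_near. Qed.

Lemma in_L2_sample_e n j : in_L2 leb (sample_e (S n.+2) j).
Proof.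
rewrite /= (En_cell_sum R (L_half n)).
have [sg _ ->] := RS_pow_cell_sum n.+2 (Num.floor (n.+2`!%:R * q j)) (Ecoef R L n.+2).
exact: in_L2_cell_sum.
Qed.

Lemma lim_e_Sn j : lim_e (Sn R q L) j (fun t => (E (t - ratr (q j)))%:C%C).
Proof.
split; first by case: (shifted_E_L (ratr (q j) : R)).
apply/cvg_shift2.
have c : Num.sqrt (sqnorm leb (fun t => En L n.+2 t - (E t)%:C%C)) @[n --> \oo] --> (0 : R).
  rewrite -[X in _ --> X](@sqrtr0 R); apply: cvg_seq_comp; first exact: sqrt_continuous.
  exact: cvg_En_L2.
apply: cvg_trans c; apply: near_eq_cvg; near=> n.
have -> : sample_e (S n.+2) j = (fun t => En L n.+2 (t - ratr (q j))).
  by near: n; exact: near_sample_e.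
congr Num.sqrt; apply/esym.
have [_ LE] := shifted_E_L (0 : R).
have e0 : (fun t : R => (E (t - 0))%:C%C) = (fun t => (E t)%:C%C).
  by apply/funext => t; rewrite subr0.
rewrite e0 in LE; have /in_L2P[_ I] := in_L2B (in_L2_En R (L_half n)) LE.
exact: (Rintegral_shift (- ratr (q j)) I).2.
Unshelve. all: by end_near. Qed.

End sampling_limits.

(** * Bump functions and the momentum operator *)

Section bump.
Variable R : realType.
Implicit Types (k : nat) (s x a : R) (f : R -> R).

(** The extra powers of [s^-1] make the family closed under derivation, up to linear
    combinations. *)
Definition flat k s : R := if 0 < s then s^-1 ^+ k * expR (- s^-1) else 0.

(** The exponential of [y = s^-1] dominates [y ^ (k + 2) / (k + 2)!]. A bound quadratic in [s] is
    what gives the derivative 0 at the origin. *)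
Lemma flat_itv k s : 0 <= flat k s <= k.+2`!%:R * s ^+ 2.
Proof.
rewrite /flat; case: ifPn => s0; last by rewrite lexx mulr_ge0// sqr_ge0.
have y0 : 0 < s^-1 by rewrite invr_gt0.
apply/andP; split; first by rewrite mulr_ge0 ?expR_ge0// exprn_ge0// ltW.
have := expR_ge1Dxn k.+1 (ltW y0); rewrite expRN => h.
rewrite ler_pdivrMr ?expR_gt0//.
have e : s^-1 ^+ k = s ^+ 2 * s^-1 ^+ k.+2.
  have sn0 : s != 0 by rewrite gt_eqF.
  by rewrite -[k.+2]addn2 exprD mulrCA -exprMn divff// expr1n mulr1.
rewrite e (_ : k.+2`!%:R * s ^+ 2 * _ = s ^+ 2 * (k.+2`!%:R * expR s^-1)); last by ring.
apply: ler_wpM2l; first exact: sqr_ge0.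
by rewrite -ler_pdivrMl ?ltr0n ?fact_gt0// mulrC; lra.
Qed.

Lemma flat_le0 k s : s <= 0 -> flat k s = 0.
Proof. by rewrite leNgt /flat => /negbTE ->. Qed.

Lemma is_derive_flat k s : is_derive s 1 (flat k) (- k%:R * flat k.+1 s + flat k.+2 s).
Proof.
case: (ltrgtP s 0) => s0.
- rewrite !flat_le0 ?(ltW s0)// mulr0 addr0.
  have d0 : is_derive s 1 (cst (0 : R)) 0 by exact: is_derive_cst.
  apply: (near_eq_is_derive _ d0).
  near=> x; rewrite flat_le0//; near: x.
  by apply: filterS (lt_nbhsl s0) => x; exact: ltW.
- apply: (@near_eq_is_derive _ _ _ (fun x : R => x^-1 ^+ k * expR (- x^-1))).
    near=> x; rewrite /flat ifT//; near: x; exact: lt_nbhsr.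
  have sn0 : s != 0 by rewrite gt_eqF.
  have dV : is_derive s 1 (fun x : R => x^-1) (- s^-1 ^+ 2).
    have := @is_deriveV R id s 1 1 sn0 (is_derive_id _ _).
    by rewrite /GRing.scale/= mulr1 exprVn.
  rewrite /flat s0.
  have dN : is_derive s 1 (fun x : R => - x^-1) (s^-1 ^+ 2).
    by have := is_deriveN dV; rewrite opprK.
  have dE : is_derive s 1 (fun x : R => expR (- x^-1)) (expR (- s^-1) * s^-1 ^+ 2).
    exact: (@is_derive1_comp R expR (fun x : R => - x^-1)).
  case: k => [|k].
    apply: (@near_eq_is_derive _ _ _ (fun x : R => expR (- x^-1))).
      by near=> x; rewrite expr0 mul1r.
    by apply: is_derive_eq; rewrite oppr0 mul0r add0r mulrC.
  have dX : is_derive s 1 (fun x : R => x^-1 ^+ k.+1) (k.+1%:R * s^-1 ^+ k * (- s^-1 ^+ 2)).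
    have := @is_deriveX _ _ (fun x : R => x^-1) k.+1 s 1 _ dV.
    by rewrite exprfctE.
  apply: (is_derive_eq (is_deriveM dX dE)).
  by rewrite /GRing.scale/= !exprS -!natr1; ring.
- rewrite s0 !flat_le0// mulr0 addr0.
  have c : h^-1 *: (((flat k) \o shift 0) (h *: 1) - flat k 0) @[h --> (0 : R)^'] --> (0 : R).
    apply/cvgrPdist_le => /= e e0.
    pose K : R := k.+2`!%:R.
    have K0 : 0 < K by rewrite ltr0n fact_gt0.
    near=> h; rewrite (@flat_le0 k 0)// subr0 addr0 sub0r normrN /GRing.scale/= mulr1.
    have h0 : h != 0 by near: h; exact: nbhs_dnbhs_neq.
    have he : `|h| <= e / K.
      by near: h; apply: dnbhs0_le; rewrite divr_gt0.
    have /andP[f0 f1] := flat_itv k h.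
    rewrite normrM normfV ler_pdivrMl ?normr_gt0// ger0_norm// (le_trans f1)//.
    rewrite -real_normK ?num_real// expr2 mulrCA ler_wpM2l// -ler_pdivlMl// mulrC//.
  apply: DeriveDef; first by apply/cvg_ex; exists 0.
  exact: (cvg_lim (@norm_hausdorff _ R) c).
Unshelve. all: by end_near. Qed.

(** Smoothness without formulas for higher derivatives: it suffices to find a class of functions
    closed under one derivation. *)
Lemma smooth_stable (C : (R -> R) -> Prop) :
  (forall f, C f -> exists2 g, C g & forall x, is_derive x 1 f (g x)) ->
  forall f, C f -> smooth f.
Proof.
move=> CD f Cf; have Cn n : C (derive1n n f).
  elim: n => [|n ih]; first by rewrite derive1n0.
  rewrite derive1nS; have [g Cg dg] := CD _ ih.
  suff -> : derive1 (derive1n n f) = g by [].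
  by apply/funext => x; rewrite derive1E; case: (dg x).
by move=> n x; have [g _ dg] := CD _ (Cn n); case: (dg x).
Qed.

(** The shape preserved by the product and chain rules: polynomial coefficients absorb the
    derivative of [u]. *)
Inductive flat_span (u : {poly R}) : (R -> R) -> Prop :=
| flat_base (p : {poly R}) k : flat_span u (fun x => p.[x] * flat k u.[x])
| flat_add f g : flat_span u f -> flat_span u g -> flat_span u (fun x => f x + g x).

Lemma smooth_flat_span (u : {poly R}) f : flat_span u f -> smooth f.
Proof.
apply: smooth_stable => {}f; elim=> [p k|f1 f2 _ [g1 s1 d1] _ [g2 s2 d2]].
  exists (fun x => (p^`().[x] * flat k u.[x] + (- k%:R *: (p * u^`())).[x] * flat k.+1 u.[x]) +
    (p * u^`()).[x] * flat k.+2 u.[x]).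
    by apply: flat_add; [apply: flat_add|]; exact: flat_base.
  move=> x; have dg := @is_derive1_comp R (flat k) (horner u) x _ _ (is_derive_flat k u.[x]) (is_derive_poly u x).
  apply: (is_derive_eq (is_deriveM (is_derive_poly p x) dg)).
  by rewrite hornerZ !hornerM /GRing.scale/=; ring.
exists (fun x => g1 x + g2 x); first exact: flat_add.
by move=> x; exact: (is_deriveD (d1 x) (d2 x)).
Qed.

Definition bump a x : R := flat 0 (x * (a - x)).

Lemma smooth_bump a : smooth (bump a).
Proof.
have -> : bump a = (fun x => 1%:P.[x] * flat 0 ('X * (a%:P - 'X)).[x]).
  by apply/funext => x; rewrite !hornerE.
by apply: smooth_flat_span; exact: flat_base.
Qed.

Lemma bump_ge0 a x : 0 <= bump a x.
Proof. by case/andP : (flat_itv 0 (x * (a - x))). Qed.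

Lemma bump_gt0 a x : 0 < x < a -> 0 < bump a x.
Proof.
move=> /andP[x0 xa]; rewrite /bump /flat mulr_gt0 ?subr_gt0// expr0 mul1r; exact: expR_gt0.
Qed.

Lemma bump_eq0 a x : 0 < a -> ~~ (0 < x < a) -> bump a x = 0.
Proof.
move=> a0 xa; rewrite /bump flat_le0// leNgt; apply: contra xa => h.
by apply/andP; split; nra.
Qed.

Lemma Cc_infty_bump a : 0 < a -> Cc_infty (fun x => (bump a x)%:C%C).
Proof.
move=> a0; split => /=; first exact: smooth_bump.
- apply: (@smooth_stable (fun f => f = fun=> 0)) => // f ->; exists (fun=> 0) => // x.
  exact: (@is_derive_cst R R R 0).
- apply: (@subclosed_compact _ _ `[0, a]%classic); [exact: closed_closure|exact: segment_compact|].
  have ci : closed (`[0, a]%classic : set R) by exact: interval_closed.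
  rewrite [X in _ `<=` X]((closure_id _).1 ci).
  apply: closure_subset => x /= nz; rewrite in_itv/=.
  apply: contraNT nz => h; rewrite bump_eq0//; apply: contra h => /andP[h1 h2].
  by rewrite !ltW.
Qed.

End bump.

(** * The momentum operator under the transform *)

Section momentum_transform.
Variable R : realType.
Notation leb := (@lebesgue_measure R).
Notation TR := (measurableTypeR R).
Implicit Types (f g : R -> R) (z : R -> R[i]) (x t w B : R).

(** A Gaussian majorant gives membership in L_1 and in L_2 at once. The constant compensates the
    smallest value of [gauss 1] on [[-|B|, |B|]]. *)
Lemma continuous_compact_gauss f B : continuous f -> (forall x, B < `|x| -> f x = 0) ->
  exists2 C : R, 0 <= C & forall x, `|f x| <= C * gauss 1 x.
Proof.
move=> cf f0; have B1 : - `|B| <= `|B| by rewrite (le_trans _ (normr_ge0 B))// oppr_le0.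
have [c _ cP] := EVT_max B1 (continuous_subspaceT (fun x => continuous_comp (cf x) (@norm_continuous _ R _))).
exists (`|f c| * expR (`|B| ^+ 2)) => [|x]; first by rewrite mulr_ge0 ?expR_ge0.
have [Bx|xB] := ltP `|B| `|x|.
  by rewrite f0 ?normr0 ?mulr_ge0 ?gauss_ge0 ?expR_ge0// (le_lt_trans (ler_norm B)).
apply: (@le_trans _ _ `|f c|); first by apply: cP; rewrite in_itv/= -ler_norml.
rewrite -mulrA ler_peMr// /gauss -expRD -[leLHS]expR0 ler_expR mul1r subr_ge0.
by rewrite -[x ^+ 2]real_normK ?num_real// lerXn2r ?nnegrE.
Qed.

Lemma L12_compact z B : continuous (fun x => complex.Re (z x)) -> continuous (fun x => complex.Im (z x)) ->
  (forall x, B < `|x| -> z x = 0) -> in_L1 leb z /\ in_L2 leb z.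
Proof.
move=> cr ci z0.
have [x /z0 -> //|C C0 hC] := continuous_compact_gauss cr (B := B).
have [x /z0 -> //|D D0 hD] := continuous_compact_gauss ci (B := B).
have mz : @cmeasurable _ TR R z.
  by split; apply: continuous_measurable_fun; [exact: cr|exact: ci].
have b x : cnorm (z x) <= (C + D) * gauss 1 x.
  by rewrite (le_trans (cnorm_le _))// mulrDl lerD.
split; [apply: (@in_L1_le _ _ _ leb _ (fun x => (C + D) * gauss 1 x))|
        apply: (@in_L2_le _ _ _ leb _ (fun x => (C + D) ^+ 2 * gauss 1 x))].
- exact: mz.
- exact: b.
- by apply: intgZ; exact: intg_gauss.
- exact: mz.
- move=> x; apply: (@le_trans _ _ (((C + D) * gauss 1 x) ^+ 2)).
    by rewrite lerXn2r ?nnegrE ?cnorm_ge0// mulr_ge0 ?addr_ge0 ?gauss_ge0.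
  rewrite exprMn ler_wpM2l ?sqr_ge0// expr2 ler_piMl ?gauss_ge0//.
  by rewrite /gauss -[leRHS]expR0 ler_expR oppr_le0 mul1r sqr_ge0.
- by apply: intgZ; exact: intg_gauss.
Qed.

Lemma smooth_continuous f : smooth f -> continuous f.
Proof.
by move=> sf x; apply: differentiable_continuous; apply/derivable1_diffP; exact: (sf 0%N).
Qed.

Lemma smooth_derive1 f : smooth f -> smooth (derive1 f).
Proof. by move=> sf n x; rewrite -derive1Sn. Qed.

Lemma smooth_is_derive f x : smooth f -> is_derive x 1 f (derive1 f x).
Proof. by move=> sf; rewrite derive1E; apply: derivableP; exact: (sf 0%N). Qed.

Lemma Cc_infty_support z : Cc_infty z -> exists B : R, forall x, B < `|x| -> z x = 0.
Proof.
move=> [_ _ /compact_bounded[M [_ MP]]]; exists (M + 1) => x xM.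
apply/eqP; apply: contraTT xM => zx; rewrite -leNgt; apply: (MP (M + 1)).
  by rewrite ltrDl.
exact: subset_closure.
Qed.

Lemma derive1_support f B : (forall x, B < `|x| -> f x = 0) ->
  forall x, B < `|x| -> derive1 f x = 0.
Proof.
move=> f0 x xB; rewrite derive1E.
have d0 : is_derive x 1 (cst (0 : R)) 0 by exact: is_derive_cst.
suff : is_derive x 1 f 0 by case.
apply: (near_eq_is_derive _ d0).
have c := @norm_continuous _ R x.
near=> y; rewrite f0//; near: y.
exact: (cvgr_gt _ c).
Unshelve. all: by end_near. Qed.

Lemma Cc_infty_L12 z : Cc_infty z ->
  (in_L1 leb z /\ in_L2 leb z) /\ (in_L1 leb (momentum z) /\ in_L2 leb (momentum z)).
Proof.
move=> zC; have [B zB] := Cc_infty_support zC; case: zC => sr si _.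
split; first by apply: (L12_compact (B := B)) => //; exact: smooth_continuous.
have mE : momentum z = (fun x => (derive1 (fun y => complex.Im (z y)) x +i*
    - derive1 (fun y => complex.Re (z y)) x)%C).
  apply/funext => x; rewrite /momentum; move: (derive1 _ x) (derive1 _ x) => a b.
  by apply: complexP => /=; ring.
rewrite mE; apply: (L12_compact (B := B)) => /=.
- by apply: smooth_continuous; exact: smooth_derive1.
- by move=> x; apply: cvgN; apply: smooth_continuous; exact: smooth_derive1.
- move=> x xB; rewrite !(derive1_support (B := B))//; last 2 first.
  + by move=> y /zB ->.
  + by move=> y /zB ->.
  by rewrite oppr0.
Qed.

Lemma FT_momentum z w : Cc_infty z ->
  Cintegral leb (fun t => expi (- pi * w * t) * momentum z t) =
  (pi * w)%:C%C * Cintegral leb (fun t => expi (- pi * w * t) * z t).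
Proof.
move=> zC; have [[Iz _] [Im _]] := Cc_infty_L12 zC.
have [B zB] := Cc_infty_support zC; case: (zC) => sr si _.
pose k := - pi * w; rewrite -/k.
pose f x := complex.Re (z x); pose g x := complex.Im (z x).
have df x := smooth_is_derive x sr; have dg x := smooth_is_derive x si.
have dk x : is_derive x 1 (fun x => k * x) k.
  by apply: is_derive_eq; rewrite /GRing.scale/= mulr1.
have dc x : is_derive x 1 (fun x => cos (k * x)) (- sin (k * x) * k).
  exact: (@is_derive1_comp R cos).
have ds x : is_derive x 1 (fun x => sin (k * x)) (cos (k * x) * k).
  exact: (@is_derive1_comp R sin).
have Ie := in_L1_expi k Iz; have Iem := in_L1_expi k Im.
(* As ['i * momentum z] is the derivative of [z], this is the derivative of [expi (k t) * z t],
   whose integral vanishes because [z] has compact support. *)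
pose D t : R[i] := 'i%C * (expi (k * t) * momentum z t) + ('i%C * k%:C%C) * (expi (k * t) * z t).
have ID : in_L1 leb D.
  by apply: in_L1D; exact: in_L1Z.
have /in_L1P[IDr IDi] := ID.
pose f' x := derive1 f x; pose g' x := derive1 g x.
have DrE x : complex.Re (D x) = cos (k * x) * f' x - f x * (sin (k * x) * k) -
    (sin (k * x) * g' x + g x * (cos (k * x) * k)).
  rewrite /D /momentum /expi /f' /g' /f /g; move: (derive1 _ x) (derive1 _ x) (z x) => a b [u v] /=.
  by move: (cos _) (sin _) => c e; ring.
have DiE x : complex.Im (D x) = cos (k * x) * g' x - g x * (sin (k * x) * k) +
    (sin (k * x) * f' x + f x * (cos (k * x) * k)).
  rewrite /D /momentum /expi /f' /g' /f /g; move: (derive1 _ x) (derive1 _ x) (z x) => a b [u v] /=.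
  by move: (cos _) (sin _) => c e; ring.
have dr x : is_derive x 1 (fun x => cos (k * x) * f x - sin (k * x) * g x) (complex.Re (D x)).
  apply: (is_derive_eq (is_deriveB (is_deriveM (dc x) (df x)) (is_deriveM (ds x) (dg x)))).
  by rewrite DrE /GRing.scale/= -/(f x) -/(g x) -/(f' x) -/(g' x); ring.
have di x : is_derive x 1 (fun x => cos (k * x) * g x + sin (k * x) * f x) (complex.Im (D x)).
  apply: (is_derive_eq (is_deriveD (is_deriveM (dc x) (dg x)) (is_deriveM (ds x) (df x)))).
  by rewrite DiE /GRing.scale/= -/(f x) -/(g x) -/(f' x) -/(g' x); ring.
have cont (F d : R -> R) : (forall x, is_derive x 1 F (d x)) -> continuous F.
  by move=> h x; apply: differentiable_continuous; apply/derivable1_diffP; case: (h x).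
have [cc cs] : continuous (fun x => cos (k * x)) /\ continuous (fun x => sin (k * x)).
  by split; [exact: cont dc|exact: cont ds].
have [cf cg] : continuous f /\ continuous g by split; exact: smooth_continuous.
have [cf' cg'] : continuous f' /\ continuous g'.
  by split; apply: smooth_continuous; exact: smooth_derive1.
have cvg0 (u : R -> R) : (forall x, B < `|x| -> u x = 0) ->
    u n%:R @[n --> \oo] --> (0 : R) /\ u (- n%:R) @[n --> \oo] --> (0 : R).
  move=> u0; have c0 : (fun _ : nat => 0 : R) n @[n --> \oo] --> (0 : R) by exact: cvg_cst.
  by split; apply: cvg_trans c0; apply: near_eq_cvg; near=> n; rewrite u0// ?normrN normr_nat;
    near: n; exact: nbhs_infty_gtr.
have D0 : Cintegral leb D = 0.
  have cM (u v : R -> R) : continuous u -> continuous v -> continuous (fun x => u x * v x).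
    by move=> cu cv x; apply: cvgM; [exact: cu|exact: cv].
  have ck : continuous (fun _ : R => k) by move=> x; exact: cvg_cst.
  apply: complexP.
    have Fr0 x : B < `|x| -> cos (k * x) * f x - sin (k * x) * g x = 0.
      by move=> xB; rewrite /f /g zB//= !mulr0 subr0.
    have [c1 c2] := cvg0 _ Fr0.
    apply: (Rintegral_derive0 dr _ IDr c1 c2); rewrite (funext DrE) => x.
    by apply: cvgB; [apply: cvgB|apply: cvgD]; apply: (cM _ _) => //; apply: (cM _ _).
  have Fi0 x : B < `|x| -> cos (k * x) * g x + sin (k * x) * f x = 0.
    by move=> xB; rewrite /f /g zB//= !mulr0 addr0.
  have [c1 c2] := cvg0 _ Fi0.
  apply: (Rintegral_derive0 di _ IDi c1 c2); rewrite (funext DiE) => x.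
  by apply: cvgD; [apply: cvgB|apply: cvgD]; apply: (cM _ _) => //; apply: (cM _ _).
have -> : (fun t => expi (k * t) * momentum z t) =
    (fun t => - 'i%C * D t + (- k)%:C%C * (expi (k * t) * z t)).
  apply/funext => t; rewrite /D; move: (expi _) (momentum z t) (z t) => u v y.
  have i2 : 'i%C * 'i%C = -1 :> R[i] by rewrite -expr2 sqr_i.
  rewrite (_ : (- k)%:C%C = - k%:C%C); last exact: (rmorphN (real_complex R)).
  move: k%:C%C => c; transitivity (- ('i%C * 'i%C) * (u * v) - 'i%C * 'i%C * (c * (u * y)) - c * (u * y)).
    by rewrite i2; ring.
  by move: ('i%C : R[i]) => i; ring.
rewrite (CintegralD (in_L1Z _ ID) (in_L1Z _ Ie)) (CintegralZ _ ID) (CintegralZ _ Ie) D0 mulr0 add0r.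
by congr (_%:C%C * _); rewrite /k mulNr opprK.
Unshelve. all: by end_near. Qed.

Lemma Vmap_momentum z : Cc_infty z ->
  aeeq leb (Vmap (momentum z)) (fun w => (pi * w)%:C%C * Vmap z w).
Proof.
move=> zC; have [[I1 I2] [J1 J2]] := Cc_infty_L12 zC.
apply: (ae_imp2 (Vmap_L1 I1 I2) (Vmap_L1 J1 J2)) => w e1 e2.
by rewrite e1 e2 FT_momentum// mulrCA.
Qed.

(** On the support of the bump the phase stays below [pi / 2] in modulus, so the real part
    integrates a nonnegative function that is positive on []0, a[]. *)
Lemma FT_bump_neq0 (a w : R) : 0 < a -> `|w| * a <= 2^-1 ->
  Cintegral leb (fun t => expi (- pi * w * t) * (bump a t)%:C%C) != 0.
Proof.
move=> a0 wa; have zC := Cc_infty_bump a0; have [[I1 _] _] := Cc_infty_L12 zC.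
apply/negP => /eqP z0.
pose F t : R := cos (- pi * w * t) * bump a t.
have FE t : complex.Re (expi (- pi * w * t) * (bump a t)%:C%C) = F t.
  by rewrite ReM/= mulr0 subr0.
have /in_L1P[IF _] := in_L1_expi (- pi * w) I1.
rewrite (funext FE) in IF.
have F0i : \int[leb]_t F t = 0.
  transitivity (complex.Re (0 : R[i])); last by [].
  by rewrite -z0; apply: eq_Rintegral => t _; rewrite FE.
have cpos t : 0 < t < a -> 0 < cos (- pi * w * t).
  move=> /andP[t0 ta]; apply: cos_gt0_pihalf.
  have pi0 := pi_gt0 R.
  have : `|- pi * w * t| < pi / 2.
    rewrite !normrM normrN (gtr0_norm pi0) (gtr0_norm t0) -mulrA ltr_pM2l//.
    have [->|w0] := eqVneq w 0; first by rewrite normr0 mul0r invr_gt0.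
    by apply: lt_le_trans wa; rewrite ltr_pM2l// normr_gt0.
  by rewrite ltr_norml.
have F0 t : 0 <= F t.
  have [h|h] := boolP (0 < t < a); first by rewrite mulr_ge0 ?bump_ge0// ltW// cpos.
  by rewrite /F bump_eq0// mulr0.
have [N [mN N0 NP]] := Rintegral_eq0_ae IF F0 F0i.
have sub : (`]0, a[%classic : set TR) `<=` N.
  move=> t /=; rewrite in_itv/= => h; apply: NP => /= e.
  by have := mulr_gt0 (cpos t h) (bump_gt0 h); rewrite -/(F t) e ltxx.
have e : leb `]0, a[%classic = a%:E.
  by rewrite lebesgue_measure_itv/= lte_fin a0 -EFinB subr0.
have : (a%:E <= 0)%E.
  by rewrite -e -N0; apply: le_measure sub; rewrite inE; [exact: measurable_itv|exact: mN].
by rewrite lee_fin leNgt a0.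
Qed.


End momentum_transform.

(** * The limit objects *)

Section limit_objects.
Variable R : realType.
Notation leb := (@lebesgue_measure R).
Notation mup := (@mu' R).
Notation TR := (measurableTypeR R).
Notation BQ := (BorelQ R).
Variables (q : nat -> rat) (L : nat -> nat).
Hypothesis q_enum : forall r : rat, exists j : nat, q j = r.
Hypothesis L_range : forall n : nat, (2 <= n)%N -> (0 < L n < n`! ^ 2 - 1)%N.
Hypothesis L_large : (n`!%:R : R) `^ (3 / 2) / (L n)%:R @[n --> \oo] --> (0 : R).
Hypothesis L_small : (L n)%:R / n`!%:R ^+ 2 @[n --> \oo] --> (0 : R).
Notation S := (Sn R q L).

Lemma hat_mu_X_is_hat_mu : is_hat_mu S (hat_mu_X R q).
Proof.
move=> h ch.
rewrite (@Cintegral_X R q (hat_mu_X R q) (fun B mB => erefl) h (cmeasurable_continuous_Q ch)).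
exact: integral_n_cvg.
Qed.

Lemma cvgC_unique (u : nat -> R[i]) (a b : R[i]) :
  u n @[n --> \oo] --> a -> u n @[n --> \oo] --> b -> a = b.
Proof.
move=> ua ub; apply: complexP.
  exact: (cvg_seq_unique (cvg_Re eventually_filter ua) (cvg_Re eventually_filter ub)).
exact: (cvg_seq_unique (cvg_Im eventually_filter ua) (cvg_Im eventually_filter ub)).
Qed.

Lemma hat_mu_pushforward (nu : probability BQ R) : is_hat_mu S nu ->
  forall B : set BQ, measurable B -> nu B = pushforward mup (X q : TR -> BQ) B.
Proof.
move=> nuS B mB; rewrite (@BorelQ_unique R nu (hat_mu_X R q) _ B mB)// => h ch.
exact: (cvgC_unique (nuS h ch) (hat_mu_X_is_hat_mu ch)).
Qed.

(** [is_hat_U] quantifies over every function that is a limit of the [e_j]; this reduces each of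
    them to the shifted Gaussian. *)
Lemma lim_e_unique j (e : R -> R[i]) : lim_e S j e ->
  aeeq leb e (fun t => (E (t - ratr (q j)))%:C%C).
Proof.
move=> [Le ce]; have [LE cE] := lim_e_Sn q L_range L_large L_small j.
have sq (f : R -> R[i]) : L2norm leb (fun t => sample_e (S n) j t - f t) @[n --> \oo] --> (0 : R) ->
    sqnorm leb (fun t => sample_e (S n.+2) j t - f t) @[n --> \oo] --> (0 : R).
  move=> /(cvg_shift2 (fun n => L2norm leb (fun t => sample_e (S n) j t - f t)) 0).2 c.
  rewrite -[X in _ --> X](mulr0 (0 : R)).
  have -> : (fun n => sqnorm leb (fun t => sample_e (S n.+2) j t - f t)) =
      (fun n => L2norm leb (fun t => sample_e (S n.+2) j t - f t) *
                L2norm leb (fun t => sample_e (S n.+2) j t - f t)).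
    by apply/funext => n; rewrite -sqr_L2norm.
  exact: (cvgM c c).
apply: (@L2_limit_unique R (fun n => sample_e (S n.+2) j)) => //.
- by move=> n; exact: in_L2_sample_e.
- exact: sq.
- exact: sq.
Qed.

Variable nu : probability BQ R.
Hypothesis nuX : forall B : set BQ, measurable B -> nu B = pushforward mup (X q : TR -> BQ) B.

(** The existence of [hat_U]: since [X_inv] undoes [X], each clause pulls back along [X] to the
    corresponding property of [Vmap]. *)
Lemma hat_U_X_inv : is_hat_U S nu (fun g => Vmap g \o X_inv q_enum).
Proof.
split; first exact: (L2isometry_X_inv q_enum nuX (Vmap_isometry R)).
move=> j e c le lc.
have Le : in_L2 leb e by case: le.
have [_ LE] := shifted_E_L (ratr (q j) : R).
have hc := (@cvg_seq_unique R (fun n => sample_c (S n) j) _ _ lc (@lim_c_Sn R q L L_range L_large j)).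
rewrite hc => {hc}.
apply: (aeeq_X nuX).
- exact: (cmeasurable_comp (measurable_X_inv q_enum) (cmeasurable_Vmap Le)).
- apply: cmeasurableM; first exact: cmeasurable_cst.
  exact: (cmeasurable_continuous_Q (@proj_Q_continuous R j)).
have [_ Vae _] := Vmap_linear R.
apply: (ae_imp2 (Vae _ _ Le LE (lim_e_unique le)) (Vmap_shifted_E (ratr (q j) : R))) => w /= e1 e2.
rewrite X_invK e1 e2 projX mulrA -(rmorphM (real_complex R)) -invfM.
by rewrite sqrtrV ?exprn_ge0// mulVf ?invr1 ?mul1r.
Qed.

Variable hat_U : (R -> R[i]) -> (Q R -> R[i]).
Hypothesis hat_UP : is_hat_U S nu hat_U.
Notation U := (fun g : R -> R[i] => hat_U g \o X q).

Lemma hat_U_Vmap f : in_L2 leb f -> aeeq mup (U f) (Vmap f).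
Proof.
case: hat_UP => iso Ue; apply: (Vmap_unique (L2isometry_X nuX iso)) => r.
have [j <-] := q_enum r.
have := Ue j _ _ (lim_e_Sn q L_range L_large L_small j) (@lim_c_Sn R q L L_range L_large j).
move=> /(ae_X nuX) h; apply: (ae_imp h) => w /= ->.
by rewrite projX mulrA -(rmorphM (real_complex R)) sqrtrV ?exprn_ge0// invrK divff ?mul1r.
Qed.

Lemma hat_U_unitary : L2unitary leb mup U.
Proof.
have iso := L2isometry_X nuX hat_UP.1.
split; [exact: iso.1|exact: L2isometry_inner iso|].
move=> h Lh; have [_ _ /(_ h Lh)[f Lf fh]] := Vmap_unitary R.
by exists f => //; apply: (ae_imp2 (hat_U_Vmap Lf) fh) => w -> ->.
Qed.

Lemma hat_U_momentum z : Cc_infty z ->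
  aeeq mup (U (momentum z)) (fun w => (pi * w)%:C%C * U z w).
Proof.
move=> zC; have [[_ Lz] [_ Lm]] := Cc_infty_L12 zC.
have h := hat_U_Vmap Lz.
have k := ae_leb_mu' (Vmap_momentum zC).
apply: (ae_imp2 (ae_imp2 h k (fun w e1 e2 => conj e1 e2)) (hat_U_Vmap Lm)) => w [e1 e2] e3.
by rewrite e3 e2 e1.
Qed.

Lemma in_L2_mul_pi : in_L2 mup (fun w : R => (pi * w)%:C%C).
Proof.
have mp : @measurable_fun _ _ TR R setT (fun w => pi * w).
  by apply: measurable_funM; [exact: measurable_cst|exact: measurable_id].
apply/in_L2P; split; first exact: cmeasurable_real.
apply/(Rintegral_mu' (measurable_sqr_cnorm (cmeasurable_real mp))).1.
have -> : (fun w : R => cnorm ((pi * w)%:C%C : R[i]) ^+ 2 * phi w) =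
    (fun w => (pi ^+ 2 * Num.sqrt (pi / 2)) * (w ^+ 2 * gauss (pi ^+ 2 / 2) w)).
  apply/funext => w; rewrite cnorm_real real_normK ?num_real// phi_gauss exprMn.
  by rewrite mulrACA.
by apply: intgZ; apply: intg_sqr_gauss; rewrite divr_gt0// exprn_gt0// pi_gt0.
Qed.

Lemma hat_m_X_inv : is_hat_m (@Cc_infty R) (@momentum R) nu hat_U (fun x => pi * X_inv q_enum x).
Proof.
have mm : @cmeasurable _ BQ R (fun x => (pi * X_inv q_enum x)%:C%C).
  apply: cmeasurable_real; apply: measurable_funM; first exact: measurable_cst.
  exact: measurable_X_inv.
have eX : (fun x => (pi * X_inv q_enum x)%:C%C) \o X q = (fun w : R => (pi * w)%:C%C).
  by apply/funext => w /=; rewrite X_invK.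
split; first by apply/(in_L2_X nuX mm).1; rewrite eX; exact: in_L2_mul_pi.
move=> z zC; have [[_ Lz] [_ Lm]] := Cc_infty_L12 zC; case: hat_UP => -[[UL _ _] _] _.
apply: (aeeq_X nuX).
- exact: (UL _ Lm).1.
- by apply: cmeasurableM => //; exact: (UL _ Lz).1.
apply: (ae_imp (hat_U_momentum zC)) => w /= ->; by rewrite X_invK.
Qed.

(* For every w some bump has a nonvanishing transform at w, and the bumps of width
   1 / (k + 1) are countably many. *)
Lemma hat_m_unique (m : Q R -> R) :
  is_hat_m (@Cc_infty R) (@momentum R) nu hat_U m ->
  {ae leb, forall w : R, (m \o X q) w = pi * w}.
Proof.
move=> [_ mP]; pose b (k : nat) (x : R) : R[i] := (bump k.+1%:R^-1 x)%:C%C.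
have bC k : Cc_infty (b k) by apply: Cc_infty_bump; rewrite invr_gt0.
have step k : {ae leb, forall w : R, `|w| * k.+1%:R^-1 <= 2^-1 -> (m \o X q) w = pi * w}.
  have [[I1 L2] _] := Cc_infty_L12 (bC k).
  have h1 := ae_mu'_leb (ae_X nuX (mP _ (bC k))).
  have h2 := ae_mu'_leb (hat_U_momentum (bC k)).
  have h3 := ae_mu'_leb (hat_U_Vmap L2).
  have h4 := Vmap_L1 I1 L2.
  apply: (ae_imp2 (ae_imp2 h1 h2 (fun w e1 e2 => conj e1 e2))
                  (ae_imp2 h3 h4 (fun w e1 e2 => conj e1 e2))) => w [e1 e2] [e3 e4] wk.
  have nz : U (b k) w != 0.
    rewrite e3 e4 mulf_neq0//; last by apply: FT_bump_neq0 => //; rewrite invr_gt0.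
    by rewrite (fmorph_eq0 (real_complex R)) invr_eq0 gt_eqF// sqrtr_gt0 mulr_gt0// phi_gt0.
  have := e2; rewrite /= e1 => /(mulIf nz) /(congr1 (@complex.Re R)) //.
apply: (ae_imp (ae_foralln step)) => w all_k.
(* For this index [k + 1] exceeds [2 |w|], so the bump is narrow enough for [w]. *)
apply: (all_k (Num.truncn (2 * `|w|))).
rewrite ler_pdivrMr ?ltr0n// -ler_pdivrMl ?invr_gt0// invrK.
exact/ltW/truncnS_gt.
Qed.

End limit_objects.

Theorem theorem8p1 (R : realType)
  (q : nat -> rat) (q_enum : forall r : rat, exists j : nat, q j = r)
  (q0 : q 0%N = 0)
  (L : nat -> nat)
  (L_range : forall n : nat, (2 <= n)%N -> (0 < L n < n`! ^ 2 - 1)%N)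
  (L_large : (n`!%:R : R) `^ (3 / 2) / (L n)%:R @[n --> \oo] --> (0 : R))
  (L_small : (L n)%:R / n`!%:R ^+ 2 @[n --> \oo] --> (0 : R)) :
  let S := Sn R q L in
  let mu := @lebesgue_measure R in
  convergent S /\
  (exists hat_mu : probability (BorelQ R) R, is_hat_mu S hat_mu) /\
  forall hat_mu : probability (BorelQ R) R, is_hat_mu S hat_mu ->
    (forall B : set (BorelQ R), measurable B ->
       hat_mu B = pushforward (@mu' R) (X q : _ -> BorelQ R) B) /\
    (exists hat_U, is_hat_U S hat_mu hat_U) /\
    forall hat_U, is_hat_U S hat_mu hat_U ->
      let U := fun g : R -> R[i] => hat_U g \o X q in
      L2unitary mu (@mu' R) U /\
      (forall psi : R -> R[i], in_L2 mu psi -> in_L1 mu psi ->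
         {ae mu, forall w : R,
           U psi w = (Num.sqrt (2 * phi w))^-1%:C%C *
             Cintegral mu (fun t => expi (- pi * w * t) * psi t)}) /\
      (exists hat_m, is_hat_m (@Cc_infty R) (@momentum R) hat_mu hat_U hat_m) /\
      forall hat_m,
        is_hat_m (@Cc_infty R) (@momentum R) hat_mu hat_U hat_m ->
        let m := hat_m \o X q in
        {ae mu, forall w : R, m w = pi * w} /\
        forall z : R -> R[i], Cc_infty z ->
          aeeq (@mu' R) (U (momentum z)) (fun w => (m w)%:C%C * U z w).
Proof.
move=> S mu; split.
  move=> h ch; apply/cvg_ex; exists (Cintegral (@mu' R) (h \o X q)).
  exact: integral_n_cvg.
split; first by exists (hat_mu_X R q); exact: hat_mu_X_is_hat_mu.
move=> nu nuS; have nuX := hat_mu_pushforward L_range L_large nuS.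
split; first exact: nuX.
split; first by exists (fun g => Vmap g \o X_inv q_enum); exact: hat_U_X_inv.
move=> hat_U hU U.
split; first exact: (hat_U_unitary q_enum L_range L_large L_small nuX hU).
split.
  move=> psi L2psi L1psi.
  have h := ae_mu'_leb (hat_U_Vmap q_enum L_range L_large L_small nuX hU L2psi).
  by apply: (ae_imp2 h (Vmap_L1 L1psi L2psi)) => w e1 e2; rewrite /U e1.
split; first by exists (fun x => pi * X_inv q_enum x); exact: (hat_m_X_inv q_enum L_range L_large L_small nuX hU).
move=> hat_m hm m; split; first exact: (hat_m_unique q_enum L_range L_large L_small nuX hU hm).
by move=> z zC; exact: (ae_X nuX (hm.2 z zC)).
Qed.
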